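(* Let $k\ge 3$. Given any $\mathcal{T}\in\mathbb{T}(\mathcal{T}_0)$ and any refinement $\hat{\mathcal{T}}\in\mathbb{T}(\mathcal{T}_0)$ of $\mathcal{T}$ (by newest vertex bisection), the extended stress spaces satisfy $\widetilde{\Sigma(\mathcal{T})}\subset\widetilde{\Sigma(\hat{\mathcal{T}})}$.
   Context: $\Omega\subset\mathbb{R}^2$ is a simply-connected bounded polygonal domain; $\mathbb{S}$ is the space of symmetric real $2\times2$ matrices; $H(\mathrm{div},\Omega;\mathbb{S})$ is the space of square-integrable symmetric matrix fields with square-integrable (row-wise) divergence. $k\ge3$ is a fixed integer; $P_m(K;X)$ is the space of $X$-valued polynomials of total degree at most $m$ on $K$. Meshes: $\mathcal{T}_0$ is an initial shape-regular (conforming) triangulation of $\Omega$ and $\mathbb{T}=\mathbb{T}(\mathcal{T}_0)$ is the set of all admissible regular triangulations obtained from $\mathcal{T}_0$ by finitely many successive newest vertex bisections. For $\hat{\mathcal{T}}\in\mathbb{T}$, $\mathcal{V}(\hat{\mathcal{T}})$ is its set of vertices and $\mathcal{V}_0(\hat{\mathcal{T}})$ its set of internal vertices. Each vertex $x_e\in\mathcal{V}(\hat{\mathcal{T}})\setminus\mathcal{V}(\mathcal{T}_0)$ was created by newest vertex bisection as the midpoint of some (coarser) edge $e$, with unit tangential vector $t_e$ and unit normal vector $n_e=t_e^\perp$. For $x_e\in\mathcal{V}_0(\hat{\mathcal{T}})\setminus\mathcal{V}(\mathcal{T}_0)$, with $\mathrm{mid}(K)$ the barycentre of $K$, let $\omega^{\pm}_{x_e}$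 be the union of all $K\in\hat{\mathcal{T}}$ with $x_e\in K$ and $\pm(\mathrm{mid}(K)-x_e)\cdot n_e>0$. Spaces: for a triangle $K$ with vertices $x_1,x_2,x_3$, barycentric coordinates $\lambda_i$, and $t_{i,j}=x_j-x_i$, set $\Sigma_{k,b}(K)=\sum_{1\le i<j\le3}\lambda_i\lambda_jP_{k-2}(K;\mathbb{R})\,t_{i,j}t_{i,j}^T$. Then $\Sigma(\hat{\mathcal{T}})=\{\sigma\in H(\mathrm{div},\Omega;\mathbb{S}) : \sigma=\sigma_c+\sigma_b,\ \sigma_c\in H^1(\Omega;\mathbb{S}),\ \sigma_c|_K\in P_k(K;\mathbb{S}),\ \sigma_b|_K\in\Sigma_{k,b}(K)\ \forall K\in\hat{\mathcal{T}}\}$. Let $\varphi_{x_e}$ be the nodal basis function at $x_e$ of the scalar continuous Lagrange element of order $k$ on $\hat{\mathcal{T}}$; let $\varphi^{\pm}_{x_e}$ equal $\varphi_{x_e}$ on $\omega^{\pm}_{x_e}$ and $0$ elsewhere, and $\tau^{\pm}_{x_e}=\varphi^{\pm}_{x_e}t_et_e^T$. Put $E(\hat{\mathcal{T}})=\mathrm{span}\{\tau^+_{x_e},\tau^-_{x_e} : x_e\in\mathcal{V}_0(\hat{\mathcal{T}})\setminus\mathcal{V}(\mathcal{T}_0)\}$. The extended stress space is $\widetilde{\Sigma(\hat{\mathcal{T}})}=\Sigma(\hat{\mathcal{T}})+E(\hat{\mathcal{T}})\subset H(\mathrm{div},\Omega;\mathbb{S})$. All notation applies to any triangulation in $\mathbb{T}$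 (in particular to $\mathcal{T}$). *)

(* Defs.v *)
From HB Require Import structures.
From mathcomp Require Import all_boot all_order all_algebra finmap.
From mathcomp Require Import all_classical all_reals all_analysis.
Set Implicit Arguments.
Unset Strict Implicit.
Unset Printing Implicit Defensive.
Import Order.TTheory GRing.Theory Num.Theory.
Import numFieldNormedType.Exports.
Local Open Scope classical_set_scope.
Local Open Scope ring_scope.

(* Analysis in this development is classical MathComp-Analysis over an
   arbitrary [R : realType].  Fields on [Omega] are represented by total
   functions on the plane, of which only the values a.e. on [Omega] matter:
   elements of L2-type spaces are Borel representatives of their classes, and
   the sum of spaces at the end is closed under a.e. equality on [Omega]. *)

Notation plane R := (R * R)%type.

Section Plane.
Variable R : realType.
Implicit Types (x y z u v t : plane R) (A : set (plane R)).

Definition cart x (i : 'I_2) : R := if i == ord0 then x.1 else x.2.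

Definition unit_vec (i : 'I_2) : plane R := ((i == ord0)%:R, (i == ord_max)%:R).

Definition dot u v : R := u.1 * v.1 + u.2 * v.2.

(* The norm of the normed module [R * R] is the sup norm, so the Euclidean one
   is spelled out. *)
Definition enorm v : R := Num.sqrt (dot v v).

Definition perp t : plane R := (- t.2, t.1).

Definition dyad t : 'M[R]_2 := \matrix_(i, j) (cart t i * cart t j).

Definition midpoint x y : plane R := 2^-1 *: (x + y).

Definition segment x y : set (plane R) :=
  [set (1 - s) *: x + s *: y | s in `[0, 1]].

Definition lebesgue2 : {measure set (measurableTypeR R * measurableTypeR R) -> \bar R} :=
  (@lebesgue_measure R \x @lebesgue_measure R)%E.

End Plane.

Section Domain.
Variable R : realType.
Implicit Type Omega : set (plane R).

(* Vertices [p i] of a simple closed polygon, in cyclic order: distinct sides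
   meet only when consecutive, and then only in their common vertex. *)
Definition simple_polygon n (p : 'I_n -> plane R) : Prop :=
  [/\ (2 < n)%N, injective p &
      forall i j, i != j ->
        segment (p i) (p (ordS i)) `&` segment (p j) (p (ordS j)) =
        [set x | (j = ordS i /\ x = p j) \/ (i = ordS j /\ x = p i)]].

Definition polygon_trace n (p : 'I_n -> plane R) : set (plane R) :=
  \bigcup_i segment (p i) (p (ordS i)).

(* Bounded domain whose boundary consists of finitely many pairwise disjoint
   simple closed polygons. *)
Definition bounded_polygonal_domain Omega : Prop :=
  [/\ Omega !=set0, open Omega, connected Omega, bounded_set Omega &
      exists N (n : 'I_N -> nat) (p : forall j, 'I_(n j) -> plane R),
        [/\ forall j, simple_polygon (p j),
            forall i j, i != j ->
              polygon_trace (p i) `&` polygon_trace (p j) = set0 &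
            closure Omega `\` Omega = \bigcup_j polygon_trace (p j)]].

Definition simply_connected Omega : Prop :=
  forall gamma : R -> plane R,
    {within `[0, 1], continuous gamma} ->
    (forall s, s \in `[0, 1] -> Omega (gamma s)) ->
    gamma 0 = gamma 1 ->
  exists H : R * R -> plane R,
    [/\ {within `[0, 1]%classic `*` `[0, 1]%classic, continuous H},
        forall s r, s \in `[0, 1] -> r \in `[0, 1] -> Omega (H (s, r)),
        forall s, s \in `[0, 1] -> H (s, 0) = gamma s /\ H (s, 1) = gamma 0 &
        forall r, r \in `[0, 1] -> H (0, r) = gamma 0 /\ H (1, r) = gamma 0].

End Domain.

Section FunctionSpaces.
Variables (R : realType) (Omega : set (plane R)).
Implicit Types (f g phi : plane R -> R) (sigma : plane R -> 'M[R]_2).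

Local Notation mu := (lebesgue2 R).

Definition L2 f : Prop := f \_ Omega \in Lfun mu 2%:E.

Definition partial (i : 'I_2) f : plane R -> R := 'D_(unit_vec R i) f.

Definition smooth f : Prop :=
  forall (s : seq 'I_2) x, differentiable (foldr partial f s) x.

(* C^oo functions with compact support in [Omega] *)
Definition test_function phi : Prop :=
  smooth phi /\
  exists A : set (plane R), [/\ compact A, A `<=` Omega & forall x, ~ A x -> phi x = 0].

Definition weak_partial (i : 'I_2) f g : Prop :=
  forall phi, test_function phi ->
    \int[mu]_(x in Omega) (f x * partial i phi x) =
    - \int[mu]_(x in Omega) (g x * phi x).

Definition H1 f : Prop :=
  L2 f /\ forall i, exists2 g, L2 g & weak_partial i f g.

Definition ae_symmetric sigma : Prop :=
  \forall x \ae mu, Omega x -> (sigma x)^T = sigma x.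

Definition H1_sym sigma : Prop :=
  ae_symmetric sigma /\ forall i j, H1 (fun x => sigma x i j).

(* [g] is the weak divergence of row [i] of [sigma]. *)
Definition weak_row_div sigma (i : 'I_2) g : Prop :=
  forall phi, test_function phi ->
    \int[mu]_(x in Omega) (\sum_j sigma x i j * partial j phi x) =
    - \int[mu]_(x in Omega) (g x * phi x).

Definition Hdiv_sym sigma : Prop :=
  [/\ ae_symmetric sigma,
      forall i j, L2 (fun x => sigma x i j) &
      forall i, exists2 g, L2 g & weak_row_div sigma i g].

End FunctionSpaces.

Section Polynomials.
Variable R : realType.

(* real polynomials of total degree at most [m] *)
Definition poly_fun (m : nat) (p : plane R -> R) : Prop :=
  exists c : nat -> nat -> R, forall x,
    p x = \sum_(i < m.+1) \sum_(j < m.+1 | (i + j <= m)%N)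
            c i j * x.1 ^+ i * x.2 ^+ j.

Definition poly_fun_sym (m : nat) (p : plane R -> 'M[R]_2) : Prop :=
  (forall x, (p x)^T = p x) /\ forall i j, poly_fun m (fun x => p x i j).

End Polynomials.

(* A triangle is the triple of its vertices.  Vertex [0] is the newest vertex
   and the opposite edge, joining vertices [1] and [2], is the refinement
   edge. *)
Notation triangle R := (3.-tuple (plane R)).
Notation mesh R := {fset triangle R}.

Section Triangulations.
Variable R : realType.
Implicit Types (K : triangle R) (T S : mesh R) (x y z : plane R)
  (Omega : set (plane R)).

Definition vtx K (i : 'I_3) : plane R := tnth K i.

(* twice the signed area of the triangle [x y z] *)
Definition area2 x y z : R :=
  (y.1 - x.1) * (z.2 - x.2) - (y.2 - x.2) * (z.1 - x.1).

Definition nondegenerate_tri K : Prop := area2 (vtx K 0) (vtx K 1) (vtx K 2) != 0.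

Definition tri K : set (plane R) :=
  [set x | exists w : 'I_3 -> R,
     [/\ forall i, 0 <= w i, \sum_i w i = 1 & x = \sum_i w i *: vtx K i]].

(* barycentric coordinates of [x] by Cramer's rule; indices are added modulo 3 *)
Definition bary K (i : 'I_3) x : R :=
  area2 x (vtx K (i + 1)) (vtx K (i + 2)) /
  area2 (vtx K i) (vtx K (i + 1)) (vtx K (i + 2)).

Definition mid K : plane R := 3^-1 *: \sum_i vtx K i.

Definition conforming T : Prop :=
  forall K K', K \in T -> K' \in T -> K != K' ->
    [\/ tri K `&` tri K' = set0,
        exists2 x, x \in K /\ x \in K' & tri K `&` tri K' = [set x] |
        exists x y, [/\ x != y, x \in K /\ x \in K', y \in K /\ y \in K' &
                        tri K `&` tri K' = segment x y]].

Definition mesh_union T : set (plane R) := \bigcup_(K in [set` T]) tri K.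

(* Shape regularity of one fixed finite mesh is nondegeneracy. *)
Definition triangulation Omega T : Prop :=
  [/\ forall K, K \in T -> nondegenerate_tri K, conforming T &
      mesh_union T = closure Omega].

Definition vertices T : set (plane R) :=
  [set x | exists2 K, K \in T & x \in K].

Definition internal_vertices Omega T : set (plane R) := vertices T `&` Omega.

Definition ref_midpoint K : plane R := midpoint (vtx K 1) (vtx K 2).

(* newest vertex bisection of [K]: the midpoint of its refinement edge becomes
   the newest vertex of both children *)
Definition child1 K : triangle R := [tuple ref_midpoint K; vtx K 0; vtx K 1].
Definition child2 K : triangle R := [tuple ref_midpoint K; vtx K 0; vtx K 2].

Definition bisect K T : mesh R :=
  ((T `\ K) `|` [fset child1 K; child2 K])%fset.

(* Intermediate meshes may have hanging nodes. *)
Inductive nvb_refine : mesh R -> mesh R -> Prop :=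
| nvb_refl T : nvb_refine T T
| nvb_step T K T' : K \in T -> nvb_refine (bisect K T) T' -> nvb_refine T T'.

(* the admissible meshes generated from the initial triangulation [T0] *)
Definition admissible Omega (T0 T : mesh R) : Prop :=
  nvb_refine T0 T /\ triangulation Omega T.

(* In the course of a refinement of [T0] into [T], the vertex [x] arises by
   bisection of an edge with endpoints [a] and [b]. *)
Definition created T0 T x a b : Prop :=
  exists S K, [/\ nvb_refine T0 S, K \in S, nvb_refine (bisect K S) T,
                  a = vtx K 1 /\ b = vtx K 2 & x = ref_midpoint K].

End Triangulations.

Section StressSpaces.
Variables (R : realType) (k : nat) (Omega : set (plane R)).
Implicit Types (K : triangle R) (T : mesh R) (x a b : plane R)
  (phi : plane R -> R) (sigma tau : plane R -> 'M[R]_2).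

Local Notation mu := (lebesgue2 R).

(* the H(div) edge-bubble space Sigma_{k,b}(K) *)
Definition bubble K sigma : Prop :=
  exists2 p : 'I_3 -> 'I_3 -> plane R -> R,
    forall i j, poly_fun (k - 2) (p i j) &
    forall x, sigma x = \sum_(i < 3) \sum_(j < 3 | (i < j)%N)
      (bary K i x * bary K j x * p i j x) *: dyad (vtx K j - vtx K i).

Definition stress_space T : set (plane R -> 'M[R]_2) :=
  [set sigma | Hdiv_sym Omega sigma /\
    exists sigma_c sigma_b,
    [/\ sigma = sigma_c \+ sigma_b %[ae mu in Omega],
        H1_sym Omega sigma_c,
        forall K, K \in T -> exists2 p,
          poly_fun_sym k p & sigma_c = p %[ae mu in tri K] &
        forall K, K \in T -> exists2 p,
          bubble K p & sigma_b = p %[ae mu in tri K]]].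

(* nodes of the Lagrange element of order [k] on [K] *)
Definition lagrange_node K : set (plane R) :=
  [set z | exists2 a : 'I_3 -> nat, (\sum_i a i)%N = k &
     z = \sum_i ((a i)%:R / k%:R) *: vtx K i].

Definition nodal_basis T x phi : Prop :=
  [/\ {within mesh_union T, continuous phi},
      forall K, K \in T -> exists2 p, poly_fun k p & {in tri K, phi =1 p} &
      forall K z, K \in T -> lagrange_node K z -> phi z = (z == x)%:R].

Definition tangent a b : plane R := (enorm (b - a))^-1 *: (b - a).

(* The half patch of [x] on the side of the edge [a b] towards which
   [(-1) ^+ s * n_e] points; [s = false] is the positive side. *)
Definition half_patch T x a b (s : bool) : set (plane R) :=
  \bigcup_(K in [set K | [/\ K \in T, tri K x &
      0 < (-1) ^+ s * dot (mid K - x) (perp (tangent a b))]]) tri K.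

Definition extra_fields (T0 T : mesh R) : set (plane R -> 'M[R]_2) :=
  [set tau | exists x a b phi (s : bool),
    [/\ (internal_vertices Omega T `\` vertices T0) x,
        created T0 T x a b,
        nodal_basis T x phi &
        tau = fun y => (phi \_ (half_patch T x a b s)) y *: dyad (tangent a b)]].

Definition lin_span (A : set (plane R -> 'M[R]_2)) : set (plane R -> 'M[R]_2) :=
  [set sigma | exists n (c : 'I_n -> R) (f : 'I_n -> plane R -> 'M[R]_2),
    (forall i, A (f i)) /\ forall x, sigma x = \sum_i c i *: f i x].

Definition extended_stress_space (T0 T : mesh R) :
    set (plane R -> 'M[R]_2) :=
  [set sigma | exists2 sigma1, stress_space T sigma1 &
    exists2 sigma2, lin_span (extra_fields T0 T) sigma2 &
      sigma = sigma1 \+ sigma2 %[ae mu in Omega]].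

End StressSpaces.

(* Main.v *)
(* Fix a direction [t] and consider fields [g * dyad t] with [g] piecewise
   polynomial on the mesh.  Call the pieces of [g] conforming if they agree
   across the edges that are not parallel to [t] and if, at each vertex, they are
   single valued or take one value on either side of the line through the vertex
   along [t]; the latter only at interior vertices that were created as the
   midpoint of an edge parallel to [t].  The edge bubbles and the extra fields
   are of this form.

   Restricting the pieces to a refinement keeps them conforming: at a new vertex
   [g] is discontinuous only if the vertex lies inside an edge parallel to [t], and
   then it is the midpoint of a bisected edge on the same line.  That vertex is
   interior because a neighbourhood of it is covered by the two triangles at the
   edge, while by a crossing parity argument the boundary of [Omega] contains no
   interior point of its closure.

   Conversely, conforming fields lie in the extended space of their own mesh.
   Multiples of the extra fields remove the jumps at the vertices.  Then, on each
   edge parallel to [t], a bubble replaces the trace from either side by its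
   linear interpolant, which is single valued, and what remains is continuous,
   hence in H^1. *)

Require Import Defs.
From HB Require Import structures.
From mathcomp Require Import all_boot all_order all_algebra finmap.
From mathcomp Require Import all_classical all_reals all_analysis.
From mathcomp Require Import measurable_realfun ring lra zify.
Set Implicit Arguments.
Unset Strict Implicit.
Unset Printing Implicit Defensive.
Import Order.TTheory GRing.Theory Num.Theory.
Import numFieldNormedType.Exports.
Local Open Scope classical_set_scope.
Local Open Scope ring_scope.

(** The divergence of [g] times [dyad t] involves only the derivative of [g] along [t], so
    integration by parts is needed in one direction at a time. It is obtained without traces and
    without a divergence theorem: by translation invariance the integral of a difference quotient
    vanishes, and for a function that is Lipschitz along almost all lines parallel to [t] the limit
    may be taken under the integral. A jump across an edge parallel to [t] is harmless because
    almost all of these lines miss the edge.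

    A chain of bisections passes through meshes with hanging nodes, while a vertex is created
    somewhere inside such a chain. Conformity is therefore at hand for [T0], [T] and [That] only;
    nondegeneracy of the triangles and disjointness of their interiors are what every bisection
    preserves, and the geometry at a created vertex has to be drawn from these two.

    Families of pieces indexed by triangles, and not functions on the plane, carry the argument: a
    discontinuous field has several values at a shared vertex, and each of them must be
    accessible. *)

Section PlaneMeasure.
Variable R : realType.
Local Notation mu1 := (@lebesgue_measure R).
Local Notation mu := (lebesgue2 R).
Local Notation pl := (measurableTypeR R * measurableTypeR R)%type.

(** * Translation invariance, measurability and null lines in the plane *)

Lemma lebesgue_measureD (a : R) (A : set R) : measurable A ->
  pushforward mu1 (fun x : measurableTypeR R => x + a : measurableTypeR R) A
  = mu1 A.
Proof.
move=> mA; apply/esym/lebesgue_measure_unique => //=.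
  by apply: measurable_funD => //; exact: measurable_id.
move=> mf _ [[b c]] _ <-.
rewrite /pushforward.
have -> : (fun x : measurableTypeR R => x + a : measurableTypeR R) @^-1`
    [set` Interval (BRight b) (BRight c)] =
    [set` Interval (BRight (b - a)) (BRight (c - a))].
  apply/seteqP; split=> x /=; rewrite !in_itv/=; lra.
rewrite !lebesgue_measure_itv/= !lte_fin ltrD2r.
by case: ifP => // _; congr EFin; ring.
Qed.

Lemma lebesgue2D (v : plane R) (A : set pl) : measurable A ->
  pushforward mu (fun x : pl => x + v : pl) A = mu A.
Proof.
move=> mA; apply/esym/product_measure_unique => //=.
  apply/measurable_fun_pairP; split.
    by apply: measurable_funD => //; exact: measurable_fst.
  by apply: measurable_funD => //; exact: measurable_snd.
move=> mf B C mB mC.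
rewrite /pushforward/=.
have -> : (fun x : pl => x + v : pl) @^-1` (B `*` C) =
  ((fun x => x + v.1) @^-1` B) `*` ((fun x => x + v.2) @^-1` C) by [].
rewrite /lebesgue2 product_measure1E; last 2 first.
- by rewrite -[X in measurable X]setTI; apply: measurable_funD.
- by rewrite -[X in measurable X]setTI; apply: measurable_funD.
by congr (_ * _)%E; [exact: lebesgue_measureD | exact: lebesgue_measureD].
Qed.

Lemma integral_lebesgue2D (v : plane R) (f : pl -> R) :
  mu.-integrable setT (EFin \o f) ->
  mu.-integrable setT (EFin \o (fun x => f (x + v))) /\
  \int[mu]_x f (x + v) = \int[mu]_x f x.
Proof.
move=> fi.
pose tr (x : pl) : pl := x + v.
have mphi : measurable_fun setT tr.
  apply/measurable_fun_pairP; split.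
    by apply: measurable_funD => //; exact: measurable_fst.
  by apply: measurable_funD => //; exact: measurable_snd.
have mf : measurable_fun setT (EFin \o f) by case/integrableP: fi.
have push (g : pl -> \bar R) : (\int[pushforward mu tr]_x g x
    = \int[mu]_x g x)%E.
  by apply/eq_measure_integral => A mA _; rewrite -(lebesgue2D v).
have fvi : mu.-integrable setT (EFin \o (fun x => f (x + v))).
  apply/integrableP; split.
    exact: (measurableT_comp mf mphi).
  have maf : measurable_fun setT (fun x : pl => `|(f x)%:E|%E) by exact: measurableT_comp.
  have /= := ge0_integral_pushforward mphi mu measurableT maf (fun y _ => abse_ge0 _).
  rewrite preimage_setT push => <-.
  by case/integrableP: fi.
split => //.
have := @integral_pushforward _ _ _ _ _ _ mphi mu setT _ mf.
rewrite preimage_setT => /(_ fvi measurableT); rewrite push /= => h.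
by rewrite /Rintegral h.
Qed.

(** An open set is the union of the countably many open boxes with rational ends that it contains,
    and boxes belong to the product sigma-algebra. *)
Lemma open_plane_measurable (A : set (plane R)) : open A -> measurable (A : set pl).
Proof.
move=> oA.
pose box (q : (rat * rat) * (rat * rat)) : set (plane R) :=
  `](ratr q.1.1), (ratr q.1.2)[%classic `*` `](ratr q.2.1), (ratr q.2.2)[%classic.
have -> : A = \bigcup_(q in [set q | box q `<=` A]) box q.
  apply/seteqP; split => [x Ax|x [q qA]]; last exact: qA.
  have /nbhs_ballP[e /= e0 eA] : nbhs x A by exact: open_nbhs_nbhs.
  have rr (y : R) : exists p : rat * rat, y - e < ratr p.1 < y /\ y < ratr p.2 < y + e.
    have [p] : exists p : rat, ratr p \in `]y - e, y[.
      apply: rat_in_itvoo. lra.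
    have [q] : exists q : rat, ratr q \in `]y, y + e[.
      apply: rat_in_itvoo. lra.
    rewrite !in_itv/= => hq hp; exists (p, q) => /=; lra.
  have [p1 [/andP[? ?] /andP[? ?]]] := rr x.1.
  have [p2 [/andP[? ?] /andP[? ?]]] := rr x.2.
  exists (p1, p2) => /=.
    move=> z [/=]; rewrite !in_itv/= => /andP[? ?] /andP[? ?]; apply: eA.
    by split; rewrite /ball/= ltr_norml; lra.
  by split; rewrite /= in_itv/=; lra.
rewrite bigcup_mkcond; apply: countable_bigcupT_measurable => // q.
case: ifP => _; last exact: measurable0.
by apply: measurableX; exact: measurable_itv.
Qed.

Lemma continuous_plane_measurable (f : plane R -> R) :
  continuous f -> measurable_fun [set: pl] (f : pl -> measurableTypeR R).
Proof.
move=> cf; apply: (measurability _ (RGenOpens.measurableE R)).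
move=> _ [_ [a [b ->] <-]]; rewrite setTI.
apply: open_plane_measurable; move/continuousP: cf; apply.
exact: interval_open.
Qed.

(** A vertical line is a product with a null factor; the vertical sections of any other line are
    singletons. *)
Lemma line_null (a b c : R) : (a, b) != (0, 0) ->
  mu [set x | a * x.1 + b * x.2 + c = 0] = 0%E.
Proof.
move=> ab; have [b0|b0] := eqVneq b 0.
  have a0 : a != 0 by apply: contraNneq ab => ->; rewrite b0.
  have -> : [set x : plane R | a * x.1 + b * x.2 + c = 0] = [set - c / a] `*` setT.
    apply/seteqP; split=> x /=; rewrite b0.
      by move=> h; split=> //; apply: (mulfI a0); rewrite mulrCA divff// mulr1; lra.
    by case=> -> _; field.
  set B := [set - c / a].
  have -> : mu (B `*` setT) = (mu1 B * mu1 setT)%E.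
    exact: (product_measure1E mu1 mu1 (measurable_set1 _) measurableT).
  by rewrite lebesgue_measure_set1 mul0e.
rewrite /lebesgue2 /= /product_measure1; apply: integral0_eq => x _ /=.
rewrite (_ : xsection _ x = [set (- c - a * x) / b]) ?lebesgue_measure_set1//.
apply/seteqP; split=> y /=; rewrite /xsection/= in_setE/=.
  by move=> h; apply: (mulfI b0); rewrite mulrCA divff// mulr1; lra.
by move=> ->; field.
Qed.

End PlaneMeasure.

(** * Bounded functions of bounded support and integrals of their directional derivatives *)

Section BoundedSupport.
Variable R : realType.
Local Notation mu := (lebesgue2 R).
Local Notation pl := (measurableTypeR R * measurableTypeR R)%type.
Implicit Types (f g h : plane R -> R) (v x : plane R).

Lemma ae_imp (P Q : plane R -> Prop) : (forall x, P x -> Q x) ->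
  (\forall x \ae mu, P x) -> \forall x \ae mu, Q x.
Proof. by move=> PQ; apply: (@filterS _ _ (ae_filter_ringOfSetsType mu)). Qed.

Lemma ae_imp2 (P P' Q : plane R -> Prop) : (forall x, P x -> P' x -> Q x) ->
  (\forall x \ae mu, P x) -> (\forall x \ae mu, P' x) -> \forall x \ae mu, Q x.
Proof. by move=> PQ; apply: (@filterS2 _ _ (ae_filter_ringOfSetsType mu)). Qed.

Lemma ae_seq (I : eqType) (s : seq I) (P : I -> plane R -> Prop) :
  (forall i, i \in s -> \forall x \ae mu, P i x) ->
  \forall x \ae mu, forall i, i \in s -> P i x.
Proof.
elim: s => [|i s IH] h; first exact/aeW.
apply: ae_imp2 (h i (mem_head _ _)) (IH _).
  by move=> x Pi Ps j; rewrite inE => /orP[/eqP ->//|]; exact: Ps.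
by move=> j js; apply: h; rewrite inE js orbT.
Qed.

(** A single constant for values and support makes [M] times the indicator of [square M] a
    dominating function. *)
Definition bounded_supp f : Prop :=
  measurable_fun setT (f : pl -> measurableTypeR R) /\
  exists M : R, forall x,
    `|f x| <= M /\ (f x != 0 -> `|x.1| <= M /\ `|x.2| <= M).

Definition square (M : R) : set pl := `[- M, M]%classic `*` `[- M, M]%classic.

Lemma squareP M x : square M x <-> `|x.1| <= M /\ `|x.2| <= M.
Proof. by rewrite /square/= !in_itv/= !ler_norml. Qed.

Lemma measurable_square M : measurable (square M).
Proof. by apply: measurableX; exact: measurable_itv. Qed.

Lemma square_fin M : (mu (square M) < +oo)%E.
Proof.
pose I : set (measurableTypeR R) := `[- M, M]%classic.
have mI : measurable I by exact: measurable_itv.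
have -> : mu (square M) = (@lebesgue_measure R I * @lebesgue_measure R I)%E.
  exact: (product_measure1E _ _ mI mI).
rewrite /I lebesgue_measure_itv/= lte_fin.
by case: ifP => _; rewrite ?mul0e ?ltry// -?EFinB -?EFinM ltry.
Qed.

Lemma indic_square_integrable M (c : R) :
  mu.-integrable setT (fun x => (c * \1_(square M) x)%:E).
Proof.
have mi : mu.-integrable setT (fun x => (\1_(square M) x)%:E); last first.
  have := integrableZl measurableT c mi.
  by apply: eq_integrable => // x _; rewrite EFinM.
apply/integrableP; split.
  by apply/measurable_EFinP; exact: measurable_indic (measurable_square M).
under eq_integral => t _ do rewrite gee0_abs ?lee_fin//.
by rewrite integral_indic ?setIT//; [exact: square_fin | exact: measurable_square].
Qed.

Lemma bounded_supp_integrable f : bounded_supp f ->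
  mu.-integrable setT (EFin \o f).
Proof.
move=> [mf [M fM]].
apply: (le_integrable measurableT _ _ (indic_square_integrable M M)).
  exact/measurable_EFinP.
move=> x _; rewrite /= lee_fin.
have [fx sx] := fM x.
have M0 : 0 <= M by apply: le_trans fx.
have [->|fx0] := eqVneq (f x) 0; first by rewrite normr0.
have /squareP sq := sx fx0.
rewrite indicE mem_set//= mulr1 (ger0_norm M0); exact: fx.
Qed.

Lemma bounded_suppM f g : bounded_supp f ->
  measurable_fun setT (g : pl -> measurableTypeR R) ->
  (exists M, forall x, f x != 0 -> `|g x| <= M) ->
  bounded_supp (fun x => f x * g x).
Proof.
move=> [mf [M fM]] mg [N gN]; split; first exact: measurable_funM.
have M0 : 0 <= M by have [+ _] := fM 0; exact: le_trans.
exists (M + M * `|N|) => x; have [fx sx] := fM x.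
have [->|fx0] := eqVneq (f x) 0.
  by rewrite mul0r normr0 eqxx; split => //; rewrite addr_ge0// mulr_ge0.
split.
  rewrite normrM; apply: (@le_trans _ _ (M * `|N|)); last by rewrite lerDr.
  by rewrite ler_pM//; apply: (le_trans (gN _ fx0)); exact: ler_norm.
move=> _; have [? ?] := sx fx0.
by split; (apply: (@le_trans _ _ M) => //; rewrite lerDl mulr_ge0).
Qed.

Lemma bounded_supp_L2 f : bounded_supp f -> f \in Lfun mu 2%:E.
Proof.
move=> bf; have [mf [M fM]] := bf.
rewrite inE; apply/andP; split; first by rewrite inE/=.
rewrite inE/= /finite_norm unlock poweR_lty//.
have /integrableP[_] : mu.-integrable setT (EFin \o (fun x => f x * f x)).
  apply: bounded_supp_integrable; apply: bounded_suppM => //.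
  by exists M => x _; case: (fM x).
apply: le_lt_trans; apply: ge0_le_integral => //.
- by move=> x _; exact: poweR_ge0.
- apply/measurable_EFinP.
  apply/(@measurableT_comp _ _ _ _ _ _ (fun x : R => x `^ 2)%R) => //.
  exact/measurableT_comp.
- apply/measurable_EFinP.
  by apply/measurableT_comp => //; exact: measurable_funM.
move=> x _ /=; rewrite lee_fin powR_mulrn// normrM expr2.
by [].
Qed.

(** Translation invariance makes the integral of every difference quotient of [G] zero, and
    dominated convergence passes this on to [h]. The steps [harmonic n] replace the limit at 0 by
    that of a sequence. *)
Lemma integral_derivative_eq0 (G h : plane R -> R) v (C : R) :
  bounded_supp G -> measurable_fun setT (h : pl -> measurableTypeR R) ->
  (\forall x \ae mu, forall n, `|G (x + harmonic n *: v) - G x| <= C * harmonic n) ->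
  (\forall x \ae mu,
     (fun n => (G (x + harmonic n *: v) - G x) / harmonic n) @ \oo --> h x) ->
  mu.-integrable setT (EFin \o h) /\ \int[mu]_x h x = 0.
Proof.
move=> bG mh GL GD.
have [mG [M GM]] := bG.
have iG := bounded_supp_integrable bG.
pose F n x := (G (x + harmonic n *: v) - G x) / harmonic n.
have iF n : mu.-integrable setT (EFin \o F n) /\ \int[mu]_x F n x = 0.
  have [iGv eGv] := integral_lebesgue2D (harmonic n *: v) iG.
  have iB : mu.-integrable setT (EFin \o (fun x => G (x + harmonic n *: v) - G x)).
    have := @integrableB _ _ _ mu setT measurableT _ _ iGv iG.
    by apply: eq_integrable => // x _ /=; rewrite EFinB.
  split.
    have := @integrableZl _ _ _ mu setT measurableT (harmonic n)^-1 _ iB.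
    by apply: eq_integrable => // x _ /=; rewrite -EFinM mulrC.
  have := RintegralZr (harmonic n)^-1 measurableT iB.
  by rewrite RintegralB// eGv subrr mul0r.
(* The steps have length at most 1, so outside this enlarged square both terms of the difference
   quotient vanish. *)
pose M' := M + `|v.1| + `|v.2|.
have [ih _ +] : [/\ mu.-integrable setT (EFin \o h),
   [sequence \int[mu]_x (`|(F n x)%:E - (h x)%:E|)]_n @ \oo --> 0 &
   [sequence \int[mu]_x (F n x)%:E]_n @ \oo --> \int[mu]_x (h x)%:E ]%E.
  apply: (@dominated_convergence _ _ _ mu setT measurableT
    (fun n x => (F n x)%:E) (EFin \o h) (fun x => (C * \1_(square M') x)%:E)).
  - by move=> n; case: (iF n) => /integrableP[].
  - exact/measurable_EFinP.
  - apply: ae_imp GD => x Hx _.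
    by apply/cvg_EFin => //; near=> n.
  - exact: indic_square_integrable.
  - apply: ae_imp GL => x Hx n _ /=; rewrite lee_fin /F.
    have hn0 : 0 < harmonic n :> R by rewrite harmonic_gt0.
    have hn1 : harmonic n <= 1 :> R by rewrite /= invf_le1// ler1n.
    have [xs|xs] := pselect (square M' x).
      rewrite indicE mem_set// mulr1 normrM normfV (gtr0_norm hn0) ler_pdivrMr//.
    have G0 y : ~ square M y -> G y = 0.
      move=> ny; apply/eqP; apply: contra_notT ny => Gy.
      by apply/squareP; apply (GM y).2.
    have key (a b r : R) : 0 < r -> r <= 1 -> `|a + r * b| <= M -> `|a| <= M + `|b|.
      move=> r0 r1 abM; rewrite (_ : a = (a + r * b) - r * b); last by ring.
      apply: (le_trans (ler_normB _ _)); apply: lerD => //.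
      by rewrite normrM (gtr0_norm r0) ler_piMl.
    rewrite !G0 ?subrr ?mul0r ?normr0.
    + rewrite indicE memNset// mulr0//.
    + move/squareP => [x1 x2]; apply: xs; apply/squareP; rewrite /M'.
      by have := normr_ge0 v.1; have := normr_ge0 v.2; split; lra.
    + move/squareP => /= [] /(key _ _ _ hn0 hn1) ? /(key _ _ _ hn0 hn1) ?.
      apply: xs; apply/squareP; rewrite /M'.
      by have := normr_ge0 v.1; have := normr_ge0 v.2; split; lra.
move=> hcvg; split => //; rewrite /Rintegral.
have Fz n : (\int[mu]_x (F n x)%:E)%E = 0%E.
  have [iFn eFn] := iF n.
  rewrite -[0%E]/(0%:E) -eFn /Rintegral fineK//; exact: integrable_fin_num.
move: hcvg; rewrite (_ : [sequence _]_n = cst 0%E); last exact/funext.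
by move/(cvg_unique (@ereal_hausdorff R) (cvg_cst 0%E)) => <-.
Unshelve. all: by end_near.
Qed.

End BoundedSupport.

(** * Affine functions, barycentric coordinates and open triangles *)

Section Triangles.
Variable R : realType.
Implicit Types (K : triangle R) (x y z u v w a b d : plane R) (i j l : 'I_3)
  (f : plane R -> R).

Lemma plane_eq x y : x.1 = y.1 -> x.2 = y.2 -> x = y.
Proof. by case: x y => [? ?] [? ?] /= -> ->. Qed.

Lemma plane1E : (forall x y, (x + y).1 = x.1 + y.1) * (forall x, (- x).1 = - x.1) *
  (forall (r : R) x, (r *: x).1 = r * x.1).
Proof. by []. Qed.

Lemma plane2E : (forall x y, (x + y).2 = x.2 + y.2) * (forall x, (- x).2 = - x.2) *
  (forall (r : R) x, (r *: x).2 = r * x.2).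
Proof. by []. Qed.

Definition planeE := (plane1E, plane2E).

Lemma I3_ind (P : 'I_3 -> Prop) : P 0 -> P 1 -> P 2 -> forall i, P i.
Proof.
move=> P0 P1 P2 [[|[|[|//]]] h].
- by rewrite (_ : Ordinal h = 0)//; apply/val_inj.
- by rewrite (_ : Ordinal h = 1)//; apply/val_inj.
- by rewrite (_ : Ordinal h = 2)//; apply/val_inj.
Qed.

(** Indices are added modulo 3 and 0 + 1 + 2 = 0 there, so [- (i + j)] is the third index when [i]
    and [j] differ. *)
Lemma I3_other i j m : i != j -> [\/ m = i, m = j | m = - (i + j)].
Proof.
move: i j m; do 3!elim/I3_ind; move=> // _;
  by [constructor 1; apply/val_inj | constructor 2; apply/val_inj
     | constructor 3; apply/val_inj].
Qed.

Lemma I3_third i j : i != j -> (- (i + j) != i) && (- (i + j) != j).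
Proof. by move: i j; do 2!elim/I3_ind. Qed.

Lemma sum_I3 (V : nmodType) (F : 'I_3 -> V) : \sum_i F i = F 0 + F 1 + F 2.
Proof.
rewrite !big_ord_recl big_ord0 addr0 addrA.
by congr (F _ + F _ + F _); apply/val_inj.
Qed.

Lemma sum_I3_third (V : nmodType) (F : 'I_3 -> V) i j : i != j ->
  \sum_l F l = F i + F j + F (- (i + j)).
Proof.
move=> ij; have /andP[li lj] := I3_third ij.
rewrite (bigD1 i)//= (bigD1 j)/= 1?eq_sym// (bigD1 (- (i + j)))/=; last first.
  by rewrite li.
rewrite big1 ?addr0 ?addrA// => m /andP[/andP[mi mj] ml].
by case: (I3_other m ij) mi mj ml => ->; rewrite eqxx.
Qed.

Definition affine f := exists a b c : R, forall x, f x = a * x.1 + b * x.2 + c.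

Lemma affine_line f x d (s : R) : affine f ->
  f (x + s *: d) = f x + s * (f (x + d) - f x).
Proof. by move=> [a [b [c fE]]]; rewrite !fE !planeE; ring. Qed.

Lemma affine_segment f x y (s : R) : affine f ->
  f ((1 - s) *: x + s *: y) = (1 - s) * f x + s * f y.
Proof. by move=> [a [b [c fE]]]; rewrite !fE !planeE; ring. Qed.

Lemma affine_midpoint f x y : affine f -> f (midpoint x y) = (f x + f y) / 2.
Proof. by move=> [a [b [c fE]]]; rewrite !fE /midpoint !planeE; field. Qed.

Lemma affine_comb f K (w : 'I_3 -> R) : affine f -> \sum_i w i = 1 ->
  f (\sum_i w i *: vtx K i) = \sum_i w i * f (vtx K i).
Proof.
move=> [a [b [c fE]]]; rewrite !sum_I3 => w1.
have -> : w 0 = 1 - w 1 - w 2 by lra.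
by rewrite !fE !planeE; ring.
Qed.

Lemma affine_area2 x y : affine (fun z => area2 x y z).
Proof.
exists (- (y.2 - x.2)), (y.1 - x.1), (- x.2 * (y.1 - x.1) + x.1 * (y.2 - x.2)).
by move=> z; rewrite /area2; ring.
Qed.

Lemma area2_rot x y z : area2 x y z = area2 y z x.
Proof. by rewrite /area2; ring. Qed.

Lemma affineZ f (r : R) : affine f -> affine (fun x => r * f x).
Proof.
move=> [a [b [c fE]]]; exists (r * a), (r * b), (r * c) => x.
by rewrite fE; ring.
Qed.

Lemma affine_bary K i : affine (bary K i).
Proof.
set D := area2 (vtx K i) (vtx K (i + 1)) (vtx K (i + 2)).
have [a [b [c h]]] := affineZ D^-1 (affine_area2 (vtx K (i + 1)) (vtx K (i + 2))).
by exists a, b, c => x; rewrite -h /bary area2_rot mulrC.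
Qed.

Lemma nondeg_rot K i : nondegenerate_tri K ->
  area2 (vtx K i) (vtx K (i + 1)) (vtx K (i + 2)) != 0.
Proof.
rewrite /nondegenerate_tri; elim/I3_ind: i.
- by rewrite !add0r.
- rewrite (_ : 1 + 1 = 2 :> 'I_3) 1?(_ : 1 + 2 = 0 :> 'I_3); try exact/val_inj.
  by rewrite -(area2_rot (vtx K 0)).
- rewrite (_ : 2 + 1 = 0 :> 'I_3) 1?(_ : 2 + 2 = 1 :> 'I_3); try exact/val_inj.
  by rewrite (area2_rot (vtx K 2)).
Qed.

Lemma bary_vtx K i j : nondegenerate_tri K -> bary K i (vtx K j) = (i == j)%:R.
Proof.
move=> nK; have D0 := nondeg_rot i nK.
have [<-|ij] := eqVneq i j; first by rewrite /bary divff.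
suff : j = i + 1 \/ j = i + 2.
  by case=> ->; rewrite /bary /area2; apply/eqP; rewrite mulf_eq0; apply/orP; left;
    apply/eqP; ring.
move: i j {D0} ij; do 2!elim/I3_ind; move=> // _; by [left; apply/val_inj | right; apply/val_inj].
Qed.

Lemma sum_bary K x : nondegenerate_tri K -> \sum_i bary K i x = 1.
Proof.
move=> nK; rewrite sum_I3 /bary.
have := nondeg_rot 0 nK; have := nondeg_rot 1 nK; have := nondeg_rot 2 nK.
rewrite (_ : 1 + 1 = 2 :> 'I_3) 1?(_ : 1 + 2 = 0 :> 'I_3); try exact/val_inj.
rewrite (_ : 2 + 1 = 0 :> 'I_3) 1?(_ : 2 + 2 = 1 :> 'I_3); try exact/val_inj.
rewrite !add0r -(area2_rot (vtx K 0) (vtx K 1)) (area2_rot (vtx K 2)).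
move=> D0 _ _; rewrite -!mulrDl; apply: (mulIf D0); rewrite divfK// mul1r.
by rewrite /area2; ring.
Qed.

Lemma bary_comb K x : nondegenerate_tri K -> x = \sum_i bary K i x *: vtx K i.
Proof.
move=> nK.
have D0 : nondegenerate_tri K := nK.
rewrite sum_I3 /bary.
rewrite (_ : 1 + 1 = 2 :> 'I_3) 1?(_ : 1 + 2 = 0 :> 'I_3); try exact/val_inj.
rewrite (_ : 2 + 1 = 0 :> 'I_3) 1?(_ : 2 + 2 = 1 :> 'I_3); try exact/val_inj.
rewrite !add0r -(area2_rot (vtx K 0) (vtx K 1)) (area2_rot (vtx K 2) (vtx K 0)).
move: D0; rewrite /nondegenerate_tri /area2 => D0.
by apply: plane_eq; rewrite !planeE; field.
Qed.

Lemma affine_bary_comb f K x : nondegenerate_tri K -> affine f ->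
  f x = \sum_i bary K i x * f (vtx K i).
Proof.
by move=> nK af; rewrite {1}(bary_comb x nK) affine_comb ?sum_bary.
Qed.

Lemma triP K x : nondegenerate_tri K -> tri K x <-> forall i, 0 <= bary K i x.
Proof.
move=> nK; split => [[w [w0 w1 ->]] i|h].
  rewrite affine_comb//; last exact: affine_bary.
  by apply: sumr_ge0 => j _; rewrite bary_vtx// mulr_ge0.
exists (fun i => bary K i x); split => //; first exact: sum_bary.
exact: bary_comb.
Qed.

Lemma tri_vtx K i : tri K (vtx K i).
Proof.
exists (fun j => (i == j)%:R); split => //.
- by rewrite (bigD1 i)//= eqxx big1 ?addr0// => j ij; rewrite eq_sym (negbTE ij).
- rewrite (bigD1 i)//= eqxx scale1r big1 ?addr0// => j ij.
  by rewrite eq_sym (negbTE ij) scale0r.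
Qed.

Lemma mem_vtx K i : vtx K i \in K.
Proof. exact: mem_tnth. Qed.

Lemma in_triP K x : reflect (exists i, x = vtx K i) (x \in K).
Proof. exact: tnthP. Qed.

Lemma vtx_inj K : nondegenerate_tri K -> injective (vtx K).
Proof.
move=> nK i j ij; apply/eqP; have := bary_vtx i j nK; rewrite -ij bary_vtx// eqxx.
by case: (i == j) => // /eqP; rewrite oner_eq0.
Qed.

Definition inside K x := forall i, 0 < bary K i x.

Lemma inside_tri K x : nondegenerate_tri K -> inside K x -> tri K x.
Proof. by move=> nK h; apply/triP => // i; exact/ltW. Qed.

Lemma segmentP K i j x : nondegenerate_tri K -> i != j ->
  segment (vtx K i) (vtx K j) x <-> tri K x /\ bary K (- (i + j)) x = 0.
Proof.
move=> nK ij; have /andP[li lj] := I3_third ij; split.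
  move=> [s /=]; rewrite in_itv/= => /andP[s0 s1] <-; split.
    apply/triP => // m; rewrite affine_segment; last exact: affine_bary.
    by rewrite addr_ge0// mulr_ge0 ?subr_ge0// bary_vtx.
  rewrite affine_segment; last exact: affine_bary.
  by rewrite !bary_vtx// (negbTE li) (negbTE lj) !mulr0 addr0.
move=> [/(triP _ nK) h l0]; exists (bary K j x).
  have := sum_bary x nK; rewrite (sum_I3_third _ ij) l0 /= in_itv/= h/=.
  by have := h i; lra.
have := sum_bary x nK; rewrite (sum_I3_third _ ij) l0 => e.
rewrite {3}(bary_comb x nK) (sum_I3_third _ ij) l0 scale0r addr0.
by congr (_ *: _ + _); lra.
Qed.

Lemma affine_eq0 f K : nondegenerate_tri K -> affine f ->
  (forall i, f (vtx K i) = 0) -> forall x, f x = 0.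
Proof.
move=> nK af f0 x; rewrite (affine_bary_comb x nK af) big1// => i _.
by rewrite f0 mulr0.
Qed.

(** The value at [x] is a combination of the vertex values with positive weights, and these values
    are not all zero since they determine the affine function. *)
Lemma affine_pos_inside f K x : nondegenerate_tri K -> affine f ->
  (forall i, 0 <= f (vtx K i)) -> (exists z, f z != 0) -> inside K x -> 0 < f x.
Proof.
move=> nK af f0 [z fz] xK; rewrite (affine_bary_comb x nK af).
have [i fi] : exists i, f (vtx K i) != 0.
  apply: contrapT => h; case/eqP: fz; apply: (affine_eq0 nK af) => i.
  by apply/eqP; apply: contra_notT h => ?; exists i.
rewrite (bigD1 i)//= ltr_pwDl//.
  by rewrite mulr_gt0// lt0r fi f0.
by apply: sumr_ge0 => j _; rewrite mulr_ge0// ltW.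
Qed.

Lemma inside_sub K K' x : nondegenerate_tri K -> nondegenerate_tri K' ->
  tri K `<=` tri K' -> inside K x -> inside K' x.
Proof.
move=> nK nK' KK' xK i; apply: (affine_pos_inside nK (affine_bary K' i) _ _ xK).
  by move=> j; move/(triP _ nK') : (KK' _ (tri_vtx K j)).
by exists (vtx K' i); rewrite bary_vtx// eqxx oner_eq0.
Qed.

Lemma pos_small (r t : R) : 0 < r \/ 0 <= r /\ 0 < t ->
  exists2 e, 0 < e & forall s, 0 < s <= e -> 0 < r + s * t.
Proof.
move=> h; have [t0|t0] := leP 0 t.
  exists 1 => // s /andP[s0 _]; case: h => [r0|[r0 t0']].
    by rewrite ltr_pwDl// mulr_ge0// ltW.
  by rewrite ltr_wpDl// mulr_gt0.
have r0 : 0 < r by case: h => // -[_]; lra.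
(* Half of the parameter at which [r + s * t] vanishes. *)
exists (r / (- 2 * t)); first by rewrite divr_gt0//; lra.
move=> s /andP[s0]; rewrite ler_pdivlMr; last by lra.
by nra.
Qed.

(** The direction [d] points from [x] into the open triangle. A first order condition suffices
    because barycentric coordinates are affine. *)
Definition inward K x d :=
  forall i, 0 < bary K i x \/ 0 <= bary K i x /\ 0 < bary K i (x + d) - bary K i x.

Lemma inward_inside K x d : inward K x d ->
  exists2 e, 0 < e & forall s, 0 < s <= e -> inside K (x + s *: d).
Proof.
move=> h.
have h' i := pos_small (h i).
have [e0 e00 h0] := h' 0; have [e1 e10 h1] := h' 1; have [e2 e20 h2] := h' 2.
exists (Num.min e0 (Num.min e1 e2)); first by rewrite !lt_min e00 e10 e20.
move=> s; rewrite !le_min => /and4P[s0 s1 s2 s3] i.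
rewrite affine_line; last exact: affine_bary.
by elim/I3_ind: i; [apply: h0 | apply: h1 | apply: h2]; rewrite s0.
Qed.

(** The tool for contradicting the disjointness of open triangles: one direction that enters both of
    them from a common point. *)
Lemma inward_meet K K' x d : inward K x d -> inward K' x d ->
  exists z, inside K z /\ inside K' z.
Proof.
move=> /inward_inside[e e0 h] /inward_inside[e' e0' h'].
exists (x + Num.min e e' *: d).
by split; [apply: h | apply: h']; rewrite lt_min e0 e0' ge_min lexx ?orbT.
Qed.

End Triangles.

(** * Bisection of meshes, conformity and vertices *)

Section Meshes.
Variable R : realType.
Implicit Types (K L : triangle R) (T S : mesh R) (x y z u v a b d : plane R)
  (i j l : 'I_3) (Omega : set (plane R)).

Definition nondeg T := forall K, K \in T -> nondegenerate_tri K.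

(** The substitute for conformity on meshes with hanging nodes: unlike [conforming], it survives
    every single bisection of a nondegenerate mesh. *)
Definition interior_disjoint T := forall K K', K \in T -> K' \in T -> K != K' ->
  forall x, inside K x -> ~ inside K' x.

Lemma tri_sub K K' : nondegenerate_tri K' -> (forall i, tri K' (vtx K i)) ->
  tri K `<=` tri K'.
Proof.
move=> nK' h x [w [w0 w1 ->]]; apply/triP => // i.
rewrite affine_comb//; last exact: affine_bary.
by apply: sumr_ge0 => j _; rewrite mulr_ge0//; move/(triP _ nK') : (h j).
Qed.

Lemma tri_midpoint K x y : nondegenerate_tri K -> tri K x -> tri K y ->
  tri K (midpoint x y).
Proof.
move=> nK /(triP _ nK) hx /(triP _ nK) hy; apply/triP => // i.
rewrite affine_midpoint; last exact: affine_bary.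
by rewrite divr_ge0// addr_ge0.
Qed.

Lemma tri_ref_midpoint K : nondegenerate_tri K -> tri K (ref_midpoint K).
Proof. by move=> nK; apply: tri_midpoint => //; exact: tri_vtx. Qed.

Lemma child1_sub K : nondegenerate_tri K -> tri (child1 K) `<=` tri K.
Proof.
move=> nK; apply: tri_sub => //; elim/I3_ind; last 2 first.
- exact: (tri_vtx K 0).
- exact: (tri_vtx K 1).
exact: tri_ref_midpoint.
Qed.

Lemma child2_sub K : nondegenerate_tri K -> tri (child2 K) `<=` tri K.
Proof.
move=> nK; apply: tri_sub => //; elim/I3_ind; last 2 first.
- exact: (tri_vtx K 0).
- exact: (tri_vtx K 2).
exact: tri_ref_midpoint.
Qed.

Lemma area2_midpoint x y z :
  area2 (midpoint y z) x y = area2 x y z / 2 /\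
  area2 (midpoint y z) x z = - (area2 x y z / 2).
Proof. by rewrite /area2 /midpoint !planeE; split; field. Qed.

Lemma child1_nondeg K : nondegenerate_tri K -> nondegenerate_tri (child1 K).
Proof.
rewrite /nondegenerate_tri => nK.
have -> : area2 (vtx (child1 K) 0) (vtx (child1 K) 1) (vtx (child1 K) 2) =
  area2 (midpoint (vtx K 1) (vtx K 2)) (vtx K 0) (vtx K 1) by [].
by rewrite (area2_midpoint _ _ _).1 mulf_neq0// invr_neq0// pnatr_eq0.
Qed.

Lemma child2_nondeg K : nondegenerate_tri K -> nondegenerate_tri (child2 K).
Proof.
rewrite /nondegenerate_tri => nK.
have -> : area2 (vtx (child2 K) 0) (vtx (child2 K) 1) (vtx (child2 K) 2) =
  area2 (midpoint (vtx K 1) (vtx K 2)) (vtx K 0) (vtx K 2) by [].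
by rewrite (area2_midpoint _ _ _).2 oppr_eq0 mulf_neq0// invr_neq0// pnatr_eq0.
Qed.

(** The children are separated by the median from vertex 0, the line on which the barycentric
    coordinates 1 and 2 agree. *)
Lemma children_disjoint K x : nondegenerate_tri K ->
  inside (child1 K) x -> ~ inside (child2 K) x.
Proof.
move=> nK h1 h2.
have [a1 [b1 [c1 e1]]] := affine_bary K 1; have [a2 [b2 [c2 e2]]] := affine_bary K 2.
have key (r : R) (L : triangle R) : r != 0 -> nondegenerate_tri L -> inside L x ->
    (forall i, 0 <= r * (bary K 1 (vtx L i) - bary K 2 (vtx L i))) ->
    0 < r * (bary K 1 x - bary K 2 x).
  move=> r0 nL iL h.
  apply: (@affine_pos_inside _ (fun z => r * (bary K 1 z - bary K 2 z)) L) => //.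
    exists (r * (a1 - a2)), (r * (b1 - b2)), (r * (c1 - c2)) => z.
    by rewrite e1 e2; ring.
  exists (vtx K 1); rewrite !bary_vtx//= subr0 mulr1//.
have m1 : bary K 1 (ref_midpoint K) = bary K 2 (ref_midpoint K).
  by rewrite !affine_midpoint ?bary_vtx//=; try exact: affine_bary; lra.
have := key 1 _ (oner_neq0 _) (child1_nondeg nK) h1.
have := key (- 1) _ _ (child2_nondeg nK) h2.
rewrite oppr_eq0 oner_eq0 => /(_ isT) k2 k1.
have : 0 < - 1 * (bary K 1 x - bary K 2 x).
  apply: k2; elim/I3_ind.
  - by rewrite (_ : vtx _ 0 = ref_midpoint K)// m1; lra.
  - by rewrite (_ : vtx _ 1 = vtx K 0)// !bary_vtx//=; lra.
  - by rewrite (_ : vtx _ 2 = vtx K 2)// !bary_vtx//=; lra.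
have : 0 < 1 * (bary K 1 x - bary K 2 x).
  apply: k1; elim/I3_ind.
  - by rewrite (_ : vtx _ 0 = ref_midpoint K)// m1; lra.
  - by rewrite (_ : vtx _ 1 = vtx K 0)// !bary_vtx//=; lra.
  - by rewrite (_ : vtx _ 2 = vtx K 1)// !bary_vtx//=; lra.
lra.
Qed.

Lemma in_bisect K T L : (L \in bisect K T) =
  [|| (L != K) && (L \in T), L == child1 K | L == child2 K].
Proof. by rewrite /bisect !inE. Qed.

Lemma bisect_nondeg K T : K \in T -> nondeg T -> nondeg (bisect K T).
Proof.
move=> KT nT L; rewrite in_bisect => /or3P[/andP[_ /nT//]|/eqP ->|/eqP ->].
  exact/child1_nondeg/nT.
exact/child2_nondeg/nT.
Qed.

Lemma bisect_disjoint K T : K \in T -> nondeg T -> interior_disjoint T ->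
  interior_disjoint (bisect K T).
Proof.
move=> KT nT dT; have nK := nT _ KT.
have c1K := inside_sub (child1_nondeg nK) nK (child1_sub nK).
have c2K := inside_sub (child2_nondeg nK) nK (child2_sub nK).
have out L x : L != K -> L \in T -> inside K x -> ~ inside L x.
  by move=> LK LT xK; apply: dT xK => //; rewrite eq_sym.
move=> L L'; rewrite !in_bisect.
move=> /or3P[/andP[LK LT]|/eqP ->|/eqP ->] /or3P[/andP[LK' LT']|/eqP ->|/eqP ->] LL' x.
- exact: dT.
- by move=> xL /c1K /(out _ _ LK LT).
- by move=> xL /c2K /(out _ _ LK LT).
- by move=> /c1K /(out _ _ LK' LT').
- by rewrite eqxx in LL'.
- exact: children_disjoint.
- by move=> /c2K /(out _ _ LK' LT').
- by move=> /[swap]; exact: children_disjoint.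
- by rewrite eqxx in LL'.
Qed.

Lemma refine_trans T1 T2 T3 :
  nvb_refine T1 T2 -> nvb_refine T2 T3 -> nvb_refine T1 T3.
Proof. by elim=> // T K T' KT _ IH /IH; exact: nvb_step. Qed.

Lemma refine_nondeg T T' : nvb_refine T T' -> nondeg T -> nondeg T'.
Proof. by elim=> // S K S' KS _ IH /(bisect_nondeg KS). Qed.

Lemma refine_disjoint T T' : nvb_refine T T' -> nondeg T ->
  interior_disjoint T -> interior_disjoint T'.
Proof.
elim=> // S K S' KS _ IH nS dS.
by apply: IH; [exact: bisect_nondeg | exact: bisect_disjoint].
Qed.

Lemma refine_parent T T' : nvb_refine T T' -> nondeg T -> forall L, L \in T' ->
  exists2 K, K \in T & tri L `<=` tri K.
Proof.
elim=> [S _ L LS|S K S' KS _ IH nS L LS']; first by exists L.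
have nK := nS _ KS.
have [K1 + LK1] := IH (bisect_nondeg KS nS) L LS'.
rewrite in_bisect => /or3P[/andP[_ K1S]|/eqP e|/eqP e]; first by exists K1.
  by exists K => // x /LK1; rewrite e; exact: child1_sub.
by exists K => // x /LK1; rewrite e; exact: child2_sub.
Qed.

Lemma refine_vertices T T' : nvb_refine T T' -> vertices T `<=` vertices T'.
Proof.
elim=> [S x|S K S' KS _ IH x [L LS xL]] //; apply: IH.
have [LK|LK] := eqVneq L K; last by exists L => //; rewrite in_bisect LK LS.
move: xL; rewrite LK => /in_triP[i ->].
elim/I3_ind: i.
- exists (child1 K); first by rewrite in_bisect eqxx !orbT.
  exact: (mem_vtx (child1 K) 1).
- exists (child1 K); first by rewrite in_bisect eqxx !orbT.
  exact: (mem_vtx (child1 K) 2).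
- exists (child2 K); first by rewrite in_bisect eqxx !orbT.
  exact: (mem_vtx (child2 K) 2).
Qed.

Lemma refine_new_vertex T T' z : nvb_refine T T' -> vertices T' z ->
  vertices T z \/ exists S K, [/\ nvb_refine T S, K \in S,
    nvb_refine (bisect K S) T' & z = ref_midpoint K].
Proof.
elim=> [S|S K S' KS SS' IH /IH]; first by left.
case=> [[L +]|[S1 [K1 [h1 h2 h3 h4]]]]; last first.
  by right; exists S1, K1; split => //; exact: nvb_step KS h1.
rewrite in_bisect => /or3P[/andP[_ LS]|/eqP -> /in_triP[i ->]|/eqP -> /in_triP[i ->]].
- by left; exists L.
- elim/I3_ind: i.
  + by right; exists S, K; split => //; exact: nvb_refl.
  + by left; exists K => //; exact: (mem_vtx K 0).
  + by left; exists K => //; exact: (mem_vtx K 1).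
- elim/I3_ind: i.
  + by right; exists S, K; split => //; exact: nvb_refl.
  + by left; exists K => //; exact: (mem_vtx K 0).
  + by left; exists K => //; exact: (mem_vtx K 2).
Qed.

(** The intersection is empty, a common vertex or a common edge, and at each of its points some
    barycentric coordinate of [K] vanishes. *)
Lemma conforming_disjoint T : nondeg T -> conforming T -> interior_disjoint T.
Proof.
move=> nT cT K K' KT K'T KK' x xK xK'.
have xx : (tri K `&` tri K') x by split; apply: inside_tri => //; exact: nT.
have nK := nT _ KT.
have [e|[y [/in_triP[i yi] _] e]|[y [z [yz [yK _] [zK _] e]]]] := cT K K' KT K'T KK'.
- by rewrite e in xx.
- move: xx; rewrite e /= yi => xi; move: (xK (i + 1)).
  by rewrite xi bary_vtx//; case: (i) => [[|[|[|]]]]//=; rewrite ltxx.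
- move: yK zK => /in_triP[i yi] /in_triP[j zj].
  have ij : i != j by apply: contra_neq yz => ij; rewrite yi zj ij.
  move: xx; rewrite e yi zj => /(segmentP _ nK ij)[_ x0].
  by have := xK (- (i + j)); rewrite x0 ltxx.
Qed.

Lemma conforming_cap T K K' z : nondeg T -> conforming T ->
  K \in T -> K' \in T -> K != K' -> tri K z -> tri K' z ->
  (z \in K /\ z \in K') \/
  exists x y, [/\ x != y, x \in K /\ x \in K', y \in K /\ y \in K',
    tri K `&` tri K' = segment x y & segment x y z].
Proof.
move=> nT cT KT K'T KK' zK zK'.
have zz : (tri K `&` tri K') z by [].
have [e|[y [yK yK'] e]|[x [y [xy xK yK e]]]] := cT K K' KT K'T KK'.
- by rewrite e in zz.
- by left; move: zz; rewrite e => ->.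
- by right; exists x, y; split => //; rewrite -e.
Qed.

(** Absence of hanging nodes: the common edge of [K] and [L] contains no vertex of [L] besides its
    two ends. *)
Lemma vertex_in_tri T K v : nondeg T -> conforming T -> K \in T ->
  vertices T v -> tri K v -> v \in K.
Proof.
move=> nT cT KT [L LT vL] vK.
have [KL|KL] := eqVneq K L; first by rewrite KL.
have vL' : tri L v by move: vL => /in_triP[i ->]; exact: tri_vtx.
have [[]//|[x [y [xy [xK xL] [yK yL] _ sv]]]] :=
  conforming_cap nT cT KT LT KL vK vL'.
move: vL xL yL => /in_triP[i vi] /in_triP[j xj] /in_triP[l yl].
have nL := nT _ LT.
have jl : j != l by apply: contra_neq xy => e; rewrite xj yl e.
move: sv; rewrite xj yl vi => /(segmentP _ nL jl)[_]; rewrite bary_vtx//.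
have [->|->|->] := I3_other i jl.
- by rewrite -xj.
- by rewrite -yl.
- by rewrite eqxx => /eqP; rewrite oner_eq0.
Qed.

(* [crs u w] is the determinant of [w] and [u]; it vanishes iff they are parallel *)
Definition crs u v : R := dot u (perp v).

Lemma affine_crs x d : affine (fun z => crs (z - x) d).
Proof.
exists (- d.2), d.1, (x.1 * d.2 - x.2 * d.1) => z.
by rewrite /crs /dot /perp !planeE /=; ring.
Qed.

Lemma midpoint_ends x y : midpoint x y - x = 2^-1 *: (y - x) /\
  midpoint x y - y = - 2^-1 *: (y - x).
Proof. by split; apply: plane_eq; rewrite /midpoint !planeE; field. Qed.

Lemma crsZl (r : R) u v : crs (r *: u) v = r * crs u v.
Proof. by rewrite /crs /dot /perp !planeE /=; ring. Qed.
Lemma crsZr (r : R) u v : crs u (r *: v) = r * crs u v.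
Proof. by rewrite /crs /dot /perp !planeE /=; ring. Qed.
Lemma crsBl u w v : crs (u - w) v = crs u v - crs w v.
Proof. by rewrite /crs /dot /perp !planeE /=; ring. Qed.

Lemma crsxx u : crs u u = 0.
Proof. by rewrite /crs /dot /perp /=; ring. Qed.

(** The left side is affine in [z] and vanishes at both ends of the edge, so only the third vertex
    contributes. *)
Lemma crs_bary K i j z : nondegenerate_tri K -> i != j ->
  crs (z - vtx K i) (vtx K j - vtx K i) =
  bary K (- (i + j)) z *
    crs (vtx K (- (i + j)) - vtx K i) (vtx K j - vtx K i).
Proof.
move=> nK ij.
rewrite (affine_bary_comb z nK (affine_crs (vtx K i) (vtx K j - vtx K i))).
by rewrite (sum_I3_third _ ij) subrr crsxx /crs/dot/= !mul0r addr0 mulr0 mulr0 !add0r.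
Qed.

(** Up to sign this is twice the area of [K]. *)
Lemma crs_neq0 K i j : nondegenerate_tri K -> i != j ->
  crs (vtx K (- (i + j)) - vtx K i) (vtx K j - vtx K i) != 0.
Proof.
move=> nK; have : area2 (vtx K 0) (vtx K 1) (vtx K 2) != 0 by [].
rewrite /area2 /crs /dot /perp.
move: i j; do 2!elim/I3_ind; move=> // h _; rewrite !planeE /=;
 (apply: contra_neq h => h);
 [have e : - (0 + 1) = 2 :> 'I_3 by exact/val_inj
 |have e : - (0 + 2) = 1 :> 'I_3 by exact/val_inj
 |have e : - (1 + 0) = 2 :> 'I_3 by exact/val_inj
 |have e : - (1 + 2) = 0 :> 'I_3 by exact/val_inj
 |have e : - (2 + 0) = 1 :> 'I_3 by exact/val_inj
 |have e : - (2 + 1) = 0 :> 'I_3 by exact/val_inj];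
 rewrite e in h; lra.
Qed.

End Meshes.

(** * Position of a triangle relative to a line through a vertex *)

Section Sides.
Variable R : realType.
Implicit Types (K L : triangle R) (T S : mesh R) (x y z u v a b d : plane R)
  (i j l : 'I_3) (Omega : set (plane R)).

(** By convexity the vertices decide: [K] lies in a closed half plane bounded by the line through
    [x] along [d]. *)
Definition one_sided K x d := (forall i, 0 <= crs (vtx K i - x) d) \/
  (forall i, crs (vtx K i - x) d <= 0).

Lemma ref_edge_neq K : nondegenerate_tri K -> vtx K 1 != vtx K 2.
Proof. by move=> nK; apply/negP => /eqP /(vtx_inj nK). Qed.

Lemma created_neq T0 T x a b : nondeg T0 -> created T0 T x a b -> a != b.
Proof.
move=> nT0 [S [K [TS KS _ [-> ->] _]]].
exact/ref_edge_neq/(refine_nondeg TS nT0).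
Qed.

(* Near the midpoint [x] of its refinement edge, the bisected triangle fills a
   half disk, so no other triangle with vertex [x] can enter that half plane. *)
Lemma created_one_sided T0 T x a b K : nondeg T0 -> interior_disjoint T0 ->
  created T0 T x a b -> K \in T -> x \in K -> one_sided K x (b - a).
Proof.
move=> nT0 dT0 [S [L [TS LS ST [ea eb] ex]]] KT xK.
have nS := refine_nondeg TS nT0; have dS := refine_disjoint TS nT0 dT0.
have nL := nS _ LS.
have nB := bisect_nondeg LS nS.
have nK := refine_nondeg ST nB KT.
have [K1 K1B KK1] := refine_parent ST nB KT.
have i12 : (1 : 'I_3) != 2 by [].
have e0 : - (1 + 2) = 0 :> 'I_3 by exact/val_inj.
set c := crs (vtx L 0 - vtx L 1) (b - a).
(* As [x] lies on the refinement edge, the side of [z] is read off from [bary L 0 z] alone, up to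
   the fixed sign of [c]. *)
have cE z : crs (z - x) (b - a) = bary L 0 z * c.
  have -> : z - x = (z - a) - 2^-1 *: (b - a).
    by rewrite ex ea eb /ref_midpoint -(midpoint_ends _ _).1; rewrite opprB addrA subrK.
  rewrite crsBl crsZl crsxx mulr0 subr0 /c ea eb.
  by rewrite (crs_bary z nL i12) e0.
have key1 : (forall i, 0 <= bary L 0 (vtx K i)) -> one_sided K x (b - a).
  move=> h; have [c0|c0] := leP 0 c; [left|right] => i; rewrite cE.
    by rewrite mulr_ge0.
  by rewrite mulr_ge0_le0// ltW.
have key2 : (forall i, bary L 0 (vtx K i) <= 0) -> one_sided K x (b - a).
  move=> h; have [c0|c0] := leP 0 c; [right|left] => i; rewrite cE.
    by rewrite mulr_le0_ge0.
  by rewrite mulr_le0// ltW.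
have inL : tri K `<=` tri L -> one_sided K x (b - a).
  move=> KL; apply: key1 => i.
  by have /(triP _ nL) := KL _ (tri_vtx K i); apply.
move: K1B; rewrite in_bisect => /or3P[/andP[K1L K1S]|/eqP e|/eqP e]; last 2 first.
- by apply: inL => z /KK1; rewrite e; exact: child1_sub.
- by apply: inL => z /KK1; rewrite e; exact: child2_sub.
(* Here [K] descends from a neighbour [K1] of [L]. A vertex of [K] strictly on the side of [L] would
   make [K1] overlap [L] near [x]. *)
have nK1 := nS _ K1S.
apply: key2 => j; rewrite leNgt; apply/negP => fj.
move: (xK) => /in_triP[i xi].
have fx m : bary L m x = (m != 0)%:R / 2.
  rewrite ex affine_midpoint; last exact: affine_bary.
  rewrite !bary_vtx//; elim/I3_ind: m => /=; lra.
have ij : i != j.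
  by apply: contraTneq fj => <-; rewrite -xi fx/= mul0r ltxx.
set w := vtx K (- (i + j)).
have fjw : 0 < bary L 0 (vtx K j) \/ 0 <= bary L 0 (vtx K j) /\ 0 < bary L 0 w by left.
have [eta eta0 heta] := pos_small fjw.
(* The direction to [vtx K j], tilted towards the third vertex in order to enter the interior of
   [K]; the tilt [eta] is small enough to keep [bary L 0] increasing along [d]. *)
pose d := (vtx K j - x) + eta *: (w - x).
have bd M m : nondegenerate_tri M -> bary M m (x + d) - bary M m x =
    (bary M m (vtx K j) - bary M m x) + eta * (bary M m w - bary M m x).
  move=> _; have [q1 [q2 [q3 E]]] := affine_bary M m.
  by rewrite !E /d !planeE; ring.
have /andP[li lj] := I3_third ij.
have K_in : inward K x d.
  move=> m; rewrite bd// /w xi !bary_vtx//.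
  have [->|->|->] := I3_other m ij.
  + by left; rewrite eqxx.
  + right; rewrite eqxx (eq_sym j i) (negbTE ij) (eq_sym j) (negbTE lj) /=.
    by split => //; lra.
  + right; rewrite (negbTE li) (negbTE lj) eqxx /=.
    by split => //; lra.
have L_in : inward L x d.
  move=> m; rewrite bd//; have [->|m0] := eqVneq m 0.
    right; rewrite fx eqxx /= mul0r !subr0; split => //.
    by apply: heta; rewrite eta0 lexx.
  by left; rewrite fx m0 /=; lra.
have [z [zK zL]] := inward_meet K_in L_in.
have := dS _ _ K1S LS K1L z _ zL; apply.
exact: inside_sub KK1 zK.
Qed.

Lemma one_sided_sub K K' x d : nondegenerate_tri K -> tri K' `<=` tri K ->
  one_sided K x d -> one_sided K' x d.
Proof.
move=> nK KK' h.
have E i : crs (vtx K' i - x) d = \sum_j bary K j (vtx K' i) * crs (vtx K j - x) d.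
  exact: (affine_bary_comb (vtx K' i) nK (affine_crs x d)).
have b0 i j : 0 <= bary K j (vtx K' i).
  by have /(triP _ nK) := KK' _ (tri_vtx K' i); apply.
case: h => h; [left|right] => i; rewrite E.
  by apply: sumr_ge0 => j _; rewrite mulr_ge0.
by apply: sumr_le0 => j _; rewrite mulr_ge0_le0.
Qed.

(** The sign test of [half_patch], with an arbitrary direction in place of the unit tangent. *)
Definition side x d K : bool := 0 < crs (mid K - x) d.

Lemma crs_mid K x d :
  crs (mid K - x) d = 3^-1 * \sum_i crs (vtx K i - x) d.
Proof.
by rewrite !sum_I3 /mid sum_I3 /crs /dot /perp !planeE /=; field.
Qed.

(** A nondegenerate triangle has a vertex off the line, and then one-sidedness puts the barycentre
    strictly on one side. *)
Lemma one_sided_side K x d : nondegenerate_tri K -> d != 0 -> one_sided K x d ->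
  (side x d K /\ forall i, 0 <= crs (vtx K i - x) d) \/
  (crs (mid K - x) d < 0 /\ forall i, crs (vtx K i - x) d <= 0).
Proof.
move=> nK d0 h.
have [i ci] : exists i, crs (vtx K i - x) d != 0.
  apply: contrapT => hn.
  have z0 := affine_eq0 nK (affine_crs x d).
  have c0 z : crs (z - x) d = 0.
    apply: z0 => i; apply/eqP; apply: contra_notT hn => ?; by exists i.
  case/eqP: d0; apply: plane_eq => /=.
    by have := c0 (x + (0, 1)); rewrite /crs /dot /perp !planeE /=; lra.
  by have := c0 (x + (1, 0)); rewrite /crs /dot /perp !planeE /=; lra.
have S h' : \sum_j crs (vtx K j - x) d = h' -> crs (mid K - x) d = 3^-1 * h'.
  by move=> <-; exact: crs_mid.
case: h => h; [left|right]; split => //.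
  rewrite /side (S _ erefl) mulr_gt0// (bigD1 i)//= ltr_pwDl//.
    by rewrite lt0r ci h.
  exact: sumr_ge0.
rewrite (S _ erefl) -oppr_gt0 -mulrN mulr_gt0// -sumrN (bigD1 i)//= ltr_pwDl//.
  by rewrite oppr_gt0 lt_neqAle ci h.
by apply: sumr_ge0 => j _; rewrite oppr_ge0.
Qed.

(** The vertices of [K'] are convex combinations of those of [K] and stay in the closed half plane
    that contains [K]. *)
Lemma side_sub K K' x d : nondegenerate_tri K -> nondegenerate_tri K' -> d != 0 ->
  tri K' `<=` tri K -> one_sided K x d -> side x d K' = side x d K.
Proof.
move=> nK nK' d0 KK' h.
have h' := one_sided_sub nK KK' h.
have E i : crs (vtx K' i - x) d = \sum_j bary K j (vtx K' i) * crs (vtx K j - x) d.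
  exact: (affine_bary_comb (vtx K' i) nK (affine_crs x d)).
have b0 i j : 0 <= bary K j (vtx K' i).
  by have /(triP _ nK) := KK' _ (tri_vtx K' i); apply.
have [[s hs]|[s hs]] := one_sided_side nK d0 h;
have [[s' hs']|[s' hs']] := one_sided_side nK' d0 h'.
- by rewrite s s'.
- move: s'; rewrite crs_mid ltNge mulr_ge0//.
  by apply: sumr_ge0 => i _; rewrite E; apply: sumr_ge0 => j _; rewrite mulr_ge0.
- move: s'; rewrite /side crs_mid ltNge mulr_ge0_le0//.
  by apply: sumr_le0 => i _; rewrite E; apply: sumr_le0 => j _; rewrite mulr_ge0_le0.
- by rewrite /side !ltNge (ltW s) (ltW s').
Qed.

Lemma enorm_gt0 v : v != 0 -> 0 < enorm v.
Proof.
move=> v0; rewrite sqrtr_gt0 lt0r /dot addr_ge0 -?expr2 ?sqr_ge0// andbT.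
rewrite paddr_eq0 ?sqr_ge0// !sqrf_eq0; apply: contra v0 => /andP[/eqP h1 /eqP h2].
by apply/eqP/plane_eq.
Qed.

Lemma crs_tangent u a b :
  crs u (tangent a b) = (enorm (b - a))^-1 * crs u (b - a).
Proof. by rewrite /tangent crsZr. Qed.

Lemma tangent_neq0 a b : a != b -> tangent a b != 0.
Proof.
move=> ab; rewrite scaler_eq0 negb_or invr_eq0 subr_eq0 (eq_sym b) ab andbT.
by rewrite gt_eqF// enorm_gt0// subr_eq0 eq_sym.
Qed.

Lemma one_sidedZ K x d (r : R) : one_sided K x d -> one_sided K x (r *: d).
Proof.
have [r0|r0] := leP 0 r; case=> h.
- by left=> i; rewrite crsZr mulr_ge0.
- by right=> i; rewrite crsZr mulr_ge0_le0.
- by right=> i; rewrite crsZr mulr_le0_ge0// ltW.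
- by left=> i; rewrite crsZr mulr_le0// ltW.
Qed.

Lemma side_edge K i j x y : i != j -> x = vtx K i -> y = vtx K j ->
  side x (y - x) K = (0 < crs (vtx K (- (i + j)) - x) (y - x)).
Proof.
move=> ij xi yj; rewrite /side crs_mid (sum_I3_third _ ij) -xi -yj subrr crsxx.
rewrite (_ : crs 0 _ = 0) ?add0r ?pmulr_rgt0//.
by rewrite /crs /dot /=; ring.
Qed.

(** The direction from the midpoint of the common edge to the third vertex of [K] enters [K] and,
    the third vertices being on the same side, [K'] too. *)
Lemma edge_overlap K K' x y : nondegenerate_tri K -> nondegenerate_tri K' ->
  x != y -> x \in K -> y \in K -> x \in K' -> y \in K' ->
  side x (y - x) K = side x (y - x) K' -> exists z, inside K z /\ inside K' z.
Proof.
move=> nK nK' xy /in_triP[i xi] /in_triP[j yj] /in_triP[i' xi'] /in_triP[j' yj'] ss.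
have ij : i != j by apply: contra_neq xy => e; rewrite xi yj e.
have ij' : i' != j' by apply: contra_neq xy => e; rewrite xi' yj' e.
set l := - (i + j); set l' := - (i' + j').
set c := crs (vtx K l - x) (y - x); set c' := crs (vtx K' l' - x) (y - x).
have cE z : crs (z - x) (y - x) = bary K l z * c.
  by rewrite /c xi yj (crs_bary z nK ij).
have cE' z : crs (z - x) (y - x) = bary K' l' z * c'.
  by rewrite /c' xi' yj' (crs_bary z nK' ij').
have c0 : c != 0 by rewrite /c xi yj; exact: crs_neq0.
have c0' : c' != 0 by rewrite /c' xi' yj'; exact: crs_neq0.
have midE (L : triangle R) p q m : nondegenerate_tri L -> p != q -> x = vtx L p -> y = vtx L q ->
    bary L m (midpoint x y) = (m != - (p + q))%:R / 2.
  move=> nL pq xp yq; have /andP[lp lq] := I3_third pq.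
  rewrite affine_midpoint; last exact: affine_bary.
  rewrite xp yq !bary_vtx//; have [->|->|->] := I3_other m pq.
  - by rewrite eqxx (negbTE pq) eq_sym lp /=; lra.
  - by rewrite eqxx eq_sym (negbTE pq) (eq_sym q (- _)) lq /=; lra.
  - by rewrite eqxx (negbTE lp) (negbTE lq) /=; lra.
have cc : (0 < c) = (0 < c').
  by move: ss; rewrite (side_edge ij xi yj) (side_edge ij' xi' yj').
have cpos : 0 < c / c'.
  have [c1|c1] := ltP 0 c; first by rewrite divr_gt0// -cc.
  have c2 : c < 0 by rewrite lt_neqAle c0.
  have c3 : c' < 0 by rewrite lt_neqAle c0' leNgt -cc -leNgt.
  by rewrite -(opprK c') invrN mulrN -mulNr divr_gt0// oppr_gt0.
pose m := midpoint x y; pose d := vtx K l - m.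
have md : m + d = vtx K l by rewrite /d addrC subrK.
apply: (@inward_meet _ _ _ m d) => p; rewrite md.
- rewrite (midE K i j)// -/l; have [->|pl] := eqVneq p l; last by left; rewrite /=; lra.
  by right; rewrite bary_vtx// eqxx /=; lra.
- rewrite (midE K' i' j')// -/l'; have [->|pl] := eqVneq p l'; last by left; rewrite /=; lra.
  right; have -> : bary K' l' (vtx K l) = c / c'.
    by apply: (mulIf c0'); rewrite -cE' divfK// cE bary_vtx// eqxx mul1r.
  by rewrite /= mul0r subr0.
Qed.

End Sides.

(** * Polynomial functions of bounded total degree and their restrictions to segments *)

Section PolyFun.
Variable R : realType.
Implicit Types (p q f : plane R -> R) (x y v : plane R) (m n : nat).

Lemma poly_fun_ext m p q : p =1 q -> poly_fun m p -> poly_fun m q.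
Proof. by move=> pq [c pE]; exists c => x; rewrite -pq. Qed.

Lemma poly_funD m p q : poly_fun m p -> poly_fun m q ->
  poly_fun m (fun x => p x + q x).
Proof.
move=> [c pE] [d qE]; exists (fun i j => c i j + d i j) => x.
rewrite pE qE -big_split; apply: eq_bigr => i _ /=.
by rewrite -big_split; apply: eq_bigr => j _ /=; rewrite !mulrDl.
Qed.

Lemma poly_fun_mono m (c : R) i j : (i + j <= m)%N ->
  poly_fun m (fun x => c * x.1 ^+ i * x.2 ^+ j).
Proof.
move=> ijm; exists (fun i' j' => if (i' == i) && (j' == j) then c else 0) => x.
have im : (i < m.+1)%N by rewrite ltnS; apply: leq_trans ijm; exact: leq_addr.
have jm : (j < m.+1)%N by rewrite ltnS; apply: leq_trans ijm; exact: leq_addl.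
rewrite (bigD1 (Ordinal im))//= [X in _ = _ + X]big1 ?addr0; last first.
  move=> i'; rewrite -val_eqE /= => /negbTE ne.
  by rewrite big1// => j' _; rewrite ne /= !mul0r.
rewrite (bigD1 (Ordinal jm))//= !eqxx/= big1 ?addr0// => j' /andP[_].
by rewrite -val_eqE /= => /negbTE ->; rewrite !mul0r.
Qed.

Lemma poly_fun0 m : poly_fun m (fun=> 0 : R).
Proof.
exists (fun _ _ => 0) => x; rewrite big1// => i _.
by rewrite big1// => j _; rewrite !mul0r.
Qed.

Lemma poly_fun_sum m (I : Type) (r : seq I) (P : pred I) (F : I -> plane R -> R) :
  (forall i, P i -> poly_fun m (F i)) -> poly_fun m (fun x => \sum_(i <- r | P i) F i x).
Proof.
move=> h; elim: r => [|i r IH].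
  by apply: poly_fun_ext (poly_fun0 m) => x; rewrite big_nil.
have [Pi|Pi] := boolP (P i).
  by apply: poly_fun_ext (poly_funD (h i Pi) IH) => x; rewrite big_cons Pi.
by apply: poly_fun_ext IH => x; rewrite big_cons (negbTE Pi).
Qed.

Lemma poly_fun_leq m n p : (m <= n)%N -> poly_fun m p -> poly_fun n p.
Proof.
move=> mn [c pE]; apply: (poly_fun_ext (fun x => esym (pE x))).
apply: poly_fun_sum => i _; apply: poly_fun_sum => j ij.
by apply: poly_fun_mono; exact: leq_trans mn.
Qed.

Lemma poly_funM m n p q : poly_fun m p -> poly_fun n q ->
  poly_fun (m + n) (fun x => p x * q x).
Proof.
move=> [c pE] [d qE].
apply: (@poly_fun_ext _ (fun x => \sum_(i < m.+1) \sum_(j < m.+1 | (i + j <= m)%N)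
   \sum_(i' < n.+1) \sum_(j' < n.+1 | (i' + j' <= n)%N)
     (c i j * d i' j') * x.1 ^+ (i + i') * x.2 ^+ (j + j'))).
  move=> x; rewrite pE qE mulr_suml; apply: eq_bigr => i _.
  rewrite mulr_suml; apply: eq_bigr => j _.
  rewrite mulr_sumr; apply: eq_bigr => i' _.
  rewrite mulr_sumr; apply: eq_bigr => j' _.
  by rewrite !exprD; ring.
do 2!(apply: poly_fun_sum => ? ?); do 2!(apply: poly_fun_sum => ? ?).
by apply: poly_fun_mono; rewrite addnACA leq_add.
Qed.

Lemma poly_fun_cst m (c : R) : poly_fun m (fun=> c).
Proof.
apply: poly_fun_ext (poly_fun_mono c (leq0n m : 0 + 0 <= m)%N) => x.
by rewrite !expr0 !mulr1.
Qed.

Lemma poly_funZ m (c : R) p : poly_fun m p -> poly_fun m (fun x => c * p x).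
Proof. exact: poly_funM (poly_fun_cst 0 c). Qed.

Lemma poly_funB m p q : poly_fun m p -> poly_fun m q ->
  poly_fun m (fun x => p x - q x).
Proof.
move=> pp /(poly_funZ (- 1)) /(poly_funD pp).
by apply: poly_fun_ext => x; rewrite mulN1r.
Qed.

Lemma poly_fun_affine f : affine f -> poly_fun 1 f.
Proof.
move=> [a [b [c fE]]].
apply: poly_fun_ext (poly_funD (poly_funD (poly_fun_mono a (isT : 1 + 0 <= 1)%N)
  (poly_fun_mono b (isT : 0 + 1 <= 1)%N)) (poly_fun_cst 1 c)) => x.
by rewrite fE !expr0 !expr1 !mulr1.
Qed.

Lemma poly_funX n f : affine f -> poly_fun n (fun x => f x ^+ n).
Proof.
move=> /poly_fun_affine af; elim: n => [|n IH].
  by apply: poly_fun_ext (poly_fun_cst 0 1) => x; rewrite expr0.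
by apply: poly_fun_ext (poly_funM af IH) => x; rewrite exprS.
Qed.

Lemma poly_fun_horner m f (P : {poly R}) : affine f -> (size P <= m.+1)%N ->
  poly_fun m (fun x => P.[f x]).
Proof.
move=> af sP.
apply: (@poly_fun_ext _ (fun x => \sum_(i < size P) P`_i * f x ^+ i)).
  by move=> x; rewrite horner_coef.
apply: poly_fun_sum => i _; apply: poly_funZ.
by apply: poly_fun_leq (poly_funX i af); rewrite -ltnS; apply: leq_trans sP.
Qed.

Lemma poly_fun_segment m p x y : poly_fun m p ->
  exists2 P : {poly R}, (size P <= m.+1)%N &
    forall s, p ((1 - s) *: x + s *: y) = P.[s].
Proof.
move=> [c pE].
pose A : {poly R} := x.1%:P + (y.1 - x.1) *: 'X.
pose B : {poly R} := x.2%:P + (y.2 - x.2) *: 'X.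
have sL (a b : R) : (size ((a%:P + b *: 'X)%R : {poly R}) <= 2)%N.
  rewrite (leq_trans (size_polyD _ _))// geq_max.
  rewrite (leq_trans (size_polyC_leq1 _))//=.
  by rewrite (leq_trans (size_scale_leq _ _))// size_polyX.
exists (\sum_(i < m.+1) \sum_(j < m.+1 | (i + j <= m)%N) c i j *: (A ^+ i * B ^+ j)).
  apply: (leq_trans (size_sum _ _ _)); apply/bigmax_leqP => i _.
  apply: (leq_trans (size_sum _ _ _)); apply/bigmax_leqP => j ij.
  apply: (leq_trans (size_scale_leq _ _)).
  apply: (leq_trans (size_polyMleq _ _)).
  have sE (C : {poly R}) n : (size C <= 2)%N -> (size (C ^+ n) <= n.+1)%N.
    move=> sC; apply: (leq_trans (size_poly_exp_leq _ _)); rewrite ltnS.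
    by rewrite -[leqRHS]mul1n leq_mul2r; case: (size C) sC => [|[|[|]]]// _; rewrite orbT.
  have := sE A i (sL _ _); have := sE B j (sL _ _); lia.
move=> s; rewrite pE horner_sum; apply: eq_bigr => i _.
rewrite horner_sum; apply: eq_bigr => j _.
rewrite hornerZ hornerM !horner_exp !hornerD !hornerC !hornerZ !hornerX mulrA.
rewrite !planeE.
by congr (_ * _ ^+ _ * _ ^+ _); ring.
Qed.

(** On the edge [p] is a polynomial in one variable with roots 0 and 1. The quotient by these roots,
    composed with [f], extends to the plane with a degree lower by two: the coefficient of an edge
    bubble. *)
Lemma poly_fun_edge_factor m p x y f : (2 <= m)%N -> poly_fun m p ->
  affine f -> f x = 0 -> f y = 1 -> p x = 0 -> p y = 0 ->
  exists2 q, poly_fun (m - 2) q &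
    forall z, segment x y z -> p z = (1 - f z) * f z * q z.
Proof.
move=> m2 pp af fx fy px py.
have [P sP PE] := poly_fun_segment x y pp.
have P0 : root P 0.
  by apply/rootP; rewrite -PE subr0 scale1r scale0r addr0.
have P1 : root P 1.
  by apply/rootP; rewrite -PE subrr scale1r scale0r add0r.
have [Q QE] := factor_theorem _ _ P0.
rewrite {1}QE in P1.
have [Q' QE'] : exists Q', Q = Q' * ('X - 1%:P).
  apply/factor_theorem; move: P1; rewrite /root hornerM !hornerE.
  by rewrite subr0 mulr1.
(* The sign turns the factor [s * (s - 1)] into [(1 - s) * s]. *)
exists (fun z => (- Q').[f z]).
  apply: poly_fun_horner => //; rewrite size_polyN.
  have [->|Q'0] := eqVneq Q' 0; first by rewrite size_poly0.
  have sPQ : size P = (size Q').+2.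
    by rewrite QE QE' !size_Mmonic ?monicXsubC ?size_XsubC ?mulf_neq0 ?polyXsubC_eq0// !addn2.
  by move: sP; rewrite sPQ; move: (size Q') => n; lia.
move=> z [s _ <-]; rewrite PE affine_segment// fx fy mulr0 mulr1 add0r.
rewrite QE QE' !hornerE/= . ring.
Qed.

(** In one variable a polynomial of degree at most [m] with [m + 1] roots, here the equidistant
    nodes, is zero. *)
Lemma poly_fun_segment_eq0 m p x y : poly_fun m p -> (0 < m)%N ->
  (forall j, (j <= m)%N ->
     p (((m - j)%:R / m%:R) *: x + (j%:R / m%:R) *: y) = 0) ->
  forall z, segment x y z -> p z = 0.
Proof.
move=> pp m0 h z [s _ <-].
have [P sP PE] := poly_fun_segment x y pp.
have mR : m%:R != 0 :> R by rewrite pnatr_eq0 -lt0n.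
rewrite PE (_ : P = 0) ?horner0//; apply/eqP.
apply: contraTT sP => P0; rewrite -ltnNge.
pose rs : seq R := [seq j%:R / m%:R | j <- iota 0 m.+1].
have -> : m.+1 = size rs by rewrite size_map size_iota.
apply: max_poly_roots => //.
  apply/allP => r /mapP[j]; rewrite mem_iota add0n => /= jm ->.
  rewrite /root -PE.
  rewrite (_ : 1 - j%:R / m%:R = (m - j)%:R / m%:R); first by rewrite h.
  by rewrite natrB// mulrBl divff.
rewrite map_inj_uniq ?iota_uniq// => i j /(mulIf _) ij.
by apply/eqP; rewrite -(eqr_nat R); apply/eqP/ij; rewrite invr_eq0.
Qed.

(** Induction principle: constants and coordinates generate all polynomial functions by sums and
    products. The degree is forgotten. *)
Lemma poly_fun_rect (Q : (plane R -> R) -> Prop) :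
  (forall p q, p =1 q -> Q p -> Q q) -> (forall c, Q (fun=> c)) ->
  Q fst -> Q snd -> (forall p q, Q p -> Q q -> Q (fun x => p x + q x)) ->
  (forall p q, Q p -> Q q -> Q (fun x => p x * q x)) ->
  forall m p, poly_fun m p -> Q p.
Proof.
move=> Qe Qc Q1 Q2 QD QM m p [c pE].
have Qs (I : Type) (r : seq I) (P : pred I) (F : I -> plane R -> R) :
    (forall i, Q (F i)) -> Q (fun x => \sum_(i <- r | P i) F i x).
  move=> h; elim: r => [|i r IH].
    by apply: Qe (Qc 0) => x; rewrite big_nil.
  have [Pi|Pi] := boolP (P i).
    by apply: Qe (QD _ _ (h i) IH) => x; rewrite big_cons Pi.
  by apply: Qe IH => x; rewrite big_cons (negbTE Pi).
have QX f n : Q f -> Q (fun x => f x ^+ n).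
  move=> Qf; elim: n => [|n IH]; first by apply: Qe (Qc 1) => x; rewrite expr0.
  by apply: Qe (QM _ _ Qf IH) => x; rewrite exprS.
apply: (Qe _ _ (fun x => esym (pE x))); apply: (Qs _ _ _ _) => i; apply: (Qs _ _ _ _) => j.
apply: (QM (fun x => c i j * x.1 ^+ i) (fun x => x.2 ^+ j)); last exact: (QX snd).
by apply: (QM (fun=> c i j) (fun x => x.1 ^+ i)) => //; exact: (QX fst).
Qed.

End PolyFun.

(** * Continuous differentiability in one direction *)

Section DirectionalC1.
Variable R : realType.
Variable v : plane R.
Local Notation pl := (measurableTypeR R * measurableTypeR R)%type.
Implicit Types (p q f : plane R -> R) (x y : plane R).

Definition C1dir p p' := [/\ continuous p, continuous p' &
  forall x, is_derive x v p (p' x)].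

Lemma is_derive_cvg p x (d : R) :
  (fun h : R => h^-1 * (p (h *: v + x) - p x)) @ 0^' --> d -> is_derive x v p d.
Proof.
move=> h; apply: DeriveDef; last exact/cvg_lim.
by apply/cvg_ex; exists d.
Qed.

Lemma is_derive_line p x (d : R) : is_derive x v p d ->
  (fun h : R => h^-1 * (p (h *: v + x) - p x)) @ 0^' --> d.
Proof.
move=> [dp dd]; rewrite -dd; exact: dp.
Qed.

Lemma C1dir_cst (c : R) : C1dir (fun=> c) (fun=> 0).
Proof.
split; [exact: cst_continuous|exact: cst_continuous|move=> x].
exact: is_derive_cst.
Qed.

Lemma C1dir_fst : C1dir fst (fun=> v.1).
Proof.
split; [by move=> x; exact: cvg_fst|exact: cst_continuous|move=> x].
apply: is_derive_cvg; apply: cvg_near_cst; near=> h.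
rewrite /= addrK mulrA mulVf ?mul1r//.
near: h; exact: nbhs_dnbhs_neq.
Unshelve. all: by end_near. Qed.

Lemma C1dir_snd : C1dir snd (fun=> v.2).
Proof.
split; [by move=> x; exact: cvg_snd|exact: cst_continuous|move=> x].
apply: is_derive_cvg; apply: cvg_near_cst; near=> h.
rewrite /= addrK mulrA mulVf ?mul1r//.
near: h; exact: nbhs_dnbhs_neq.
Unshelve. all: by end_near. Qed.

Lemma C1dirD p q p' q' : C1dir p p' -> C1dir q q' ->
  C1dir (fun x => p x + q x) (fun x => p' x + q' x).
Proof.
move=> [cp cp' dp] [cq cq' dq]; split => x.
- exact: cvgD (cp x) (cq x).
- exact: cvgD (cp' x) (cq' x).
- exact: is_deriveD.
Qed.

Lemma C1dirM p q p' q' : C1dir p p' -> C1dir q q' ->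
  C1dir (fun x => p x * q x) (fun x => p' x * q x + p x * q' x).
Proof.
move=> [cp cp' dp] [cq cq' dq]; split => x.
- exact: cvgM (cp x) (cq x).
- by apply: cvgD; apply: cvgM; [exact: cp'|exact: cq|exact: cp|exact: cq'].
- have -> : p' x * q x + p x * q' x = p x *: q' x + q x *: p' x.
    by rewrite addrC [p' x * _]mulrC.
  exact: is_deriveM.
Qed.

Lemma C1dir_poly m p : poly_fun m p -> exists p', C1dir p p'.
Proof.
move: m p; apply: poly_fun_rect.
- by move=> f g fg [f' h]; exists f'; rewrite -(funext fg).
- by move=> c; exists (fun=> 0); exact: C1dir_cst.
- by exists (fun=> v.1); exact: C1dir_fst.
- by exists (fun=> v.2); exact: C1dir_snd.
- by move=> f g [f' hf] [g' hg]; eexists; exact: C1dirD hf hg.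
- by move=> f g [f' hf] [g' hg]; eexists; exact: C1dirM hf hg.
Qed.

Lemma continuous_square_bounded f (M : R) : continuous f ->
  exists B : R, forall x, square M x -> `|f x| <= B.
Proof.
move=> cf.
have cS : compact (square M : set (plane R)).
  by apply: compact_setX; exact: segment_compact.
have /compact_bounded[B [_ hB]] : compact (f @` (square M)).
  by apply: continuous_compact => //; exact: continuous_subspaceT.
by exists (B + 1) => x xM; apply: hB; [lra|exists x].
Qed.

Lemma square_convex M x (s r : R) : 0 <= r <= s ->
  square M x -> square M (x + s *: v) -> square M (x + r *: v).
Proof.
move=> /andP[r0 rs] /squareP[x1 x2] /squareP[]; rewrite !planeE => y1 y2.
have [s0|s0] := leP s 0.
  have -> : r = 0 by lra.
  by apply/squareP; rewrite scale0r addr0.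
have key (a b : R) : `|a| <= M -> `|a + s * b| <= M -> `|a + r * b| <= M.
  move=> ha hb.
  have -> : a + r * b = (1 - r / s) * a + r / s * (a + s * b) by field; exact: lt0r_neq0.
  have t0 : 0 <= r / s by rewrite divr_ge0// ltW.
  have t1 : r / s <= 1 by rewrite ler_pdivrMr// mul1r.
  apply: (le_trans (ler_normD _ _));
    rewrite 2!(normrM _ (_ : R)) (ger0_norm t0).
    rewrite (ger0_norm (_ : 0 <= 1 - r / s)) ?subr_ge0//.
  by nra.
by apply/squareP; rewrite !planeE; split; apply: key.
Qed.

(** The mean value theorem on the segment, which stays in the convex square where [p'] is
    bounded. *)
Lemma C1dir_lip p p' M : C1dir p p' -> exists2 C : R, 0 <= C &
  forall x s, 0 <= s -> square M x -> square M (x + s *: v) ->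
    `|p (x + s *: v) - p x| <= C * s.
Proof.
move=> [cp cp' dp]; have [B hB] := continuous_square_bounded M cp'.
exists `|B| => // x s s0 xM yM.
pose g r := p (x + r *: v).
have dg (r : R) : is_derive r 1 g (p' (x + r *: v)).
  have /is_derive_line h := dp (x + r *: v).
  have h' : (fun h : R => h^-1 *: ((g \o shift r) (h *: (1 : R)) - g r)) @ 0^' -->
      p' (x + r *: v).
    apply: cvg_trans h; apply: near_eq_cvg; near=> h.
    rewrite /g -[RHS]/(_ * _) /shift /=; congr (_ * (p _ - _)).
    rewrite -[h *: 1]/(h * 1) mulr1 scalerDl; exact: addrCA.
  apply: DeriveDef; last exact/cvg_lim.
  by apply/cvg_ex; exists (p' (x + r *: v)).
have gc : {within `[0, s], continuous g}.
  apply: continuous_subspaceT => r; apply: differentiable_continuous.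
  by apply/derivable1_diffP; case: (dg r).
have [c] := MVT_segment s0 (fun r _ => dg r) gc.
rewrite in_itv/= => /andP[c0 cs]; rewrite /g scale0r addr0 subr0 => ->.
rewrite normrM (ger0_norm s0) ler_wpM2r//.
apply: (le_trans _ (ler_norm _)); apply: hB.
by apply: square_convex yM => //; rewrite c0 cs.
Unshelve. all: by end_near. Qed.

Lemma C1dir_seq p p' x : C1dir p p' ->
  (fun n => (p (x + harmonic n *: v) - p x) / harmonic n) @ \oo --> p' x.
Proof.
move=> [_ _ /(_ x) /is_derive_line /cvgr_dnbhsP h].
have {h} := h harmonic; move=> /(_ _)/wrap[].
  by split => [n|]; [rewrite gt_eqF// harmonic_gt0 | exact: cvg_harmonic].
by apply: cvg_trans; apply: near_eq_cvg; near=> n; rewrite mulrC (addrC x).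
Unshelve. all: by end_near. Qed.

End DirectionalC1.

(** * Lipschitz bounds from a finite closed cover of an interval *)

Section LipschitzCover.
Variable R : realType.

(** Let [F i] contain [a], and let [c] be its last point in the interval. The bound of this single
    piece leads from [a] to [c]; beyond [c] the piece does not occur any more, and induction on the
    number of pieces applies. How often the function changes between pieces is irrelevant. *)
Lemma lipschitz_cover (I : choiceType) (s : seq I) (F : I -> set R) (f : R -> R)
    (C a b : R) : 0 <= C -> a <= b -> (forall i, closed (F i)) ->
  (forall r, a <= r <= b -> exists2 i, i \in s & F i r) ->
  (forall i r t, i \in s -> F i r -> F i t -> a <= r -> r <= t -> t <= b ->
     `|f t - f r| <= C * (t - r)) ->
  `|f b - f a| <= C * (b - a).
Proof.
move=> C0; have [n] := ubnP (size s); elim: n s a => // n IH s a sn ab cF cov lip.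
have [|i si Fa] := cov a; first by rewrite lexx ab.
have [c] : exists2 c, c \in `[a, b]%classic `&` F i &
    forall t, t \in `[a, b]%classic `&` F i -> t <= c.
  apply: (@compact_EVT_max _ _ id).
  - by exists a; split => //=; rewrite in_itv/= lexx.
  - apply: compact_closedI; [exact: segment_compact | exact: cF].
  - by apply: continuous_subspaceT => r; exact: cvg_id.
rewrite inE/= in_itv/= => -[/andP[ac cb] Fc] cmax.
have fca : `|f c - f a| <= C * (c - a) by apply: (lip i).
have [bc|cb'] := leP b c.
  by have -> : b = c by apply/eqP; rewrite eq_le bc cb.
suff : `|f b - f c| <= C * (b - c).
  move=> fbc; have -> : f b - f a = (f b - f c) + (f c - f a) by ring.
  by apply: (le_trans (ler_normD _ _)); lra.
apply: (IH (rem i s)) => //.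
- have : (0 < size s)%N by case: (s) si.
  by rewrite size_rem//; case: (size s) sn.
(* The point [c] itself must be covered by the remaining pieces: it is a limit of points that are,
   and their finite union is closed. *)
- pose G : set R := \bigcup_(j in [set` rem i s]) F j.
  have cG : closed G by apply: closed_bigcup => //; exact: finite_seq.
  have Gr (r : R) : c < r <= b -> G r.
    move=> /andP[cr rb]; have [|j sj Fj] := cov r; first by rewrite rb ltW// (le_lt_trans ac).
    exists j => //=; apply: rem_mem => //; apply/negP => /eqP ji.
    have : r <= c.
      apply: cmax; rewrite inE/= in_itv/= rb (le_trans ac (ltW cr)).
      by split => //; rewrite -ji.
    by rewrite leNgt cr.
  move=> r0 /andP[]; rewrite le_eqVlt => /orP[/eqP <- _|cr rb]; last first.
    by case: (Gr r0) => [|j /= ? ?]; [rewrite cr|exists j].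
  suff [j /= ? ?] : G c by exists j.
  rewrite closure_id in cG; rewrite cG => B /nbhs_ballP[e /= e0 eB].
  pose r := Num.min b (c + e / 2).
  have cr : c < r by rewrite lt_min cb' ltrDl divr_gt0.
  exists r; split; first by apply: Gr; rewrite cr ge_min lexx.
  apply: eB; rewrite /ball/= ltr_norml.
  have : r <= c + e / 2 by rewrite ge_min lexx orbT.
  by lra.
- move=> j r t js Fr Ft cr rt tb; apply: (lip j) => //; first exact: mem_rem js.
  exact: le_trans cr.
Qed.

End LipschitzCover.

(** * Piecewise C1 functions along lines, and test functions *)

Section PiecewiseC1.
Variable R : realType.
Local Notation mu := (lebesgue2 R).
Local Notation pl := (measurableTypeR R * measurableTypeR R)%type.
Implicit Types (p q f psi : plane R -> R) (x y v : plane R) (Omega : set (plane R)).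

Lemma continuous_line x v : continuous (fun r : R => x + r *: v).
Proof.
move=> r; apply: cvgD; first exact: cvg_cst.
by apply: cvgZr_tmp; exact: cvg_id.
Qed.

(* Difference quotients of a Lipschitz function with bounded support have
   integral zero, and they converge boundedly to its derivative. *)
Lemma piecewise_integral_eq0 (I : finType) (F : I -> set (plane R))
    (P P' : I -> plane R -> R) (G h : plane R -> R) v :
  bounded_supp G -> measurable_fun setT (h : pl -> measurableTypeR R) ->
  (forall i, closed (F i)) -> (forall i, C1dir v (P i) (P' i)) ->
  (\forall x \ae mu, [/\ forall r, exists i, F i (x + r *: v),
     forall r i, F i (x + r *: v) -> G (x + r *: v) = P i (x + r *: v) &
     exists i, [/\ F i x, \forall n \near \oo, F i (x + harmonic n *: v)
                 & h x = P' i x]]) ->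
  mu.-integrable setT (EFin \o h) /\ \int[mu]_x h x = 0.
Proof.
move=> bG mh cF dP GP.
have [mG [M GM]] := bG.
have M0 : 0 <= M by have [+ _] := GM 0; exact: le_trans.
pose d := `|v.1| + `|v.2|.
have d0 : 0 <= d by rewrite addr_ge0.
have v1d : `|v.1| <= d by rewrite lerDl.
have v2d : `|v.2| <= d by rewrite lerDr.
(* The first enlargement by [d] contains every [x] from which a step of length at most 1 reaches the
   support; the second contains these steps. *)
have /choice[C hC] i : exists C : R, 0 <= C /\
    forall x s, 0 <= s -> square (M + d + d) x -> square (M + d + d) (x + s *: v) ->
    `|P i (x + s *: v) - P i x| <= C * s.
  by have [C C0 h0] := C1dir_lip (M + d + d) (dP i); exists C.
have G0 y : ~ square M y -> G y = 0.
  move=> ny; apply/eqP; apply: contra_notT ny => Gy.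
  by apply/squareP; apply (GM y).2.
have C0 : 0 <= \sum_i C i by apply: sumr_ge0 => i _; case: (hC i).
have key (a b r N : R) : 0 <= r <= 1 -> `|a + r * b| <= N -> `|b| <= d -> `|a| <= N + d.
  move=> /andP[r0 r1] abM bd; rewrite (_ : a = (a + r * b) - r * b); last by ring.
  apply: (le_trans (ler_normB _ _)); apply: lerD => //.
  rewrite normrM (ger0_norm r0); apply: le_trans bd.
  by rewrite ler_piMl.
apply: (@integral_derivative_eq0 _ G h v (\sum_i C i)) => //.
- apply: ae_imp GP => x [cov GE _] n.
  have hn0 : 0 < harmonic n :> R by rewrite harmonic_gt0.
  have hn1 : harmonic n <= 1 :> R by rewrite /= invf_le1// ler1n.
  have [xs|xs] := pselect (square (M + d) x); last first.
    rewrite !G0 ?subrr ?normr0.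
    + by rewrite mulr_ge0// ltW.
    + move/squareP => [x1 x2]; apply: xs; apply/squareP.
      by split; lra.
    + move/squareP => []; rewrite !planeE => y1 y2; apply: xs; apply/squareP.
      have r01 : 0 <= (harmonic n : R) <= 1 by apply/andP; split; [exact: ltW|].
      by split; [exact: key y1 _|exact: key y2 _].
  have -> : (\sum_i C i) * harmonic n = (\sum_i C i) * (harmonic n - 0) by rewrite subr0.
  have {2}-> : x = x + 0 *: v by rewrite scale0r addr0.
  apply: (@lipschitz_cover _ _ (enum I) (fun i => [set r | F i (x + r *: v)])
     (fun r => G (x + r *: v))) => //.
  + exact: ltW.
  + move=> i; apply: (@preimage_closed _ _ (fun r : R => x + r *: v) (F i)) => // r _.
    exact: continuous_line.
  + by move=> r _; have [i Fi] := cov r; exists i; rewrite ?mem_enum.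
  + move=> i r t _ /= Fr Ft r0 rt tn; rewrite (GE _ _ Fr) (GE _ _ Ft).
    have tE : x + t *: v = (x + r *: v) + (t - r) *: v.
      by rewrite -addrA -scalerDl (addrC r) subrK.
    have sq u : 0 <= u <= 1 -> square (M + d + d) (x + u *: v).
      move=> u01; move/squareP : xs => [x1 x2]; apply/squareP; rewrite !planeE.
      split.
        apply: (@key _ (- v.1) u) => //; last by rewrite normrN.
        by rewrite (_ : x.1 + u * v.1 + u * - v.1 = x.1)//; ring.
      apply: (@key _ (- v.2) u) => //; last by rewrite normrN.
      by rewrite (_ : x.2 + u * v.2 + u * - v.2 = x.2)//; ring.
    have t1 : t <= 1 := le_trans tn hn1.
    rewrite {1}tE; apply: (@le_trans _ _ (C i * (t - r))).
      have [_ h1] := hC i; apply: h1; rewrite ?subr_ge0// -?tE.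
        by apply: sq; rewrite r0 (le_trans rt t1).
      by apply: sq; rewrite t1 (le_trans r0 rt).
    rewrite ler_wpM2r ?subr_ge0// (bigD1 i)//= lerDl.
    by apply: sumr_ge0 => j _; case: (hC j).
- apply: ae_imp GP => x [cov GE [i [Fix Fin ->]]].
  have Gx : G x = P i x by have := GE 0 i; rewrite scale0r addr0; apply.
  apply: cvg_trans (@C1dir_seq _ _ _ _ x (dP i)); apply: near_eq_cvg; near=> n.
  by rewrite Gx (GE _ i)//; near: n.
Unshelve. all: by end_near. Qed.

Lemma unit_vecE v : v = v.1 *: unit_vec R ord0 + v.2 *: unit_vec R ord_max.
Proof.
by apply: plane_eq; rewrite !planeE /unit_vec/= ?mulr1 ?mulr0 ?addr0 ?add0r.
Qed.

Lemma smooth_C1dir v psi : smooth psi ->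
  C1dir v psi (fun x => v.1 * partial ord0 psi x + v.2 * partial ord_max psi x).
Proof.
move=> sm; split.
- by move=> x; exact: differentiable_continuous (sm [::] x).
- move=> x; apply: cvgD; apply: cvgM; try exact: cvg_cst.
    exact: differentiable_continuous (sm [:: ord0] x).
  exact: differentiable_continuous (sm [:: ord_max] x).
- move=> x; have dx := sm [::] x; apply: DeriveDef; first exact: diff_derivable.
  rewrite /partial !deriveE// {1}(unit_vecE v) linearD !linearZ.
  by [].
Qed.

Lemma smooth_C1partial i psi : smooth psi -> C1dir (unit_vec R i) psi (partial i psi).
Proof.
move=> sm; split.
- by move=> x; exact: differentiable_continuous (sm [::] x).
- by move=> x; exact: differentiable_continuous (sm [:: i] x).
- by move=> x; apply: derivableP; apply: diff_derivable; exact: (sm [::] x).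
Qed.

Lemma plane_norm_bound x (M : R) : `|x| <= M -> square M x.
Proof.
move=> h; apply/squareP; split; apply: le_trans h.
  by rewrite prod_normE le_max lexx.
by rewrite prod_normE le_max lexx orbT.
Qed.

(** The complement of [A] is open, so off [A] the difference quotients vanish eventually, and the
    partial derivatives with them. *)
Lemma test_function_supp Omega psi : test_function Omega psi ->
  exists A : set (plane R), [/\ closed A, exists M : R, A `<=` square M, A `<=` Omega &
    forall x, ~ A x -> psi x = 0 /\ forall i, partial i psi x = 0].
Proof.
move=> [sm [A [cA AO A0]]].
have clA : closed A by apply: compact_closed cA; exact: norm_hausdorff.
exists A; split => //.
  have [M [_ hM]] := compact_bounded cA.
  by exists (M + 1) => x Ax; apply: plane_norm_bound; apply: hM => //; lra.
move=> x nA; split; first exact: A0.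
move=> i; have h := @C1dir_seq _ _ _ _ x (smooth_C1partial i sm).
apply: (cvg_unique _ h) => //; apply: cvg_near_cst.
have hx : (fun n => x + harmonic n *: unit_vec R i) @ \oo --> x.
  rewrite -[X in _ --> X]addr0 -(scale0r (unit_vec R i)).
  by apply: cvgD; [exact: cvg_cst | apply: cvgZr_tmp; exact: cvg_harmonic].
have oA : nbhs x (~` A) by apply: open_nbhs_nbhs; split => //; exact: closed_openC.
near=> n; rewrite (A0 x nA) A0 ?subrr ?mul0r//.
by near: n; exact: (hx _ oA).
Unshelve. all: by end_near. Qed.

Lemma continuous_bounded_supp f (A : set (plane R)) (M : R) :
  continuous f -> A `<=` square M -> (forall x, ~ A x -> f x = 0) -> bounded_supp f.
Proof.
move=> cf AM A0; split; first exact: continuous_plane_measurable.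
have [B hB] := continuous_square_bounded M cf.
exists (`|B| + `|M|) => x.
have [sx|sx] := pselect (square M x); last first.
  have -> : f x = 0 by apply: A0 => /AM.
  by rewrite normr0 eqxx; split => //; rewrite addr_ge0.
have := ler_norm B; have := ler_norm M; have := hB x sx.
have := normr_ge0 B; have := normr_ge0 M.
by move/squareP : sx => [? ?]; repeat split; lra.
Qed.

Lemma test_bounded_supp Omega psi : test_function Omega psi ->
  bounded_supp psi /\ forall i, bounded_supp (partial i psi).
Proof.
move=> tp; have [A [_ [M AM] _ A0]] := test_function_supp tp; case: tp => sm _.
split=> [|i].
  apply: (continuous_bounded_supp _ AM); first by case: (smooth_C1partial ord0 sm).
  by move=> x /A0[].
apply: (continuous_bounded_supp _ AM); first by case: (smooth_C1partial i sm).
by move=> x /A0[].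
Qed.

Lemma bounded_supp_C1dir Omega psi v : test_function Omega psi ->
  bounded_supp (fun x => v.1 * partial ord0 psi x + v.2 * partial ord_max psi x).
Proof.
move=> tp; have [A [_ [M AM] _ A0]] := test_function_supp tp.
apply: (continuous_bounded_supp _ AM); first by case: (smooth_C1dir v tp.1).
by move=> x /A0[_ h]; rewrite !h !mulr0 addr0.
Qed.

End PiecewiseC1.

(** * Functions glued from pieces on a mesh and their weak derivatives *)

Section Glue.
Variable R : realType.
Local Notation mu := (lebesgue2 R).
Local Notation pl := (measurableTypeR R * measurableTypeR R)%type.
Implicit Types (f g psi : plane R -> R) (x y v : plane R) (Omega : set (plane R))
  (K : triangle R) (T : mesh R) (s : seq (triangle R)) (p : triangle R -> plane R -> R).

Lemma affine_continuous f : affine f -> continuous f.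
Proof.
move=> [a [b [c fE]]]; rewrite (funext fE) => x.
apply: cvgD; last exact: cvg_cst.
by apply: cvgD; apply: cvgM; try exact: cvg_cst; [exact: cvg_fst | exact: cvg_snd].
Qed.

Lemma closed_bary_ge0 K i : closed [set x | 0 <= bary K i x].
Proof.
apply: (@preimage_closed _ _ (bary K i) [set r | 0 <= r]); last exact: closed_ge.
by move=> x _; exact: (affine_continuous (affine_bary K i)).
Qed.

Lemma closed_bary_le0 K i : closed [set x | bary K i x <= 0].
Proof.
apply: (@preimage_closed _ _ (bary K i) [set r | r <= 0]); last exact: closed_le.
by move=> x _; exact: (affine_continuous (affine_bary K i)).
Qed.

Lemma closed_tri K : nondegenerate_tri K -> closed (tri K).
Proof.
move=> nK.
have -> : tri K = \bigcap_i [set x | 0 <= bary K i x].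
  apply/seteqP; split => x; first by move=> /(triP _ nK) h i _; exact: h.
  by move=> h; apply/triP => // i; exact: (h i I).
by apply: closed_bigI => i _; exact: closed_bary_ge0.
Qed.

Lemma closed_plane_measurable (A : set (plane R)) : closed A -> measurable (A : set pl).
Proof.
by move=> cA; rewrite -(setCK A); apply: measurableC; apply: open_plane_measurable;
  exact: closed_openC.
Qed.

Lemma tri_square K : exists M : R, tri K `<=` square M.
Proof.
exists (\sum_i (`|(vtx K i).1| + `|(vtx K i).2|)) => x [w [w0 w1 ->]].
have wle i : w i <= 1 by rewrite -w1 (bigD1 i)//= lerDl; apply: sumr_ge0.
apply/squareP; rewrite !sum_I3 !planeE.
have key (a : 'I_3 -> R) i : `|w i * a i| <= `|a i|.
  by rewrite normrM (ger0_norm (w0 i)) ler_piMl.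
have key1 i := key (fun i => (vtx K i).1) i.
have key2 i := key (fun i => (vtx K i).2) i.
have := (normr_ge0 (vtx K 0).1, normr_ge0 (vtx K 1).1, normr_ge0 (vtx K 2).1).
have := (normr_ge0 (vtx K 0).2, normr_ge0 (vtx K 1).2, normr_ge0 (vtx K 2).2).
move=> [[? ?] ?] [[? ?] ?].
have := key1 0; have := key1 1; have := key1 2.
have := key2 0; have := key2 1; have := key2 2 => /= *.
by split; (apply: (le_trans (ler_normD _ _));
  apply: (le_trans (lerD (ler_normD _ _) (lexx _))); lra).
Qed.

(** Points off the lines that carry the edges, hence almost all points. When the open triangles are
    disjoint, such a point belongs to at most one triangle, which makes the a.e. comparison of glued
    functions a pointwise one. *)
Definition generic T x := forall K, K \in T -> forall i, bary K i x != 0.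

Lemma ae_bary_neq0 K i : nondegenerate_tri K -> \forall x \ae mu, bary K i x != 0.
Proof.
move=> nK; have [a [b [c E]]] := affine_bary K i.
exists [set x | a * x.1 + b * x.2 + c = 0]; split.
- apply: closed_plane_measurable.
  apply: (@preimage_closed _ _ (fun x : plane R => a * x.1 + b * x.2 + c) [set 0]);
    last exact: closed_eq.
  by move=> x _; apply: affine_continuous; exists a, b, c.
- apply: line_null; apply/eqP => -[a0 b0].
  have h j : bary K i (vtx K j) = c by rewrite E a0 b0 !mul0r !add0r.
  have := h i; have := h (i + 1); rewrite !bary_vtx// eqxx.
  have -> : (i == i + 1) = false by elim/I3_ind: i {E h}.
  by move=> <- /eqP; rewrite oner_eq0.
- by move=> x /= h; apply: contra_notP h; rewrite -E => /eqP.
Qed.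

Lemma ae_generic T : nondeg T -> \forall x \ae mu, generic T x.
Proof.
move=> nT.
have : \forall x \ae mu, forall K, K \in (T : seq (triangle R)) ->
    forall i, i \in enum 'I_3 -> bary K i x != 0.
  apply: ae_seq => K KT; apply: ae_seq => i _; exact/ae_bary_neq0/nT.
by apply: ae_imp => x h K KT i; apply: h => //; rewrite mem_enum.
Qed.

Lemma generic_inside T x K : nondeg T -> generic T x -> K \in T -> tri K x -> inside K x.
Proof.
move=> nT gx KT xK i; rewrite lt0r (gx K KT) /=.
by move/(triP _ (nT K KT)) : xK; apply.
Qed.

Lemma generic_unique T x K K' : nondeg T -> interior_disjoint T -> generic T x ->
  K \in T -> K' \in T -> tri K x -> tri K' x -> K = K'.
Proof.
move=> nT dT gx KT K'T xK xK'; apply/eqP; apply/negPn/negP => KK'.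
apply: (dT K K' KT K'T KK' x); exact: (@generic_inside T).
Qed.

(* Where pieces overlap the first one in [s] wins; for a mesh this concerns a
   null set only. *)
Fixpoint glue s p x : R :=
  if s is K :: s' then \1_(tri K) x * p K x + (1 - \1_(tri K) x) * glue s' p x
  else 0.

Lemma glue_in s p x K : K \in s -> tri K x ->
  (forall K', K' \in s -> tri K' x -> p K' x = p K x) -> glue s p x = p K x.
Proof.
elim: s => // L s IH; rewrite inE => KLs xK h /=.
have [xL|xL] := pselect (tri L x).
  rewrite indicE mem_set// mul1r subrr mul0r addr0 h// mem_head//.
rewrite indicE memNset// mul0r add0r subr0 mul1r IH//.
  by case/orP: KLs => // /eqP KL; rewrite KL in xK.
by move=> K' K's; apply: h; rewrite inE K's orbT.
Qed.

Lemma glue_out s p x : (forall K, K \in s -> ~ tri K x) -> glue s p x = 0.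
Proof.
elim: s => // K s IH h /=.
rewrite indicE memNset ?mul0r ?add0r ?subr0 ?mul1r; last by apply: h; rewrite mem_head.
by apply: IH => L Ls; apply: h; rewrite inE Ls orbT.
Qed.

Lemma glue_generic T p x K : nondeg T -> interior_disjoint T -> generic T x ->
  K \in T -> tri K x -> glue T p x = p K x.
Proof.
move=> nT dT gx KT xK; apply: glue_in => // K' K'T xK'.
by rewrite (generic_unique nT dT gx KT K'T xK xK').
Qed.

Lemma bounded_suppD f g : bounded_supp f -> bounded_supp g ->
  bounded_supp (fun x => f x + g x).
Proof.
move=> [mf [M fM]] [mg [N gN]]; split; first exact: measurable_funD.
exists (`|M| + `|N|) => x; have [fx sx] := fM x; have [gx tx] := gN x.
have := ler_norm M; have := ler_norm N; have := normr_ge0 M; have := normr_ge0 N => *.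
split; first by apply: (le_trans (ler_normD _ _)); lra.
have [f0|f0] := eqVneq (f x) 0.
  by rewrite f0 add0r => /tx[? ?]; split; lra.
by move=> _; have [? ?] := sx f0; split; lra.
Qed.

Lemma bounded_supp_indic (A : set (plane R)) g M : measurable (A : set pl) ->
  A `<=` square M -> continuous g -> bounded_supp (fun x => \1_A x * g x).
Proof.
move=> mA AM cg.
have i01 x : `|\1_A x| <= 1 :> R.
  by rewrite indicE; case: (_ \in _); rewrite ?normr0 ?normr1.
apply: bounded_suppM.
- split; first exact: measurable_indic.
  exists (1 + `|M|) => x; split; first by apply: le_trans (i01 x) _; rewrite lerDl.
  rewrite indicE; have [/set_mem/AM/squareP[? ?] _|] := boolP (x \in A).
    by have := ler_norm M; split; lra.
  by rewrite eqxx.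
- exact: continuous_plane_measurable.
- have [B hB] := continuous_square_bounded M cg; exists B => x.
  rewrite indicE; have [/set_mem/AM xM _|] := boolP (x \in A); first exact: hB.
  by rewrite eqxx.
Qed.

Lemma bounded_supp_glue s p : (forall K, K \in s -> nondegenerate_tri K) ->
  (forall K, K \in s -> continuous (p K)) -> bounded_supp (glue s p).
Proof.
elim: s => [_ _|K s IH nT cp].
  split; first exact: measurable_cst.
  by exists 0 => x; rewrite /= normr0 eqxx.
have mK : measurable (tri K : set pl).
  by apply: closed_plane_measurable; apply: closed_tri; apply: nT; rewrite mem_head.
have bs : bounded_supp (glue s p).
  by apply: IH => L Ls; [apply: nT|apply: cp]; rewrite inE Ls orbT.
apply: bounded_suppD.
  have [M KM] := tri_square K.
  by apply: bounded_supp_indic KM _ => //; apply: cp; rewrite mem_head.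
have -> : (fun x => (1 - \1_(tri K) x) * glue s p x) =
    (fun x => glue s p x * (1 - \1_(tri K) x)) by apply/funext => x; rewrite mulrC.
apply: bounded_suppM => //.
  by apply: measurable_funB => //; exact: measurable_indic.
exists 1 => x _; rewrite indicE.
by case: (_ \in _); rewrite ?subrr ?subr0 ?normr0 ?normr1.
Qed.

Lemma L2_bounded_supp Omega f : measurable (Omega : set pl) -> bounded_supp f ->
  L2 Omega f.
Proof.
move=> mO bf; apply: bounded_supp_L2.
have -> : f \_ Omega = (fun x => f x * \1_Omega x).
  apply/funext => x; rewrite patchE indicE.
  by case: ifP; rewrite ?mulr1 ?mulr0.
apply: (@bounded_suppM _ f \1_Omega) => //.
exists 1 => x _; rewrite indicE.
by case: (_ \in _); rewrite ?normr0 ?normr1.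
Qed.

Lemma integral_split_eq0 Omega f g : bounded_supp f -> bounded_supp g ->
  (forall x, ~ Omega x -> f x = 0 /\ g x = 0) ->
  \int[mu]_x (f x + g x) = 0 ->
  \int[mu]_(x in Omega) g x = - \int[mu]_(x in Omega) f x.
Proof.
move=> bf bg fg0 fg.
have fO : f \_ Omega = f.
  apply/funext => x; rewrite patchE; case: ifPn => // /negP xO.
  by have [->] := fg0 x (fun h => xO (mem_set h)).
have gO : g \_ Omega = g.
  apply/funext => x; rewrite patchE; case: ifPn => // /negP xO.
  by have [_ ->] := fg0 x (fun h => xO (mem_set h)).
rewrite Rintegral_mkcond gO [in RHS]Rintegral_mkcond fO.
move: fg; rewrite RintegralD//; try exact: bounded_supp_integrable.
by rewrite addrC => /eqP; rewrite addr_eq0 => /eqP.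
Qed.

Lemma near_inside K x v : nondegenerate_tri K -> inside K x ->
  \forall n \near \oo, tri K (x + harmonic n *: v).
Proof.
move=> nK xK; have xin : inward K x v by move=> i; left.
have [e e0 he] := inward_inside xin.
have : \forall n \near \oo, harmonic n < e.
  exact: (cvgr_lt 0 (@cvg_harmonic R) _ e0).
move=> he'; near=> n; apply: inside_tri => //; apply: he.
by rewrite harmonic_gt0/=; apply: ltW; near: n.
Unshelve. all: by end_near. Qed.

Lemma cvg_harmonic_line x v : (fun n => x + harmonic n *: v) @ \oo --> x.
Proof.
rewrite -[X in _ --> X]addr0 -(scale0r v).
by apply: cvgD; [exact: cvg_cst | apply: cvgZr_tmp; exact: cvg_harmonic].
Qed.

Lemma closed_mesh_union T : nondeg T -> closed (mesh_union T).
Proof.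
by move=> nT; apply: closed_bigcup => [|K /= KT]; [exact: finite_fset | exact/closed_tri/nT].
Qed.

(* Continuity across the mesh is what makes the glued function Lipschitz. *)
Lemma glue_ibp Omega T p p' v psi : nondeg T -> interior_disjoint T ->
  Omega `<=` mesh_union T ->
  (forall K, K \in T -> C1dir v (p K) (p' K)) ->
  (forall K K' x, K \in T -> K' \in T -> tri K x -> tri K' x -> p K x = p K' x) ->
  test_function Omega psi ->
  \int[mu]_(x in Omega) (glue T p x *
     (v.1 * partial ord0 psi x + v.2 * partial ord_max psi x)) =
  - \int[mu]_(x in Omega) (glue T p' x * psi x).
Proof.
move=> nT dT OT dp sv tp.
pose dpsi x := v.1 * partial ord0 psi x + v.2 * partial ord_max psi x.
have dps : C1dir v psi dpsi := smooth_C1dir v tp.1.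
have [A [cA _ AO A0]] := test_function_supp tp.
have [bpsi _] := test_bounded_supp tp; have bdpsi := bounded_supp_C1dir v tp.
have bg : bounded_supp (glue T p).
  by apply: bounded_supp_glue nT _ => K /dp[].
have bg' : bounded_supp (glue T p').
  by apply: bounded_supp_glue nT _ => K /dp[].
have bm f g : bounded_supp f -> bounded_supp g -> bounded_supp (fun x => f x * g x).
  move=> bf [mg [M gM]]; apply: bounded_suppM => //.
  by exists M => x _; case: (gM x).
have gE K x : K \in T -> tri K x -> glue T p x = p K x.
  by move=> KT xK; apply: glue_in => // K' K'T xK'; exact: sv.
apply: (integral_split_eq0 (bm _ _ bg' bpsi) (bm _ _ bg bdpsi)).
  move=> x xO; have [h1 h2] := A0 x (fun h => xO (AO _ h)).
  by rewrite h1 !h2 !mulr0 addr0 mulr0.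
(* [None] stands for the closed zero set of [psi]. It contains the complement of the mesh, so that
   whole lines are covered by the pieces. *)
pose F (o : option T) : set (plane R) :=
  if o is Some K then tri (val K) else [set x | psi x = 0].
pose P (o : option T) x := if o is Some K then p (val K) x * psi x else 0.
pose P' (o : option T) x :=
  if o is Some K then p' (val K) x * psi x + p (val K) x * dpsi x else 0.
suff : mu.-integrable setT (EFin \o (fun x => glue T p' x * psi x + glue T p x * dpsi x))
  /\ \int[mu]_x (glue T p' x * psi x + glue T p x * dpsi x) = 0 by case.
apply: (@piecewise_integral_eq0 _ _ F P P' (fun x => glue T p x * psi x) _ v).
- exact: bm.
- have [mb _] := bounded_suppD (bm _ _ bg' bpsi) (bm _ _ bg bdpsi); exact: mb.
- case=> [K|] /=; first by apply/closed_tri/nT/valP.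
  apply: (@preimage_closed _ _ psi [set 0]); last exact: closed_eq.
  by move=> x _; case: dps.
- case=> [K|]; last exact: C1dir_cst.
  by apply: C1dirM => //; exact/dp/valP.
apply: ae_imp (ae_generic nT) => x gx; split.
- move=> r; have [h|h] := pselect (A (x + r *: v)); last first.
    by exists None; case: (A0 _ h).
  have [K /= KT hK] := OT _ (AO _ h).
  by exists (Some [` KT]%fset).
- move=> r [K|] /= h; last by rewrite h mulr0.
  by rewrite (gE (val K))//; exact: valP.
have [[K KT xK]|xT] := pselect (exists2 K, K \in T & tri K x).
  exists (Some [` KT]%fset); split => //=.
    by apply: near_inside; [exact: nT | exact: (@generic_inside T)].
  by rewrite (gE K)// (glue_generic _ nT dT gx KT xK).
have xU : ~ mesh_union T x by case=> K /= KT xK; apply: xT; exists K.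
have out y : ~ mesh_union T y -> psi y = 0.
  by move=> yU; case: (A0 y) => // /AO /OT.
have xn K : K \in T -> ~ tri K x by move=> KT xK; apply: xT; exists K.
exists None; split.
- exact: out.
- have oU : nbhs x (~` mesh_union T).
    by apply: open_nbhs_nbhs; split => //; apply/closed_openC/closed_mesh_union.
  near=> n; apply: out; near: n; exact: (cvg_harmonic_line _ oU).
- by rewrite !glue_out//= !mul0r addr0.
Unshelve. all: by end_near. Qed.

Lemma glue_H1 Omega T p m : measurable (Omega : set pl) -> nondeg T ->
  interior_disjoint T -> Omega `<=` mesh_union T ->
  (forall K, K \in T -> poly_fun m (p K)) ->
  (forall K K' x, K \in T -> K' \in T -> tri K x -> tri K' x -> p K x = p K' x) ->
  H1 Omega (glue T p).
Proof.
move=> mO nT dT OT pp sv.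
have cp v : exists p' : triangle R -> plane R -> R,
    forall K, K \in T -> C1dir v (p K) (p' K).
  have /choice[p' hp'] : forall K, exists q, K \in T -> C1dir v (p K) q.
    move=> K; have [KT|KT] := boolP (K \in T); last by exists (fun=> 0).
    by have [q hq] := C1dir_poly v (pp K KT); exists q.
  by exists p'.
split.
  apply: L2_bounded_supp => //; have [p' hp'] := cp 0.
  by apply: bounded_supp_glue nT _ => K /hp'[].
move=> i; have [p' hp'] := cp (unit_vec R i).
exists (glue T p').
  apply: L2_bounded_supp => //.
  by apply: bounded_supp_glue nT _ => K /hp'[].
move=> psi tp; rewrite -(glue_ibp nT dT OT hp' sv tp).
apply: eq_Rintegral => x _; congr (_ * _).
rewrite /unit_vec /=; case: i {p' hp'} => [[|[|//]]] hi /=.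
  by rewrite mul1r mul0r addr0; congr (partial _ _ _); exact/val_inj.
by rewrite mul1r mul0r add0r; congr (partial _ _ _); exact/val_inj.
Qed.

(* On the lines parallel to [v] that miss the edge where [q] may jump, the
   extension of [q] by zero is Lipschitz. *)
Lemma bubble_ibp Omega K q q' v l psi : nondegenerate_tri K -> C1dir v q q' ->
  (forall x, bary K l (x + v) = bary K l x) ->
  (forall i x, i != l -> tri K x -> bary K i x = 0 -> q x = 0) ->
  test_function Omega psi ->
  \int[mu]_(x in Omega) ((\1_(tri K) x * q x) *
     (v.1 * partial ord0 psi x + v.2 * partial ord_max psi x)) =
  - \int[mu]_(x in Omega) ((\1_(tri K) x * q' x) * psi x).
Proof.
move=> nK dq lv q0 tp.
pose dpsi x := v.1 * partial ord0 psi x + v.2 * partial ord_max psi x.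
have dps : C1dir v psi dpsi := smooth_C1dir v tp.1.
have [A [cA _ AO A0]] := test_function_supp tp.
have [bpsi _] := test_bounded_supp tp; have bdpsi := bounded_supp_C1dir v tp.
have mK : measurable (tri K : set pl) by apply: closed_plane_measurable; exact: closed_tri.
have [M KM] := tri_square K.
have bg : bounded_supp (fun x => \1_(tri K) x * q x).
  by apply: bounded_supp_indic KM _ => //; case: dq.
have bg' : bounded_supp (fun x => \1_(tri K) x * q' x).
  by apply: bounded_supp_indic KM _ => //; case: dq.
have bm f g : bounded_supp f -> bounded_supp g -> bounded_supp (fun x => f x * g x).
  move=> bf [mg [N gN]]; apply: bounded_suppM => //.
  by exists N => x _; case: (gN x).
have lline x (r : R) : bary K l (x + r *: v) = bary K l x.
  by rewrite affine_line ?lv ?subrr ?mulr0 ?addr0//; exact: affine_bary.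
apply: (integral_split_eq0 (bm _ _ bg' bpsi) (bm _ _ bg bdpsi)).
  move=> x xO; have [h1 h2] := A0 x (fun h => xO (AO _ h)).
  by rewrite h1 !h2 !mulr0 addr0 mulr0.
(* The outside of [K] is covered by three closed half planes, each bounded by the line of an edge;
   the function to be glued is zero on them. *)
pose F (o : option 'I_3) : set (plane R) :=
  if o is Some i then [set x | bary K i x <= 0] else tri K.
pose P (o : option 'I_3) x := if o is Some i then 0 else q x * psi x.
pose P' (o : option 'I_3) x :=
  if o is Some i then 0 else q' x * psi x + q x * dpsi x.
pose h x := \1_(tri K) x * q' x * psi x + \1_(tri K) x * q x * dpsi x.
suff : mu.-integrable setT (EFin \o h) /\ \int[mu]_x h x = 0 by case.
apply: (@piecewise_integral_eq0 _ _ F P P' (fun x => \1_(tri K) x * q x * psi x) _ v).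
- exact: bm.
- have [mb _] := bounded_suppD (bm _ _ bg' bpsi) (bm _ _ bg bdpsi); exact: mb.
- by case=> [i|] /=; [exact: closed_bary_le0 | exact: closed_tri].
- case=> [i|]; first exact: C1dir_cst.
  exact: C1dirM.
have cover y : exists o, F o y.
  have [/(triP _ nK) yK|yK] := pselect (forall i, 0 <= bary K i y).
    by exists None.
  suff [i hi] : exists i, bary K i y < 0 by exists (Some i); exact: ltW.
  apply: contrapT => hn; apply: yK => i; rewrite leNgt; apply/negP => hi.
  by apply: hn; exists i.
have : \forall x \ae mu, generic [fset K]%fset x.
  by apply: ae_generic => L; rewrite inE => /eqP ->.
apply: ae_imp => x gx.
have nz i : bary K i x != 0 by apply: gx; rewrite inE.
split.
- by move=> r; exact: cover.
- move=> r [i|] /= hy; last by rewrite indicE mem_set// mul1r.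
  rewrite indicE; have [/set_mem yK|] := boolP (_ \in _); last by rewrite !mul0r.
  have hi0 : bary K i (x + r *: v) = 0.
    by apply/eqP; rewrite eq_le hy /=; move/(triP _ nK) : yK; apply.
  (* The line cannot meet the edge opposite [l], as [bary K l] is constant along it and nonzero at
     the generic point [x]; on the other edges [q] vanishes. *)
  have [il|il] := eqVneq i l.
    by move: hi0 (nz l); rewrite il lline => ->; rewrite eqxx.
  by rewrite (q0 i)// mulr0 mul0r.
have [/(triP _ nK) xK|xK] := pselect (forall i, 0 <= bary K i x).
  exists None; split => //=.
    apply: near_inside => // i; rewrite lt0r nz.
    by move/(triP _ nK) : xK; apply.
  by rewrite /h indicE mem_set// !mul1r.
have [i hi] : exists i, bary K i x < 0.
  apply: contrapT => hn; apply: xK => i; rewrite leNgt; apply/negP => hi.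
  by apply: hn; exists i.
exists (Some i); split => /=.
- exact: ltW.
- have cb : bary K i @ x --> bary K i x by exact: (affine_continuous (affine_bary K i)).
  have cl := cvg_comp _ _ (cvg_harmonic_line (x := x) v) cb.
  by near=> n; apply: ltW; near: n; exact: (cvgr_lt (bary K i x) cl _ hi).
- by rewrite /h indicE memNset ?mul0r ?addr0// => /(triP _ nK).
Unshelve. all: by end_near. Qed.

End Glue.

(** * Crossing parity with respect to a closed polygon *)

Section CrossingParity.
Variable R : realType.
(** [X] and [H] stand for the two coordinates in either order and [d] for the unit vector of [X].
    Both orders are needed, since rays have to be transversal to a given edge. *)
Variables (X H : plane R -> R) (d : plane R).
Hypotheses (cX : continuous X) (cH : continuous H).
Hypothesis XH_inj : forall x y, X x = X y -> H x = H y -> x = y.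
Hypothesis XH_lin : forall (s : R) x y,
  X ((1 - s) *: x + s *: y) = (1 - s) * X x + s * X y /\
  H ((1 - s) *: x + s *: y) = (1 - s) * H x + s * H y.
Hypothesis XH_d : forall (s : R) x, X (x + s *: d) = X x + s /\ H (x + s *: d) = H x.
Implicit Types (p q x y z : plane R).

(** Twice the signed area of [p q y] in the coordinates [X] and [H]; its sign tells the side of the
    line through [p] and [q]. *)
Definition det_edge p q y := (X q - X p) * (H y - H p) - (X y - X p) * (H q - H p).

(* the ray from [y] in direction [d], the level line of [H] on which [X] grows,
   crosses the edge [p q], where the edge contains only its lower end *)
Definition crossing p q y : bool :=
  ((H y < H p) (+) (H y < H q)) && (0 < det_edge p q y * (H q - H p)).

(* the part of [crossing] due to an end [p] on the ray from [x] *)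
Definition endpoint_crossing x p y : bool :=
  [&& H p == H x, X x < X p & H y < H p].

Lemma crossingC p q y : crossing p q y = crossing q p y.
Proof.
by rewrite /crossing addbC; congr (_ && (0 < _)); rewrite /det_edge; ring.
Qed.

Lemma det_edge_continuous p q : continuous (fun y => det_edge p q y * (H q - H p)).
Proof.
move=> y; apply: cvgM; last exact: cvg_cst.
by apply: cvgB; apply: cvgM; try exact: cvg_cst;
  (apply: cvgB; last exact: cvg_cst); [exact: cH | exact: cX].
Qed.

Lemma det_edge_sign p q x : det_edge p q x * (H q - H p) != 0 ->
  \forall y \near x, (0 < det_edge p q y * (H q - H p)) =
                     (0 < det_edge p q x * (H q - H p)).
Proof.
move=> d0; have cd := @det_edge_continuous p q x.
have [dp|dp] := ltP 0 (det_edge p q x * (H q - H p)).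
  by near=> y; near: y; exact: (cvgr_gt _ cd _ dp).
have dn : det_edge p q x * (H q - H p) < 0 by rewrite lt_neqAle d0.
have h := cvgr_lt _ cd _ dn.
near=> y; apply/negbTE; rewrite -leNgt; apply: ltW; near: y; exact: h.
Unshelve. all: by end_near. Qed.

Lemma height_sign p x : H p != H x ->
  \forall y \near x, (H y < H p) = (H x < H p).
Proof.
move=> px; have cx : H @ x --> H x by exact: cH.
have [hp|hp] := ltP (H x) (H p).
  by have h := cvgr_lt _ cx _ hp; near=> y; near: y; exact: h.
have hp' : H p < H x by rewrite lt_neqAle px.
have h := cvgr_gt _ cx _ hp'.
near=> y; apply/negbTE; rewrite -leNgt; apply: ltW; near: y; exact: h.
Unshelve. all: by end_near. Qed.

(** Near a point [x] off the edge, [crossing] changes only when [y] passes the level of an end that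
    lies on the ray from [x]. The endpoint terms record these changes, so the sum is locally
    constant. *)
Lemma crossing_locally p q x : ~ segment p q x -> exists c : bool,
  \forall y \near x,
    crossing p q y (+) (endpoint_crossing x p y (+) endpoint_crossing x q y) = c.
Proof.
have seg_in s u v : 0 <= s <= 1 -> X x = (1 - s) * X u + s * X v ->
    H x = (1 - s) * H u + s * H v -> segment u v x.
  move=> s01 e1 e2; exists s; first by rewrite /= in_itv.
  by apply: XH_inj; [rewrite (XH_lin s u v).1|rewrite (XH_lin s u v).2].
have one u v : H u = H x -> H v != H x -> ~ segment u v x -> exists c : bool,
    \forall y \near x, crossing u v y (+)
      (endpoint_crossing x u y (+) endpoint_crossing x v y) = c.
  move=> ux vx nseg.
  have Xux : X u != X x.
    apply/eqP => Xux; apply: nseg; apply: (seg_in 0); first by rewrite lexx ler01.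
      by rewrite subr0 mul1r mul0r addr0.
    by rewrite subr0 mul1r mul0r addr0.
  have dE : det_edge u v x * (H v - H u) = (X u - X x) * (H v - H u) ^+ 2.
    by rewrite /det_edge ux; ring.
  have vu2 : 0 < (H v - H u) ^+ 2.
    by rewrite exprn_even_gt0//= subr_eq0 ux.
  have d0 : det_edge u v x * (H v - H u) != 0.
    by rewrite dE mulf_neq0 ?subr_eq0// gt_eqF.
  exists ((H x < H v) && (X x < X u)).
  have h1 := det_edge_sign d0; have h2 := height_sign vx.
  near=> y.
  rewrite /crossing /endpoint_crossing (negbTE vx) ux eqxx /= addbF.
  rewrite (near h2 y)//; have -> : (0 < det_edge u v y * (H v - H x)) = (X x < X u).
    by rewrite -ux (near h1 y)// dE pmulr_lgt0// subr_gt0.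
  by case: (H y < H x); case: (H x < H v); case: (X x < X u).
move=> nseg.
have [px|px] := eqVneq (H p) (H x); have [qx|qx] := eqVneq (H q) (H x).
(* The whole edge is at the level of [x]. As [x] is not on it, both ends lie ahead of [x] or both
   behind, and their terms cancel. *)
- exists false; near=> y.
  rewrite /crossing /endpoint_crossing px qx eqxx addbb /=.
  have [h1|h1] := ltP (X x) (X p); have [h2|h2] := ltP (X x) (X q); rewrite ?addbb//.
    exfalso; apply: nseg.
    have pq : X p - X q != 0 by rewrite subr_eq0 gt_eqF// (le_lt_trans h2 h1).
    have pq0 : 0 < X p - X q by rewrite subr_gt0 (le_lt_trans h2 h1).
    apply: (seg_in ((X p - X x) / (X p - X q))).
    + by rewrite divr_ge0 ?ler_pdivrMr ?mul1r//; lra.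
    + by field.
    + by rewrite px qx; ring.
  exfalso; apply: nseg.
  have pq : X q - X p != 0 by rewrite subr_eq0 gt_eqF// (le_lt_trans h1 h2).
  have pq0 : 0 < X q - X p by rewrite subr_gt0 (le_lt_trans h1 h2).
  apply: (seg_in ((X x - X p) / (X q - X p))).
  + by rewrite divr_ge0 ?ler_pdivrMr ?mul1r//; lra.
  + by field.
  + by rewrite px qx; ring.
- exact: one.
- have [|c hc] := one q p qx px.
    move=> [s]; rewrite /= in_itv/= => s01 sx; apply: nseg; exists (1 - s).
      by rewrite /= in_itv/=; lra.
    by rewrite -sx opprB [1 + _]addrC subrK addrC.
  exists c; apply: filterS hc => y.
  by rewrite crossingC addbC (addbC (endpoint_crossing x q y)) addbC.
exists (crossing p q x).
have h1 := height_sign px; have h2 := height_sign qx.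
have [e|e] := eqVneq (H x < H p) (H x < H q).
  near=> y.
  rewrite /crossing /endpoint_crossing (negbTE px) (negbTE qx) /= addbF.
  by rewrite (near h1 y)// (near h2 y)// e addbb.
have pq0 : H q - H p != 0.
  by rewrite subr_eq0; apply: contra_neq e => ->.
have d0 : det_edge p q x * (H q - H p) != 0.
  rewrite mulf_neq0//; apply/eqP => de; apply: nseg.
  apply: (seg_in ((H x - H p) / (H q - H p))).
  - move: e; have [a|a] := ltP (H x) (H p); have [b|b] := ltP (H x) (H q) => // _.
      have s0 : H q - H p < 0 by lra.
      have -> : (H x - H p) / (H q - H p) = (H p - H x) / (H p - H q).
        by rewrite -(opprB (H x)) -(opprB (H q)) invrN mulrNN.
      by rewrite divr_ge0 ?ler_pdivrMr ?mul1r//; lra.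
    have s0 : 0 < H q - H p by rewrite lt_neqAle eq_sym pq0; lra.
    by rewrite divr_ge0 ?ler_pdivrMr ?mul1r//; lra.
  - apply: (mulIf pq0).
    rewrite (_ : (_ + _) * _ = X p * (H q - H p) + (X q - X p) * (H x - H p)).
      by move: de; rewrite /det_edge; lra.
    by field.
  - by field.
have h3 := det_edge_sign d0.
near=> y.
rewrite /crossing /endpoint_crossing (negbTE px) (negbTE qx) /= addbF.
by rewrite (near h1 y)// (near h2 y)// (near h3 y).
Unshelve. all: by end_near. Qed.

Section Polygon.
Variables (n : nat) (p : 'I_n -> plane R).

Definition parity y : bool := \big[addb/false]_i crossing (p i) (p (ordS i)) y.

Lemma parity_locally x : ~ polygon_trace p x ->
  \forall y \near x, parity y = parity x.
Proof.
move=> nx.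
have /choice[c hc] : forall i, exists c : bool, \forall y \near x,
    crossing (p i) (p (ordS i)) y (+) (endpoint_crossing x (p i) y (+)
      endpoint_crossing x (p (ordS i)) y) = c.
  by move=> i; apply: crossing_locally => h; apply: nx; exists i.
have pE : \forall y \near x, parity y = \big[addb/false]_i c i.
  have hall : \forall y \near x, forall i, crossing (p i) (p (ordS i)) y (+)
      (endpoint_crossing x (p i) y (+) endpoint_crossing x (p (ordS i)) y) = c i.
    exact: (@filter_forall _ _ (fun i y => _ = c i) _ (nbhs_filter x) hc).
  near=> y.
  have : \big[addb/false]_i (crossing (p i) (p (ordS i)) y (+)
      (endpoint_crossing x (p i) y (+) endpoint_crossing x (p (ordS i)) y)) =
      \big[addb/false]_i c i.
    by apply: eq_bigr => i _; move: i; near: y.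
  (* Each vertex is an end of two consecutive edges, so the endpoint terms cancel around the
     polygon. *)
  rewrite big_split big_split /=.
  rewrite [X in _ (+) (_ (+) X)](_ : _ = \big[addb/false]_i endpoint_crossing x (p i) y).
    by rewrite addbb addbF.
  by rewrite [RHS](reindex_inj (@ordS_inj n)).
have px := nbhs_singleton pE.
by near=> y; rewrite px; near: y.
Unshelve. all: by end_near. Qed.

(** The ray crosses the edge [i] from the point behind it only. All other edges count equally for
    both points: the endpoint terms depend on the level [H], which is unchanged along [d]. *)
Lemma parity_jump i z : H (p i) != H (p (ordS i)) ->
  (exists2 s, 0 < s < 1 & z = (1 - s) *: p i + s *: p (ordS i)) ->
  (forall j, j != i -> ~ segment (p j) (p (ordS j)) z) ->
  \forall m \near \oo, parity (z + harmonic m *: d) != parity (z + harmonic m *: - d).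
Proof.
move=> Hi [s /andP[s0 s1] zE] zj.
have cl := (cvg_harmonic_line (x := z) d, cvg_harmonic_line (x := z) (- d)).
have other j : j != i -> \forall m \near \oo,
    crossing (p j) (p (ordS j)) (z + harmonic m *: d) =
    crossing (p j) (p (ordS j)) (z + harmonic m *: - d).
  move=> ji; have [c hc] := crossing_locally (zj j ji).
  have h1 := cl.1 _ hc; have h2 := cl.2 _ hc.
  near=> m.
  have e1 : crossing (p j) (p (ordS j)) (z + harmonic m *: d) (+)
    (endpoint_crossing z (p j) (z + harmonic m *: d) (+)
     endpoint_crossing z (p (ordS j)) (z + harmonic m *: d)) = c.
    by near: m.
  have e2 : crossing (p j) (p (ordS j)) (z + harmonic m *: - d) (+)
    (endpoint_crossing z (p j) (z + harmonic m *: - d) (+)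
     endpoint_crossing z (p (ordS j)) (z + harmonic m *: - d)) = c.
    by near: m.
  have Hd : H (z + harmonic m *: - d) = H (z + harmonic m *: d).
    by rewrite scalerN -scaleNr !(XH_d _ z).2.
  move: e1 e2; rewrite /endpoint_crossing Hd => e1 e2.
  by move: e1; rewrite -e2; exact: addIb.
have all_other : \forall m \near \oo, forall j, j != i ->
    crossing (p j) (p (ordS j)) (z + harmonic m *: d) =
    crossing (p j) (p (ordS j)) (z + harmonic m *: - d).
  apply: filter_forall => j; have [->|ji] := eqVneq j i; first by apply: nearW.
  by have := other j ji; apply: filterS => m h _.
near=> m.
rewrite /parity (bigD1 i)//= [X in _ != X](bigD1 i)//=.
rewrite [X in _ (+) X != _](eq_bigr
  (fun j => crossing (p j) (p (ordS j)) (z + harmonic m *: - d))); last first.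
  by move=> j ji; move: j ji; near: m.
set t := harmonic m.
have t0 : 0 < t by exact: harmonic_gt0.
have [zX zH] : X z = (1 - s) * X (p i) + s * X (p (ordS i)) /\
    H z = (1 - s) * H (p i) + s * H (p (ordS i)) by rewrite zE.
have cr (r : R) : crossing (p i) (p (ordS i)) (z + r *: d) = (r < 0).
  rewrite /crossing /det_edge !(XH_d r z).1 !(XH_d r z).2.
  set D := H (p (ordS i)) - H (p i).
  have D0 : D != 0 by rewrite subr_eq0 eq_sym.
  have HzE : H z = H (p i) + s * D by rewrite zH /D; ring.
  have HzE' : H z = H (p (ordS i)) - (1 - s) * D by rewrite zH /D; ring.
  have -> : (H z < H (p i)) (+) (H z < H (p (ordS i))).
    rewrite {1}HzE HzE' gtrDl ltrBlDr ltrDl.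
    rewrite (pmulr_rgt0 _ (_ : 0 < 1 - s)) ?subr_gt0// (pmulr_rlt0 _ s0).
    by rewrite -[X in _ (+) X]subr_gt0 -/D; case: (ltgtP D 0) D0.
  have -> : ((X (p (ordS i)) - X (p i)) * (H z - H (p i)) -
      (X z + r - X (p i)) * D) * D = - r * D ^+ 2.
    by rewrite zX HzE; ring.
  by rewrite /= pmulr_lgt0 ?exprn_even_gt0//= oppr_gt0.
have -> : t *: - d = - t *: d by rewrite scalerN scaleNr.
rewrite !cr ltNge (ltW t0) oppr_lt0 t0 /=.
by case: (\big[addb/false]_(_ | _) _).
Unshelve. all: by end_near. Qed.

End Polygon.
End CrossingParity.

(** * The interior of the closure of a polygonal domain *)

Section PolygonalDomain.
Variable R : realType.
Implicit Types (Omega : set (plane R)) (x y z a b : plane R).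

Lemma continuous_fst_snd : continuous (fst : plane R -> R) /\
  continuous (snd : plane R -> R).
Proof. by split => x; [exact: cvg_fst | exact: cvg_snd]. Qed.

Lemma closed_segment a b : closed (segment a b).
Proof.
apply: compact_closed; first exact: norm_hausdorff.
apply: continuous_compact; last exact: segment_compact.
apply: continuous_subspaceT => s.
apply: cvgD; apply: cvgZr_tmp; last exact: cvg_id.
by apply: cvgB; [exact: cvg_cst | exact: cvg_id].
Qed.

Lemma ordS_neq n (i : 'I_n) : (2 < n)%N -> ordS i != i.
Proof.
move=> n2; rewrite -val_eqE /=; have := ltn_ord i; rewrite leq_eqVlt => /orP[/eqP e|lt].
  by rewrite e modnn eq_sym; lia.
by rewrite modn_small//; lia.
Qed.

(* A boundary point cannot be interior to the closure: near an edge of the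
   polygon, both sides would lie in the connected set [Omega], but the crossing
   parity with respect to that polygon differs on the two sides. *)
Lemma polygonal_interior Omega z : bounded_polygonal_domain Omega ->
  nbhs z (closure Omega) -> Omega z.
Proof.
move=> [_ oO cO _ [N [n [p [sp disj bdE]]]]] zc.
apply: contrapT => nOz.
have [j _ [i _ zi]] : (\bigcup_j polygon_trace (p j)) z.
  by rewrite -bdE; split => //; exact: nbhs_singleton zc.
have [n2 pinj psimple] := sp j.
pose a := p j i; pose b := p j (ordS i).
have ab : a != b.
  by apply/eqP => /pinj/esym/eqP; rewrite (negbTE (ordS_neq i n2)).
move: zi => [s0]; rewrite /= in_itv/= => /andP[s00 s01] zE.
(* move [z] to the relative interior of the edge *)
have [w wc [s /andP[s0' s1'] wE]] : exists2 w, nbhs w (closure Omega) &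
    exists2 s, 0 < s < 1 & w = (1 - s) *: a + s *: b.
  have zcc : nbhs z [set y | nbhs y (closure Omega)] by exact: nbhs_interior zc.
  (* The displacement points to the midpoint of the edge, so any positive fraction of it leaves the
     ends of the edge. *)
  have h : \forall m \near \oo,
      nbhs (z + harmonic m *: ((2^-1 - s0) *: (b - a))) (closure Omega).
    exact: (cvg_harmonic_line _ zcc).
  have [m hm] := filter_ex h.
  set t := harmonic m in hm.
  have t0 : 0 < t by exact: harmonic_gt0.
  have t1 : t <= 1 by rewrite /t/= invf_le1// ler1n.
  exists (z + t *: ((2^-1 - s0) *: (b - a))) => //.
  exists (s0 + t * (2^-1 - s0)); first by apply/andP; split; nra.
  by rewrite -zE -/a -/b; apply: plane_eq; rewrite !planeE; ring.
have other k : k != i -> ~ segment (p j k) (p j (ordS k)) w.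
  move=> ki hk.
  have wab : segment a b w.
    by exists s => //=; rewrite in_itv/= !ltW.
  have : (segment (p j k) (p j (ordS k)) `&` segment a b) w by [].
  rewrite (psimple k i ki) /= -/a.
  have wb (r : R) : w - b = (1 - s) *: (a - b).
    by rewrite wE; apply: plane_eq; rewrite !planeE; ring.
  case=> -[e ew].
    have : s *: (b - a) = 0 by rewrite -(subrr a) -{2}ew wE; apply: plane_eq; rewrite !planeE; ring.
    by move/eqP; rewrite scaler_eq0 subr_eq0 (eq_sym b) (negbTE ab) orbF gt_eqF.
  have : (1 - s) *: (a - b) = 0 by rewrite -wb// ew /b -e subrr.
  by move/eqP; rewrite scaler_eq0 !subr_eq0 (negbTE ab) orbF => /eqP; lra.
have far j' : j' != j -> ~ polygon_trace (p j') w.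
  move=> jj' h; have : (polygon_trace (p j') `&` polygon_trace (p j)) w.
    by split => //; exists i => //; exists s => //=; rewrite in_itv/= !ltW.
  by rewrite disj.
suff key (X H : plane R -> R) (d : plane R) : continuous X -> continuous H ->
    (forall x y, X x = X y -> H x = H y -> x = y) ->
    (forall (s : R) x y, X ((1 - s) *: x + s *: y) = (1 - s) * X x + s * X y /\
      H ((1 - s) *: x + s *: y) = (1 - s) * H x + s * H y) ->
    (forall (s : R) x, X (x + s *: d) = X x + s /\ H (x + s *: d) = H x) ->
    H a != H b -> False.
  have [c1 c2] := continuous_fst_snd.
  have [ab2|ab2] := eqVneq a.2 b.2; last first.
    apply: (key fst snd (1, 0)) => //.
    - by move=> x y; exact: plane_eq.
    - by move=> r x; rewrite !planeE /= mulr1 mulr0 addr0.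
  apply: (key snd fst (0, 1)) => //.
  - by move=> x y e1 e2; exact: plane_eq.
  - by move=> r x; rewrite !planeE /= mulr1 mulr0 addr0.
  - by apply: contra_neq ab => ab1; exact: plane_eq.
move=> cX cH XHi XHl XHd Hab.
have jump := parity_jump cX cH XHi XHl XHd Hab
  (ex_intro2 _ _ s (introT andP (conj s0' s1')) wE) other.
(* Near [w] the closure of [Omega] contains all points, and no boundary is left except the edge
   [i]. *)
have nbd : \forall y \near w, closure Omega y /\
    (forall j', j' != j -> ~ polygon_trace (p j') y) /\
    (forall k, k != i -> ~ segment (p j k) (p j (ordS k)) y).
  have cl_near (A : set (plane R)) : closed A -> ~ A w -> \forall y \near w, ~ A y.
    by move=> cA nA; apply: open_nbhs_nbhs; split => //; exact: closed_openC.
  have h1 : \forall y \near w, forall j', j' != j -> ~ polygon_trace (p j') y.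
    apply: (@filter_forall _ _ (fun j' y => j' != j -> ~ _) _ (nbhs_filter w)) => j'.
    have [->|jj'] := eqVneq j' j; first by near=> y.
    have h : \forall y \near w, ~ polygon_trace (p j') y.
      apply: cl_near; last exact: far.
      by apply: closed_bigcup => [|k _]; [exact: finite_finset | exact: closed_segment].
    by near=> y => _; near: y.
  have h2 : \forall y \near w, forall k, k != i -> ~ segment (p j k) (p j (ordS k)) y.
    apply: (@filter_forall _ _ (fun k y => k != i -> ~ _) _ (nbhs_filter w)) => k.
    have [->|ki] := eqVneq k i; first by near=> y.
    have h : \forall y \near w, ~ segment (p j k) (p j (ordS k)) y.
      by apply: cl_near; [exact: closed_segment | exact: other].
    by near=> y => _; near: y.
  by near=> y; split; [near: y; exact: wc | split; near: y].
have inO (d' : plane R) : (forall r : R, H (w + r *: d') = H w) ->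
    (forall r : R, r != 0 -> X (w + r *: d') != X w) ->
    \forall m \near \oo, Omega (w + harmonic m *: d').
  move=> Hd' Xd'.
  have := cvg_harmonic_line (x := w) d' => /(_ _ nbd) h.
  near=> m.
  have [cy [ny1 ny2]] : closure Omega (w + harmonic m *: d') /\
    (forall j', j' != j -> ~ polygon_trace (p j') (w + harmonic m *: d')) /\
    (forall k, k != i -> ~ segment (p j k) (p j (ordS k)) (w + harmonic m *: d')).
    by near: m.
  apply: contrapT => nO.
  have [j1 _ tr] : (\bigcup_j polygon_trace (p j)) (w + harmonic m *: d').
    by rewrite -bdE.
  have jj1 : j1 = j by apply/eqP; apply/negPn/negP => /ny1.
  move: tr; rewrite jj1 => -[k _ sk].
  have ki : k = i by apply/eqP; apply/negPn/negP => /ny2.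
  move: sk; rewrite ki => -[r _ yE].
  have HE : (1 - r) * H a + r * H b = (1 - s) * H a + s * H b.
    by rewrite -(XHl r _ _).2 -(XHl s _ _).2 yE Hd' wE.
  have rs : r = s.
    have /eqP : (r - s) * (H b - H a) = 0 by lra.
    by rewrite mulf_eq0 !subr_eq0 (eq_sym (H b)) (negbTE Hab) orbF => /eqP.
  have := Xd' (harmonic m); rewrite gt_eqF ?harmonic_gt0// => /(_ isT).
  by rewrite -yE rs -/a -/b -wE eqxx.
have in1 := inO d (fun r => (XHd r w).2).
have in2 := inO (- d).
have Od : \forall m \near \oo, [/\ Omega (w + harmonic m *: d),
    Omega (w + harmonic m *: - d) &
    parity X H (p j) (w + harmonic m *: d) != parity X H (p j) (w + harmonic m *: - d)].
  have {}in1 : \forall m \near \oo, Omega (w + harmonic m *: d).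
    apply: in1 => r r0; rewrite (XHd r w).1 -subr_eq0 addrAC subrr add0r.
    exact: r0.
  have {}in2 : \forall m \near \oo, Omega (w + harmonic m *: - d).
    apply: in2 => r; first by rewrite scalerN -scaleNr (XHd _ w).2.
    move=> r0; rewrite scalerN -scaleNr (XHd _ w).1 -subr_eq0 addrAC subrr add0r.
    by rewrite oppr_eq0.
  by near=> m; split; near: m.
have [m [Om1 Om2 par12]] := filter_ex Od.
have nOtr y : Omega y -> ~ polygon_trace (p j) y.
  move=> Oy tr; have : (\bigcup_j polygon_trace (p j)) y by exists j.
  by rewrite -bdE => -[].
(* The parity is locally constant off the polygon, so [U c] is both open and closed relative to the
   connected set [Omega]. *)
pose U (c : bool) := [set y | Omega y /\ parity X H (p j) y = c].
have oU c : open (U c).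
  rewrite openE => y [Oy py].
  have h1 : nbhs y Omega by exact: open_nbhs_nbhs.
  have h2 := parity_locally cX cH XHi XHl (nOtr y Oy).
  by rewrite /interior; near=> x; split; [near: x | rewrite -py; near: x].
pose c := parity X H (p j) (w + harmonic m *: d).
have UO : U c = Omega.
  apply: cO.
  - by exists (w + harmonic m *: d).
  - by exists (U c) => //; apply/seteqP; split => y; [move=> h; split => //; case: h|case].
  - exists (~` U (~~ c)); first exact: open_closedC.
    apply/seteqP; split => y.
      by move=> [Oy py]; split => // -[_]; rewrite py; case: (c).
    move=> [Oy ny]; split => //; apply: contrapT => py; apply: ny; split => //.
    by move: py; case: (parity _ _ _ _); case: (c).
have : U c (w + harmonic m *: - d) by rewrite UO.
by case=> _ e; move: par12; rewrite e eqxx.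
Unshelve. all: by end_near. Qed.

End PolygonalDomain.

(** * Linear structure of L2, H1 and H(div) *)

Section FunctionSpaceClosure.
Variables (R : realType) (Omega : set (plane R)).
Hypothesis mO : measurable (Omega : set (measurableTypeR R * measurableTypeR R)).
Local Notation mu := (lebesgue2 R).
Local Notation pl := (measurableTypeR R * measurableTypeR R)%type.
Implicit Types (f g psi : plane R -> R) (sigma tau : plane R -> 'M[R]_2).

Let le12 : (1 <= 2%:E :> \bar R)%E.
Proof. by rewrite lee_fin; lra. Qed.

Lemma L2D f g : L2 Omega f -> L2 Omega g -> L2 Omega (fun x => f x + g x).
Proof.
move=> hf hg; rewrite /L2.
have -> : (fun x => f x + g x) \_ Omega = (f \_ Omega) \+ (g \_ Omega).
  by apply/funext => x; rewrite /= !patchE; case: ifP; rewrite ?addr0.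
exact: (Lfun_addr_closed mu le12).2 _ _ hf hg.
Qed.

Lemma L2Z (c : R) f : L2 Omega f -> L2 Omega (fun x => c * f x).
Proof.
move=> hf; rewrite /L2.
have -> : (fun x => c * f x) \_ Omega = c \o* (f \_ Omega).
  by apply/funext => x; rewrite /= !patchE; case: ifP; rewrite ?mul0r// mulrC.
by apply: Lfun_scale => //; rewrite ler1n.
Qed.

Lemma L2_cst0 : L2 Omega (fun=> 0).
Proof.
rewrite /L2 (_ : _ \_ _ = cst 0); last by apply/funext => x; rewrite patchE; case: ifP.
exact: (Lfun_addr_closed mu le12).1.
Qed.

Lemma L2_sum (n : nat) (F : 'I_n -> plane R -> R) :
  (forall i, L2 Omega (F i)) -> L2 Omega (fun x => \sum_i F i x).
Proof.
move=> h; elim: n F h => [|n IH] F h.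
  have -> : (fun x => \sum_(i < 0) F i x) = (fun=> 0).
    by apply/funext => x; rewrite big_ord0.
  exact: L2_cst0.
have -> : (fun x => \sum_i F i x) =
    (fun x => F ord0 x + \sum_(i < n) F (lift ord0 i) x).
  by apply/funext => x; rewrite big_ord_recl.
by apply: L2D => //; apply: IH => i.
Qed.

(** A product of two L2 functions is integrable; this is what makes the integrals of the weak
    formulations additive. *)
Lemma L2_integral f psi : L2 Omega f -> bounded_supp psi ->
  mu.-integrable setT (EFin \o (fun x => (f \_ Omega) x * psi x)) /\
  \int[mu]_(x in Omega) (f x * psi x) = \int[mu]_x ((f \_ Omega) x * psi x).
Proof.
move=> hf bpsi; split.
  by apply/Lfun1_integrable; apply: Lfun2_mul_Lfun1 => //; exact: bounded_supp_L2.
rewrite Rintegral_mkcond; apply: eq_Rintegral => x _.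
by rewrite !patchE; case: ifP; rewrite ?mul0r.
Qed.

Lemma L2_integralD f g psi chi : L2 Omega f -> L2 Omega g ->
  bounded_supp psi -> bounded_supp chi ->
  \int[mu]_(x in Omega) (f x * psi x + g x * chi x) =
  \int[mu]_(x in Omega) (f x * psi x) + \int[mu]_(x in Omega) (g x * chi x).
Proof.
move=> hf hg bp bc.
have [i1 ->] := L2_integral hf bp; have [i2 ->] := L2_integral hg bc.
rewrite -RintegralD// Rintegral_mkcond; apply: eq_Rintegral => x _.
by rewrite !patchE; case: ifP; rewrite ?mul0r ?addr0.
Qed.

Lemma L2_integralZ (c : R) f psi : L2 Omega f -> bounded_supp psi ->
  \int[mu]_(x in Omega) ((c * f x) * psi x) =
  c * \int[mu]_(x in Omega) (f x * psi x).
Proof.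
move=> hf bp; have [i1 ->] := L2_integral hf bp.
rewrite -RintegralZl// Rintegral_mkcond; apply: eq_Rintegral => x _.
by rewrite !patchE; case: ifP; rewrite ?mul0r ?mulr0// mulrA.
Qed.

Lemma H1D f g : H1 Omega f -> H1 Omega g -> H1 Omega (fun x => f x + g x).
Proof.
move=> [lf wf] [lg wg]; split; first exact: L2D.
move=> i; have [f' lf' hf] := wf i; have [g' lg' hg] := wg i.
exists (fun x => f' x + g' x); first exact: L2D.
move=> psi tp; have [bpsi bdpsi] := test_bounded_supp tp.
under eq_Rintegral do rewrite mulrDl.
under [in RHS]eq_Rintegral do rewrite mulrDl.
by rewrite !L2_integralD// hf// hg// opprD.
Qed.

Lemma H1Z (c : R) f : H1 Omega f -> H1 Omega (fun x => c * f x).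
Proof.
move=> [lf wf]; split; first exact: L2Z.
move=> i; have [f' lf' hf] := wf i.
exists (fun x => c * f' x); first exact: L2Z.
move=> psi tp; have [bpsi bdpsi] := test_bounded_supp tp.
by rewrite !L2_integralZ// hf// mulrN.
Qed.

Lemma H1_cst0 : H1 Omega (fun=> 0).
Proof.
split=> [|i]; first exact: L2_cst0.
exists (fun=> 0); first exact: L2_cst0.
move=> psi tp.
under eq_Rintegral do rewrite mul0r.
under [in RHS]eq_Rintegral do rewrite mul0r.
by rewrite Rintegral_mkcond (_ : _ \_ _ = cst 0) ?Rintegral_cst ?mul0r ?oppr0//;
  apply/funext => x; rewrite patchE; case: ifP.
Qed.

Lemma ae_symmetricD sigma tau : ae_symmetric Omega sigma -> ae_symmetric Omega tau ->
  ae_symmetric Omega (sigma \+ tau).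
Proof.
by apply: ae_imp2 => x h1 h2 xO /=; rewrite linearD /= h1// h2.
Qed.

Lemma H1_symD sigma tau : H1_sym Omega sigma -> H1_sym Omega tau ->
  H1_sym Omega (sigma \+ tau).
Proof.
move=> [s1 h1] [s2 h2]; split; first exact: ae_symmetricD.
move=> i j; rewrite (_ : (fun x => _) = (fun x => sigma x i j + tau x i j)).
  exact: H1D.
by apply/funext => x; rewrite mxE.
Qed.

Lemma sum2 (F : 'I_2 -> R) : \sum_i F i = F ord0 + F ord_max.
Proof. by rewrite !big_ord_recl big_ord0 addr0; congr (_ + F _); exact/val_inj. Qed.

Lemma row_div_integral sigma i (psi : plane R -> R) : (forall j, L2 Omega (fun x => sigma x i j)) ->
  test_function Omega psi ->
  \int[mu]_(x in Omega) (\sum_j sigma x i j * partial j psi x) =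
  \sum_j \int[mu]_(x in Omega) (sigma x i j * partial j psi x).
Proof.
move=> h /test_bounded_supp[_ bd]; rewrite sum2 -L2_integralD//.
by apply: eq_Rintegral => x _; rewrite sum2.
Qed.

Lemma Hdiv_symD sigma tau : Hdiv_sym Omega sigma -> Hdiv_sym Omega tau ->
  Hdiv_sym Omega (sigma \+ tau).
Proof.
move=> [s1 l1 d1] [s2 l2 d2]; split; first exact: ae_symmetricD.
  move=> i j; rewrite (_ : (fun x => _) = (fun x => sigma x i j + tau x i j)).
    exact: L2D.
  by apply/funext => x; rewrite mxE.
move=> i; have [g lg hg] := d1 i; have [g' lg' hg'] := d2 i.
exists (fun x => g x + g' x); first exact: L2D.
move=> psi tp; have [bpsi bdpsi] := test_bounded_supp tp.
under [in RHS]eq_Rintegral do rewrite mulrDl.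
rewrite L2_integralD// opprD -hg// -hg'// !row_div_integral//; last first.
  move=> j; rewrite (_ : (fun x => _) = (fun x => sigma x i j + tau x i j)).
    exact: L2D.
  by apply/funext => x; rewrite mxE.
rewrite -big_split; apply: eq_bigr => j _ /=.
rewrite -L2_integralD//; apply: eq_Rintegral => x _.
by rewrite mxE mulrDl.
Qed.

Lemma H1_sym_Hdiv sigma : H1_sym Omega sigma -> Hdiv_sym Omega sigma.
Proof.
move=> [s h]; split => // [i j|i]; first by case: (h i j).
have /choice[g hg] : forall j, exists g, L2 Omega g /\
    weak_partial Omega j (fun x => sigma x i j) g.
  by move=> j; have [_ /(_ j)[g ? ?]] := h i j; exists g.
exists (fun x => \sum_j g j x); first by apply: L2_sum => j; case: (hg j).
move=> psi tp; have [bpsi bdpsi] := test_bounded_supp tp.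
rewrite row_div_integral//; last by move=> j; case: (h i j).
under [in RHS]eq_Rintegral do rewrite sum2 mulrDl.
have [l0 w0] := hg ord0; have [l1 w1] := hg ord_max.
by rewrite L2_integralD// opprD sum2 w0// w1.
Qed.

Lemma dyad_sym (t : plane R) : (dyad t)^T = dyad t.
Proof. by apply/matrixP => i j; rewrite !mxE mulrC. Qed.

Lemma dyadZ (c : R) (t : plane R) : dyad (c *: t) = (c ^+ 2) *: dyad t.
Proof.
apply/matrixP => i j; rewrite !mxE /cart !planeE.
by case: ifP => _; case: ifP => _; ring.
Qed.

Lemma H1_sym_dyad f (t : plane R) : H1 Omega f -> H1_sym Omega (fun x => f x *: dyad t).
Proof.
move=> hf; split.
  by apply: aeW => x _; rewrite linearZ /= dyad_sym.
move=> i j; rewrite (_ : (fun x => _) = (fun x => dyad t i j * f x)); first exact: H1Z.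
by apply/funext => x; rewrite mxE mulrC.
Qed.

Lemma H1_sym_cst0 : H1_sym Omega (fun=> 0).
Proof.
have -> : (fun=> 0) = (fun x => (0 : R) *: dyad (0 : plane R)) :> (plane R -> 'M[R]_2).
  by apply/funext => x; rewrite scale0r.
exact/H1_sym_dyad/H1_cst0.
Qed.

(** Row [i] of [dyad t] is [cart t i] times [t], so every row divergence is a multiple of the one
    derivative along [t]. *)
Lemma Hdiv_dyad f g (t : plane R) : L2 Omega f -> L2 Omega g ->
  (forall psi, test_function Omega psi ->
    \int[mu]_(x in Omega) (f x *
      (t.1 * partial ord0 psi x + t.2 * partial ord_max psi x)) =
    - \int[mu]_(x in Omega) (g x * psi x)) ->
  Hdiv_sym Omega (fun x => f x *: dyad t).
Proof.
move=> lf lg h; split.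
- by apply: aeW => x _; rewrite linearZ /= dyad_sym.
- move=> i j; rewrite (_ : (fun x => _) = (fun x => dyad t i j * f x)); first exact: L2Z.
  by apply/funext => x; rewrite mxE mulrC.
move=> i; exists (fun x => cart t i * g x); first exact: L2Z.
move=> psi tp; have [bpsi bdpsi] := test_bounded_supp tp.
rewrite L2_integralZ// -mulrN -h// -L2_integralZ//; last exact: (bounded_supp_C1dir t tp).
apply: eq_Rintegral => x _; rewrite sum2 !mxE.
by rewrite /cart /=; case: ifP => _; ring.
Qed.

End FunctionSpaceClosure.

(** * Members and closure properties of the stress space and of the extended space *)

Section StressClosure.
Variables (R : realType) (k : nat) (Omega : set (plane R)).
Hypothesis mO : measurable (Omega : set (measurableTypeR R * measurableTypeR R)).
Local Notation mu := (lebesgue2 R).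
Local Notation pl := (measurableTypeR R * measurableTypeR R)%type.
Implicit Types (sigma tau : plane R -> 'M[R]_2) (K : triangle R) (T : mesh R).

Lemma poly_fun_symD m (p q : plane R -> 'M[R]_2) :
  poly_fun_sym m p -> poly_fun_sym m q -> poly_fun_sym m (p \+ q).
Proof.
move=> [ps pp] [qs qp]; split => [x|i j]; first by rewrite /= linearD /= ps qs.
by apply: poly_fun_ext (poly_funD (pp i j) (qp i j)) => x; rewrite mxE.
Qed.

Lemma bubbleD K sigma tau : bubble k K sigma -> bubble k K tau -> bubble k K (sigma \+ tau).
Proof.
move=> [p pp pE] [q qp qE]; exists (fun i j x => p i j x + q i j x).
  by move=> i j; exact: poly_funD.
move=> x; rewrite /= pE qE -big_split; apply: eq_bigr => i _ /=.
by rewrite -big_split; apply: eq_bigr => j _ /=; rewrite mulrDr scalerDl.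
Qed.

Lemma bubble0 K : bubble k K (fun=> 0).
Proof.
exists (fun _ _ _ => 0) => [i j|x]; first exact: poly_fun0.
by rewrite big1// => i _; rewrite big1// => j _; rewrite mulr0 scale0r.
Qed.

Lemma stress_spaceD T sigma tau : stress_space k Omega T sigma ->
  stress_space k Omega T tau -> stress_space k Omega T (sigma \+ tau).
Proof.
move=> [hs [sc [sb [sE sH sp sbub]]]] [ht [tc [tb [tE tH tp tbub]]]].
split; first exact: Hdiv_symD.
exists (sc \+ tc), (sb \+ tb); split.
- by apply: ae_imp2 sE tE => x h1 h2 xO /=; rewrite h1// h2//= addrACA.
- exact: H1_symD.
- move=> K KT; have [p pp pE] := sp K KT; have [q qp qE] := tp K KT.
  exists (p \+ q); first exact: poly_fun_symD.
  by apply: ae_imp2 pE qE => x h1 h2 xO /=; rewrite h1// h2.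
- move=> K KT; have [p pp pE] := sbub K KT; have [q qp qE] := tbub K KT.
  exists (p \+ q); first exact: bubbleD.
  by apply: ae_imp2 pE qE => x h1 h2 xO /=; rewrite h1// h2.
Qed.

Lemma H1_stress_space T sigma : H1_sym Omega sigma ->
  (forall K, K \in T -> exists2 p, poly_fun_sym k p & sigma = p %[ae mu in tri K]) ->
  stress_space k Omega T sigma.
Proof.
move=> hH hp; split; first exact: H1_sym_Hdiv.
exists sigma, (fun=> 0); split => //.
- by apply: aeW => x _ /=; rewrite addr0.
- by move=> K KT; exists (fun=> 0); [exact: bubble0 | apply: aeW].
Qed.

(** The bubble vanishes on two edges of [K], and its direction is tangential to the third, from [i]
    to [j]. Hence extension by zero keeps the derivative along [t] weakly in L2. *)
Lemma bubble_stress_space T K i j (q : plane R -> R) (c : R) : nondeg T ->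
  interior_disjoint T -> K \in T -> i != j -> poly_fun (k - 2) q ->
  stress_space k Omega T (fun x => (\1_(tri K) x * (bary K i x * bary K j x * q x)) *:
    (c *: dyad (vtx K j - vtx K i))).
Proof.
(* [bubble] sums over ordered pairs only; the dyad does not see the sign of its vector. *)
move=> nT dT KT ij qp; wlog ltij : i j ij / (i < j)%N => [h|].
  have [lt|] := ltnP i j; first exact: h.
  rewrite leq_eqVlt (_ : (nat_of_ord j == i) = false) ?orFb => [lt|]; last first.
    by apply/negbTE; rewrite eq_sym.
  rewrite (_ : (fun x => _) = (fun x => (\1_(tri K) x * (bary K j x * bary K i x * q x)) *:
    (c *: dyad (vtx K i - vtx K j)))); first by apply: h => //; rewrite eq_sym.
  apply/funext => x; rewrite (mulrC (bary K i x)); congr (_ *: (_ *: _)).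
  by rewrite -opprB -scaleN1r dyadZ sqrrN expr1n scale1r.
have nK := nT K KT.
pose b x := bary K i x * bary K j x * (c * q x).
have bE : (fun x => (\1_(tri K) x * (bary K i x * bary K j x * q x)) *:
    (c *: dyad (vtx K j - vtx K i))) =
    (fun x => (\1_(tri K) x * b x) *: dyad (vtx K j - vtx K i)).
  by apply/funext => x; rewrite scalerA /b; congr (_ *: _); ring.
rewrite bE.
have qcp : poly_fun (k - 2) (fun x => c * q x) by exact: poly_funZ.
have bp : poly_fun (1 + 1 + (k - 2)) b.
  by apply: poly_funM => //; apply: poly_funM; apply: poly_fun_affine; exact: affine_bary.
set t := vtx K j - vtx K i.
have [b' db] := C1dir_poly t bp.
have [M KM] := tri_square K.
have mK : measurable (tri K : set pl) by apply: closed_plane_measurable; exact: closed_tri.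
set l := - (i + j).
have /andP[li lj] := I3_third ij.
have bl x : bary K l (x + t) = bary K l x.
  have [u [v [w E]]] := affine_bary K l.
  have : bary K l (vtx K j) = bary K l (vtx K i).
    by rewrite !bary_vtx// (negbTE li) (negbTE lj).
  by rewrite !E /t !planeE; lra.
split; last first.
  exists (fun=> 0), (fun x => (\1_(tri K) x * b x) *: dyad t); split.
  - by apply: aeW => x _ /=; rewrite add0r.
  - exact: H1_sym_cst0.
  - move=> K' _; exists (fun=> 0); last exact: aeW.
    split=> [x|i' j']; first by rewrite linear0.
    by rewrite mxE; exact: poly_fun0.
  - move=> K' K'T; have [KK'|KK'] := eqVneq K' K; last first.
      exists (fun=> 0); first exact: bubble0.
      apply: ae_imp (ae_generic nT) => x gx xK'.
      have xK : ~ tri K x.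
        move=> xK; case/eqP: KK'; exact: (generic_unique nT dT gx K'T KT xK' xK).
      by rewrite indicE memNset// mul0r scale0r.
    rewrite KK'; exists (fun x => b x *: dyad t); last first.
      by apply: aeW => x xK; rewrite indicE mem_set// mul1r.
    exists (fun i' j' x => if (i' == i) && (j' == j) then c * q x else 0).
      by move=> i' j'; case: ((i' == i) && (j' == j)) => //; exact: poly_fun0.
    move=> x; rewrite (bigD1 i)//= [X in _ = _ + X]big1 ?addr0; last first.
      by move=> i' /negbTE ii'; rewrite big1// => j' _; rewrite ii' /= mulr0 scale0r.
    rewrite (bigD1 j)//= [X in _ = _ + X]big1 ?addr0; last first.
      by move=> j' /andP[_ /negbTE jj']; rewrite jj' andbF mulr0 scale0r.
    by rewrite !eqxx.
apply: (@Hdiv_dyad _ _ (fun x => \1_(tri K) x * b x) (fun x => \1_(tri K) x * b' x) t).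
- by apply: L2_bounded_supp => //; apply: bounded_supp_indic KM _ => //; case: db.
- by apply: L2_bounded_supp => //; apply: bounded_supp_indic KM _ => //; case: db.
move=> psi tp; apply: (@bubble_ibp _ Omega K b b' t l) => // m x ml _ m0.
case: (I3_other m ij) ml m0 => ->; last by rewrite eqxx.
  by move=> _ z; rewrite /b z !mul0r.
by move=> _ z; rewrite /b z mulr0 mul0r.
Qed.

Lemma lin_spanD (A : set (plane R -> 'M[R]_2)) sigma tau :
  lin_span A sigma -> lin_span A tau -> lin_span A (sigma \+ tau).
Proof.
move=> [n [c [f [fA fE]]]] [m [d [g [gA gE]]]].
exists (n + m)%N, (fun i => match fintype.split i with inl a => c a | inr b => d b end),
  (fun i => match fintype.split i with inl a => f a | inr b => g b end); split.
  by move=> i; case: (fintype.split i).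
move=> x; rewrite /= fE gE big_split_ord /=.
congr (_ + _); apply: eq_bigr => i _.
  by case: splitP => j /= e; [congr (c _ *: f _ _); exact/val_inj
    | move: (ltn_ord i); rewrite e ltnNge leq_addr].
case: splitP => j /= e; first by move: (ltn_ord j); rewrite -e ltnNge leq_addr.
by congr (d _ *: g _ _); apply/val_inj/eqP; rewrite -(eqn_add2l n) e.
Qed.

Local Notation ext := (extended_stress_space k Omega).

Lemma ext_ae T0 T sigma tau : ext T0 T tau -> sigma = tau %[ae mu in Omega] ->
  ext T0 T sigma.
Proof.
move=> [s1 h1 [s2 h2 h]] e; exists s1 => //; exists s2 => //.
by apply: ae_imp2 h e => x E1 E2 xO; rewrite E2// E1.
Qed.

Lemma extD T0 T sigma tau : ext T0 T sigma -> ext T0 T tau -> ext T0 T (sigma \+ tau).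
Proof.
move=> [s1 h1 [s2 h2 h]] [t1 g1 [t2 g2 g]].
exists (s1 \+ t1); first exact: stress_spaceD.
exists (s2 \+ t2); first exact: lin_spanD.
by apply: ae_imp2 h g => x E1 E2 xO /=; rewrite E1// E2//= addrACA.
Qed.

Lemma stress_ext T0 T sigma : stress_space k Omega T sigma -> ext T0 T sigma.
Proof.
move=> h; exists sigma => //; exists (fun=> 0); last by apply: aeW => x _ /=; rewrite addr0.
exists 0%N, (fun=> 0), (fun=> fun=> 0); split; first by case.
by move=> x; rewrite big_ord0.
Qed.

Lemma stress_space0 T : stress_space k Omega T (fun=> 0).
Proof.
apply: H1_stress_space; first exact: H1_sym_cst0.
move=> K KT; exists (fun=> 0); last exact: aeW.
split=> [x|i j]; first by rewrite linear0.
by rewrite mxE; exact: poly_fun0.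
Qed.

Lemma extra_ext T0 T (c : R) tau : extra_fields k Omega T0 T tau ->
  ext T0 T (fun x => c *: tau x).
Proof.
move=> h; exists (fun=> 0); first exact: stress_space0.
exists (fun x => c *: tau x); last by apply: aeW => x _ /=; rewrite add0r.
exists 1%N, (fun=> c), (fun=> tau); split => // x.
by rewrite big_ord1.
Qed.

Lemma ext_sum T0 T (I : Type) (r : seq I) (F : I -> plane R -> 'M[R]_2) :
  (forall i, ext T0 T (F i)) -> ext T0 T (fun x => \sum_(i <- r) F i x).
Proof.
move=> h; elim: r => [|i r IH].
  by apply: ext_ae (stress_ext _ (stress_space0 T)) _; apply: aeW => x _; rewrite big_nil.
apply: ext_ae (extD (h i) IH) _.
by apply: aeW => x _; rewrite big_cons.
Qed.

End StressClosure.

(** * Triangles with a common edge *)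

Section SharedEdges.
Variable R : realType.
Implicit Types (K L : triangle R) (T S : mesh R) (x y z u v w a b d t : plane R)
  (i j l : 'I_3).

Lemma parallel_scale u v : u != 0 -> crs u v = 0 -> exists r : R, v = r *: u.
Proof.
move=> u0; rewrite /crs /dot /perp /= => e.
have [u1|u1] := eqVneq u.1 0; last first.
  exists (v.1 / u.1); apply: plane_eq; rewrite !planeE; first by field.
  by apply: (mulIf u1); rewrite mulrAC divfK//; lra.
have u2 : u.2 != 0 by apply: contra_neq u0 => u2; exact: plane_eq.
exists (v.2 / u.2); apply: plane_eq; rewrite !planeE; last by field.
by rewrite u1 mulr0; apply: (mulfI u2); move: e; rewrite u1; lra.
Qed.

Lemma parallel_scale_neq0 u v : u != 0 -> v != 0 -> crs u v = 0 ->
  exists2 r : R, r != 0 & v = r *: u.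
Proof.
move=> u0 v0 /(parallel_scale u0)[r e]; exists r => //.
by apply: contra_neq v0 => r0; rewrite e r0 scale0r.
Qed.

Lemma crs_segment x y z : segment x y z -> crs (z - x) (y - x) = 0.
Proof.
move=> [s _ <-]; rewrite (_ : _ - x = s *: (y - x)).
  by rewrite crsZl crsxx mulr0.
by apply: plane_eq; rewrite !planeE; ring.
Qed.

Lemma crs_base x y z v : segment x y z -> crs (v - z) (y - x) = crs (v - x) (y - x).
Proof.
move=> /crs_segment h; have -> : v - z = (v - x) - (z - x).
  by apply: plane_eq; rewrite !planeE; ring.
by rewrite crsBl h subr0.
Qed.

Lemma edge_one_sided K x y z : nondegenerate_tri K -> x != y -> x \in K -> y \in K ->
  segment x y z -> one_sided K z (y - x).
Proof.
move=> nK xy /in_triP[i xi] /in_triP[j yj] sz.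
have ij : i != j by apply: contra_neq xy => e; rewrite xi yj e.
have val m : crs (vtx K m - z) (y - x) =
    (m == - (i + j))%:R * crs (vtx K (- (i + j)) - x) (y - x).
  by rewrite (crs_base _ sz) {1 2}xi {1}yj (crs_bary _ nK ij) bary_vtx// -xi -yj eq_sym.
have [c0|c0] := leP 0 (crs (vtx K (- (i + j)) - x) (y - x)); [left|right] => m;
  rewrite val; case: (m == _); rewrite ?mul1r ?mul0r//.
exact: ltW.
Qed.

Lemma side_base K x y z : segment x y z -> side z (y - x) K = side x (y - x) K.
Proof. by move=> sz; rewrite /side (crs_base _ sz). Qed.

Lemma side_scale K x d (r : R) : nondegenerate_tri K -> d != 0 -> r != 0 ->
  one_sided K x d -> side x (r *: d) K = ((0 < r) == side x d K).
Proof.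
move=> nK d0 r0 os; rewrite {1}/side crsZr.
have [r1|r1] := ltP 0 r; first by rewrite pmulr_rgt0.
have r2 : r < 0 by rewrite lt_neqAle r0.
rewrite nmulr_rgt0//; have [[s _]|[s _]] := one_sided_side nK d0 os.
  by rewrite s ltNge ltW.
by rewrite s /side ltNge ltW.
Qed.

(** Distinct triangles at a common edge would overlap if they were on the same side of it. *)
Lemma same_side_eq T K K' x y z t : nondeg T -> interior_disjoint T ->
  K \in T -> K' \in T -> x != y -> x \in K -> y \in K -> x \in K' -> y \in K' ->
  segment x y z -> t != 0 -> crs (y - x) t = 0 -> side z t K = side z t K' -> K = K'.
Proof.
move=> nT dT KT K'T xy xK yK xK' yK' sz t0 par ss.
have nK := nT K KT; have nK' := nT K' K'T.
have yx0 : y - x != 0 by rewrite subr_eq0 eq_sym.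
have [r r0 tE] := parallel_scale_neq0 yx0 t0 par.
have os := edge_one_sided nK xy xK yK sz; have os' := edge_one_sided nK' xy xK' yK' sz.
move: ss; rewrite tE !side_scale// !(side_base _ sz).
have inj (b1 b2 b3 : bool) : (b1 == b2) = (b1 == b3) -> b2 = b3.
  by case: b1; case: b2; case: b3.
move=> /inj ss; apply/eqP; apply/negPn/negP => KK'.
have [w [wK wK']] := edge_overlap nK nK' xy xK yK xK' yK' ss.
exact: (dT K K' KT K'T KK' w wK wK').
Qed.

Lemma segment_open x y z : segment x y z -> z != x -> z != y ->
  exists2 s : R, 0 < s < 1 & z = (1 - s) *: x + s *: y.
Proof.
move=> [s]; rewrite /= in_itv/= => /andP[s0 s1] <- zx zy; exists s => //.
apply/andP; split.
  rewrite lt_neqAle s0 andbT; apply: contra_neq zx => <-.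
  by rewrite subr0 scale1r scale0r addr0.
rewrite lt_neqAle s1 andbT; apply: contra_neq zy => ->.
by rewrite subrr scale1r scale0r add0r.
Qed.

(** The barycentric coordinates opposite the common edge have a negative constant ratio, so at every
    point one of the two is nonnegative. The other coordinates are positive at [z] and hence near
    it. *)
Lemma shared_edge_nbhs T K K' x y z : nondeg T -> interior_disjoint T ->
  K \in T -> K' \in T -> K != K' -> x != y ->
  x \in K -> y \in K -> x \in K' -> y \in K' ->
  segment x y z -> z != x -> z != y -> nbhs z (tri K `|` tri K').
Proof.
move=> nT dT KT K'T KK' xy xK yK xK' yK' sz zx zy.
have nK := nT K KT; have nK' := nT K' K'T.
have ss : side x (y - x) K != side x (y - x) K'.
  apply/eqP => ss; have [w [wK wK']] := edge_overlap nK nK' xy xK yK xK' yK' ss.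
  exact: (dT K K' KT K'T KK' w wK wK').
move: xK yK xK' yK' => /in_triP[i xi] /in_triP[j yj] /in_triP[i' xi'] /in_triP[j' yj'].
have ij : i != j by apply: contra_neq xy => e; rewrite xi yj e.
have ij' : i' != j' by apply: contra_neq xy => e; rewrite xi' yj' e.
move: ss; rewrite (side_edge ij xi yj) (side_edge ij' xi' yj').
set l := - (i + j); set l' := - (i' + j').
set c := crs (vtx K l - x) (y - x); set c' := crs (vtx K' l' - x) (y - x).
have c0 : c != 0 by rewrite /c xi yj; exact: crs_neq0.
have c0' : c' != 0 by rewrite /c' xi' yj'; exact: crs_neq0.
move=> ss.
have rel q : bary K' l' q = bary K l q * (c / c').
  apply: (mulIf c0'); rewrite -[RHS]mulrA divfK//.
  transitivity (crs (q - x) (y - x)).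
    by rewrite /c' xi' yj' (crs_bary q nK' ij').
  by rewrite /c xi yj (crs_bary q nK ij).
have cneg : c / c' < 0.
  move: ss; have [c1|c1] := ltP 0 c; have [c1'|c1'] := ltP 0 c' => // _.
    by rewrite pmulr_rlt0// invr_lt0 lt_neqAle c0' c1'.
  by rewrite nmulr_rlt0 ?invr_gt0// lt_neqAle c0 c1.
have [s /andP[s0 s1] zE] := segment_open sz zx zy.
have pos (M : triangle R) p q m : nondegenerate_tri M -> p != q -> x = vtx M p ->
    y = vtx M q -> m = p \/ m = q -> \forall w \near z, 0 < bary M m w.
  move=> nM pq xp yq mpq.
  have cb : bary M m @ z --> bary M m z by exact: (affine_continuous (affine_bary M m)).
  apply: (cvgr_gt (bary M m z) cb).
  rewrite zE affine_segment; last exact: affine_bary.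
  rewrite xp yq !bary_vtx//.
  case: mpq => ->; rewrite eqxx ?(negbTE pq) 1?eq_sym ?(negbTE pq) /=; lra.
have pi := pos K i j i nK ij xi yj (or_introl erefl).
have pj := pos K i j j nK ij xi yj (or_intror erefl).
have pi' := pos K' i' j' i' nK' ij' xi' yj' (or_introl erefl).
have pj' := pos K' i' j' j' nK' ij' xi' yj' (or_intror erefl).
near=> w.
have [lw|lw] := leP 0 (bary K l w); [left|right]; apply/triP => // m.
  case: (I3_other m ij) => -> //; apply: ltW; near: w; [exact: pi|exact: pj].
case: (I3_other m ij') => ->; [apply: ltW; near: w; exact: pi'|apply: ltW; near: w; exact: pj'|].
by rewrite -/l' rel ltW// nmulr_lgt0.
Unshelve. all: by end_near. Qed.

(** Where two barycentric coordinates vanish there is a vertex, so a point that is no vertex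
    determines its edge. *)
Lemma edge_unique K x y x' y' z : nondegenerate_tri K -> x != y -> x' != y' ->
  x \in K -> y \in K -> x' \in K -> y' \in K ->
  segment x y z -> segment x' y' z -> z \notin K ->
  (x' = x /\ y' = y) \/ (x' = y /\ y' = x).
Proof.
move=> nK xy xy' /in_triP[i xi] /in_triP[j yj] /in_triP[i' xi'] /in_triP[j' yj'].
have ij : i != j by apply: contra_neq xy => e; rewrite xi yj e.
have ij' : i' != j' by apply: contra_neq xy' => e; rewrite xi' yj' e.
rewrite {1}xi {1}yj {1}xi' {1}yj' => /(segmentP _ nK ij)[_ z0] /(segmentP _ nK ij')[_ z0'] zK.
have ll : - (i + j) = - (i' + j').
  apply/eqP/negPn/negP => ll; case/negP: zK.
  have := sum_bary z nK; rewrite (sum_I3_third _ ll) z0 z0' !add0r => e.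
  apply/in_triP; exists (- (- (i + j) + - (i' + j'))).
  by rewrite {1}(bary_comb z nK) (sum_I3_third _ ll) z0 z0' !scale0r !add0r e scale1r.
have /andP[l1 l2] := I3_third ij'; rewrite -ll in l1 l2.
case: (I3_other i' ij) l1 => ei; rewrite ei ?eqxx// => _.
  case: (I3_other j' ij) l2 => ej; rewrite ej ?eqxx// => _.
    by move: ij'; rewrite ei ej eqxx.
  by left; rewrite xi' yj' ei ej xi yj.
case: (I3_other j' ij) l2 => ej; rewrite ej ?eqxx// => _.
  by right; rewrite xi' yj' ei ej xi yj.
by move: ij'; rewrite ei ej eqxx.
Qed.

End SharedEdges.

(** * Conforming families under refinement *)

Section ConformingFamilies.
Variables (R : realType) (k : nat) (Omega : set (plane R)) (T0 : mesh R).
Hypotheses (nT0 : nondeg T0) (dT0 : interior_disjoint T0).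
Implicit Types (K L : triangle R) (T S : mesh R) (x y z u v w a b d t : plane R)
  (i j l : 'I_3) (p q : triangle R -> plane R -> R).

Definition single_valued T p z := forall K K', K \in T -> K' \in T ->
  tri K z -> tri K' z -> p K z = p K' z.

Definition jump_vertex T t p z :=
  [/\ Omega z, ~ vertices T0 z,
      exists a b, created T0 T z a b /\ crs (b - a) t = 0 &
      exists c : bool -> R, forall K, K \in T -> tri K z -> p K z = c (side z t K)].

(* Pieces of a scalar field [g] such that [g] times [dyad t] is in H(div): the
   traces agree on the edges that are not parallel to [t], and at the vertices
   up to the jump that the extended space allows. *)
Definition conforming_family T t p :=
  [/\ forall K, K \in T -> poly_fun k (p K),
      forall K K' x y, K \in T -> K' \in T -> x != y ->
        x \in K -> x \in K' -> y \in K -> y \in K' -> crs (y - x) t != 0 ->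
        forall z, segment x y z -> p K z = p K' z &
      forall z, vertices T z -> single_valued T p z \/ jump_vertex T t p z].

Lemma created_refine T T' x a b : created T0 T x a b -> nvb_refine T T' ->
  created T0 T' x a b.
Proof.
move=> [S [K [h1 h2 h3 h4 h5]]] h; exists S, K; split => //.
exact: refine_trans h3 h.
Qed.

Lemma created_side T x a b t K : created T0 T x a b -> K \in T -> x \in K ->
  t != 0 -> crs (b - a) t = 0 -> one_sided K x t.
Proof.
move=> cr KT xK t0 par.
have ab := created_neq nT0 cr.
have ba0 : b - a != 0 by rewrite subr_eq0 eq_sym.
have [r tE] := parallel_scale ba0 par.
by rewrite tE; apply: one_sidedZ; exact: created_one_sided cr KT xK.
Qed.

(** A fine triangle inherits the piece of the coarse triangle [par L] that contains it. Fine
    triangles with the same parent agree trivially, so only points shared by different parents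
    matter. *)
Lemma conforming_refine T That t p par : nvb_refine T0 T -> triangulation Omega T ->
  triangulation Omega That -> nvb_refine T That ->
  (forall z, nbhs z (closure Omega) -> Omega z) ->
  (forall L, L \in That -> par L \in T /\ tri L `<=` tri (par L)) -> t != 0 ->
  conforming_family T t p -> conforming_family That t (fun L => p (par L)).
Proof.
move=> T0T [nT cT uT] [nT' cT' uT'] TT' intO hpar t0 [pp pe pv].
have dT := conforming_disjoint nT cT.
split=> [L LT'|L L' x y LT' L'T' xy xL xL' yL yL' nxy z sz|z zT'].
- by apply: pp; case: (hpar L LT').
- have [KT LK] := hpar L LT'; have [KT' LK'] := hpar L' L'T'.
  have [<-//|KK'] := eqVneq (par L) (par L').
  have in_tri M v : v \in M -> tri M v by move=> /in_triP[i ->]; exact: tri_vtx.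
  have capx : (tri (par L) `&` tri (par L')) x.
    by split; [apply/LK/in_tri | apply/LK'/in_tri].
  have capy : (tri (par L) `&` tri (par L')) y.
    by split; [apply/LK/in_tri | apply/LK'/in_tri].
  (* The parents share two distinct points, hence an entire edge [u v]; it contains the fine edge
     and is parallel to it. *)
  case: (cT _ _ KT KT' KK') => [e|[v _ e]|[u [v [uv [uK uK'] [vK vK'] e]]]].
  + by rewrite e in capx.
  + move: capx capy xy; rewrite e /= => -> ->; by rewrite eqxx.
  move: capx capy; rewrite e => -[s]; rewrite /= in_itv/= => /andP[s0 s1] xE.
  move=> -[r]; rewrite /= in_itv/= => /andP[r0 r1] yE.
  have yxE : y - x = (r - s) *: (v - u).
    by rewrite -xE -yE; apply: plane_eq; rewrite !planeE; ring.
  apply: (pe _ _ u v) => //.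
    by apply: contra_neq nxy => h; rewrite yxE crsZl h mulr0.
  move: sz => [q]; rewrite /= in_itv/= => /andP[q0 q1] <-.
  exists ((1 - q) * s + q * r); first by rewrite /= in_itv/=; apply/andP; split; nra.
  by rewrite -xE -yE; apply: plane_eq; rewrite !planeE; ring.
have [zT|zT] := pselect (vertices T z).
  case: (pv z zT) => [sv|[Oz nz [a [b [cr par0]]] [c hc]]]; [left|right].
    move=> L L' LT' L'T' zL zL'.
    have [KT LK] := hpar L LT'; have [KT' LK'] := hpar L' L'T'.
    by apply: sv => //; [exact: LK | exact: LK'].
  split => //.
    by exists a, b; split => //; exact: created_refine cr TT'.
  exists c => L LT' zL; have [KT LK] := hpar L LT'.
  have zK : tri (par L) z by exact: LK.
  (* At an old jump vertex the parent is one-sided, so its side is that of the fine triangle. *)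
  rewrite hc//; congr (c _); apply/esym.
  apply: side_sub => //; [exact: nT | exact: nT' | ].
  have zv := vertex_in_tri nT cT KT zT zK.
  exact: (created_side cr KT zv t0 par0).
have [//|[S [M [TS MS ST' zM]]]] := refine_new_vertex TT' zT'.
have nS := refine_nondeg TS nT.
have [K1 K1T MK1] := refine_parent TS nT MS.
have nzK K : K \in T -> z \notin K.
  by move=> KT; apply/negP => zK; apply: zT; exists K.
have [sv|nsv] := pselect (single_valued That (fun L => p (par L)) z); first by left.
right.
have [L [L' [LT' L'T' zL zL' pLL']]] : exists L L', [/\ L \in That, L' \in That, tri L z,
    tri L' z & p (par L) z <> p (par L') z].
  apply: contrapT => h; apply: nsv => L L' LT' L'T' zL zL'.
  by apply: contrapT => pLL'; apply: h; exists L, L'.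
have [KT LK] := hpar L LT'; have [KT' LK'] := hpar L' L'T'.
set K := par L in KT LK pLL'; set K' := par L' in KT' LK' pLL'.
have KK' : K != K' by apply/eqP => e; rewrite e in pLL'.
have [[zK _]|[x [y [xy [xK xK'] [yK yK'] _ sz]]]] :=
    conforming_cap nT cT KT KT' KK' (LK _ zL) (LK' _ zL').
  by move: (nzK K KT); rewrite zK.
have par0 : crs (y - x) t = 0.
  apply/eqP/negPn/negP => h; apply: pLL'; exact: (pe K K' x y).
(* As [z] is no coarse vertex, [x y] is the only edge through it, and all coarse triangles at [z]
   have this edge. *)
have share M' : M' \in T -> tri M' z -> x \in M' /\ y \in M'.
  move=> M'T zM'; have [<-//|KM'] := eqVneq K M'.
  have [[zK _]|[x' [y' [xy' [xK1 xM'] [yK1 yM'] _ sz']]]] :=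
      conforming_cap nT cT KT M'T KM' (LK _ zL) zM'.
    by move: (nzK K KT); rewrite zK.
  by have [[<- <-]|[<- <-]] := edge_unique (nT K KT) xy xy' xK yK xK1 yK1 sz sz' (nzK K KT).
have yx0 : y - x != 0 by rewrite subr_eq0 eq_sym.
have sideE M' : M' \in T -> tri M' z -> side z t M' = side z t K -> M' = K.
  move=> M'T zM' ss; have [xM' yM'] := share M' M'T zM'.
  exact: (same_side_eq nT dT M'T KT xy xM' yM' xK yK sz t0 par0 ss).
have sideE' M' : M' \in T -> tri M' z -> side z t M' = side z t K' -> M' = K'.
  move=> M'T zM' ss; have [xM' yM'] := share M' M'T zM'.
  exact: (same_side_eq nT dT M'T KT' xy xM' yM' xK' yK' sz t0 par0 ss).
split.
- apply: intO; rewrite -uT.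
  have : nbhs z (tri K `|` tri K').
    apply: (shared_edge_nbhs nT dT KT KT' KK' xy xK yK xK' yK' sz).
      by apply: contraNneq (nzK K KT) => ->.
    by apply: contraNneq (nzK K KT) => ->.
  by apply: filterS => w [wK|wK']; [exists K | exists K'].
- by move=> z0; apply: zT; exact: refine_vertices T0T _ z0.
- exists (vtx M 1), (vtx M 2); split.
    exists S, M; split => //; exact: refine_trans T0T TS.
  (* Both ends of the bisected edge lie in [K1], where the coordinate opposite [x y] is nonnegative,
     while it vanishes at their midpoint. Hence it vanishes at both ends, and the bisected edge is
     parallel to [x y]. *)
  have nK1 := nT K1 K1T; have nM := nS M MS.
  have zK1 : tri K1 z by rewrite zM; apply: MK1; exact: tri_ref_midpoint.
  have [/in_triP[i xi] /in_triP[j yj]] := share K1 K1T zK1.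
  have ij : i != j by apply: contra_neq xy => e; rewrite xi yj e.
  have : segment (vtx K1 i) (vtx K1 j) z by rewrite -xi -yj.
  move=> /(segmentP _ nK1 ij)[_]; rewrite zM affine_midpoint; last exact: affine_bary.
  set l := - (i + j).
  have /(triP _ nK1)/(_ l) h1 := MK1 _ (tri_vtx M 1).
  have /(triP _ nK1)/(_ l) h2 := MK1 _ (tri_vtx M 2).
  move=> h12.
  have b1 : bary K1 l (vtx M 1) = 0 by lra.
  have b2 : bary K1 l (vtx M 2) = 0 by lra.
  have cE v : bary K1 l v = 0 -> crs (v - x) (y - x) = 0.
    by move=> bv; rewrite xi yj (crs_bary v nK1 ij) -/l bv mul0r.
  have ba : crs (vtx M 2 - vtx M 1) (y - x) = 0.
    have -> : vtx M 2 - vtx M 1 = (vtx M 2 - x) - (vtx M 1 - x).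
      by apply: plane_eq; rewrite !planeE; ring.
    by rewrite crsBl !cE// subrr.
  have [r tE] := parallel_scale yx0 par0.
  by rewrite tE crsZr ba mulr0.
- exists (fun bb => if bb == side z t K then p K z else p K' z) => M' M'T zM'.
  have [NT M'N] := hpar M' M'T; set N := par M' in NT M'N *.
  have zN := M'N _ zM'.
  have [xN yN] := share N NT zN.
  have os : one_sided N z t.
    have [r tE] := parallel_scale yx0 par0; rewrite tE.
    by apply: one_sidedZ; exact: (edge_one_sided (nT N NT) xy xN yN sz).
  rewrite (side_sub (nT N NT) (nT' M' M'T) t0 M'N os).
  case: eqP => [/(sideE N NT zN) -> //|ns].
  rewrite (sideE' N NT zN)//.
  have nss : side z t K' <> side z t K.
    by move=> /(sideE K' KT' (LK' _ zL')) e; move: KK'; rewrite e eqxx.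
  by move: ns nss; case: (side z t N); case: (side z t K); case: (side z t K').
Qed.

End ConformingFamilies.

(** * Lagrange nodes and existence of nodal basis functions *)

Section NodalBasis.
Variables (R : realType) (k : nat).
Implicit Types (K L : triangle R) (T S : mesh R) (x y z a b d t : plane R)
  (i j l : 'I_3) (P : triangle R -> plane R -> R) (phi : plane R -> R).

Lemma lagrange_segment K x y (j : nat) : (0 < k)%N -> nondegenerate_tri K -> x != y ->
  x \in K -> y \in K -> (j <= k)%N ->
  lagrange_node k K (((k - j)%:R / k%:R) *: x + (j%:R / k%:R) *: y).
Proof.
move=> k0 nK xy /in_triP[i xi] /in_triP[i' yi] jk.
have ij : i != i' by apply: contra_neq xy => e; rewrite xi yi e.
have [h1 h2] := andP (I3_third ij).
exists (fun l => if l == i then (k - j)%N else if l == i' then j else 0%N).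
  rewrite (sum_I3_third _ ij) eqxx eq_sym (negbTE ij) eqxx (negbTE h1) (negbTE h2).
  by rewrite -[LHS]/(k - j + j + 0)%N addn0 subnK.
rewrite (sum_I3_third _ ij) eqxx [i' == i]eq_sym (negbTE ij) eqxx (negbTE h1) (negbTE h2).
by rewrite mul0r scale0r addr0 xi yi.
Qed.

Lemma lagrange_vtx K i : (0 < k)%N -> lagrange_node k K (vtx K i).
Proof.
move=> k0; exists (fun l => if l == i then k else 0%N).
  by rewrite (bigD1 i)//= eqxx big1 ?addn0// => l /negbTE ->.
rewrite (bigD1 i)//= eqxx big1 ?addr0 => [|l /negbTE ->].
  by rewrite divff ?scale1r// pnatr_eq0 -lt0n.
by rewrite mul0r scale0r.
Qed.

Lemma lagrange_tri K z : (0 < k)%N -> lagrange_node k K z -> tri K z.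
Proof.
move=> k0 [a sa ->]; exists (fun i => (a i)%:R / k%:R); split => //.
by rewrite -mulr_suml -natr_sum sa divff// pnatr_eq0 -lt0n.
Qed.

Lemma lagrange_weight K (a : 'I_3 -> nat) z : (0 < k)%N -> nondegenerate_tri K ->
  (\sum_i a i)%N = k -> z = \sum_i ((a i)%:R / k%:R) *: vtx K i ->
  forall i, bary K i z = (a i)%:R / k%:R.
Proof.
move=> k0 nK sa -> i; rewrite affine_comb; last 2 first.
- exact: affine_bary.
- by rewrite -mulr_suml -natr_sum sa divff// pnatr_eq0 -lt0n.
rewrite (bigD1 i)//= bary_vtx// eqxx mulr1 big1 ?addr0// => j ji.
by rewrite bary_vtx// eq_sym (negbTE ji) mulr0.
Qed.

(** The pieces of the continuous, piecewise affine nodal function of the vertex [x]. *)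
Definition hat x K z : R := \sum_i (vtx K i == x)%:R * bary K i z.

Lemma affine_hat x K : affine (hat x K).
Proof.
have h i := affineZ (vtx K i == x)%:R (affine_bary K i).
have [a [b [c h0]]] := h 0; have [a' [b' [c' h1]]] := h 1.
have [a2 [b2 [c2 h2]]] := h 2.
exists (a + a' + a2), (b + b' + b2), (c + c' + c2) => z.
by rewrite /hat sum_I3 h0 h1 h2; ring.
Qed.

Lemma hat_vtx x K i : nondegenerate_tri K -> hat x K (vtx K i) = (vtx K i == x)%:R.
Proof.
move=> nK; rewrite /hat (bigD1 i)//= bary_vtx// eqxx mulr1 big1 ?addr0// => j ji.
by rewrite bary_vtx// (negbTE ji) mulr0.
Qed.

Lemma hat_single T x K K' z : nondeg T -> conforming T -> K \in T -> K' \in T ->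
  tri K z -> tri K' z -> hat x K z = hat x K' z.
Proof.
move=> nT cT KT KT' zK zK'; have [<-//|KK'] := eqVneq K K'.
have hv v : v \in K -> v \in K' -> hat x K v = hat x K' v.
  move=> /in_triP[i vi] /in_triP[j vj].
  have := hat_vtx x i (nT K KT); have := hat_vtx x j (nT K' KT').
  by rewrite -vi -vj => -> ->.
have [[? ?]|[u [v [_ [? ?] [? ?] _ [s _ <-]]]]] := conforming_cap nT cT KT KT' KK' zK zK'.
  exact: hv.
by rewrite !affine_segment; [rewrite !hv | exact: affine_hat..].
Qed.

(** At the Lagrange nodes the hat function of a vertex takes values [m / k], and 1 at the vertex
    only. Composed with [P] it becomes the nodal function of order [k]. *)
Lemma nodal_poly : (0 < k)%N -> exists P : {poly R}, [/\ (size P <= k.+1)%N,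
  forall m : nat, (m < k)%N -> P.[m%:R / k%:R] = 0 & P.[1] = 1].
Proof.
move=> k0; pose s : seq R := [seq m%:R / k%:R | m <- iota 0 k].
pose Q : {poly R} := \prod_(r <- s) ('X - r%:P).
have kk : (k%:R : R) != 0 by rewrite pnatr_eq0 -lt0n.
have Q1 : Q.[1] != 0.
  rewrite -rootE root_prod_XsubC; apply/mapP => -[m]; rewrite mem_iota add0n => mk e.
  have : k%:R = m%:R :> R by rewrite -[RHS](divfK kk) -e mul1r.
  by move/eqP; rewrite eqr_nat => /eqP ek; rewrite -ek ltnn in mk.
exists (Q.[1]^-1 *: Q); split.
- apply: (leq_trans (size_scale_leq _ _)).
  by rewrite /Q size_prod_XsubC size_map size_iota.
- move=> m mk; rewrite hornerZ; have /rootP -> : root Q (m%:R / k%:R).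
    by rewrite root_prod_XsubC; apply/mapP; exists m => //; rewrite mem_iota.
  by rewrite mulr0.
- by rewrite hornerZ mulVf.
Qed.

Lemma closed_pieces_continuous (s : seq (triangle R)) P phi :
  (forall K, K \in s -> nondegenerate_tri K) ->
  (forall K, K \in s -> continuous (P K)) ->
  (forall K, K \in s -> {in tri K, phi =1 P K}) ->
  {within (\bigcup_(K in [set` s]) tri K), continuous phi}.
Proof.
elim: s => [|K s IH] ns cs ps.
  have -> : \bigcup_(K in [set` [::]]) tri K = (set0 : set (plane R)).
    by apply/seteqP; split=> x // [].
  exact: continuous_subspace0.
have -> : \bigcup_(L in [set` K :: s]) tri L = tri K `|` \bigcup_(L in [set` s]) tri L.
  apply/seteqP; split => x.
    move=> [L]; rewrite /= inE => /orP[/eqP ->|Ls] xL; first by left.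
    by right; exists L.
  move=> [xK|[L Ls xL]]; first by exists K => //=; rewrite mem_head.
  by exists L => //=; rewrite inE Ls orbT.
have ns' : forall L, L \in s -> nondegenerate_tri L.
  by move=> L Ls; apply: ns; rewrite inE Ls orbT.
apply: withinU_continuous.
- by apply: closed_tri; apply: ns; rewrite mem_head.
- apply: closed_bigcup; first exact: finite_seq.
  by move=> L /= Ls; apply: closed_tri; exact: ns'.
- apply: (@subspace_eq_continuous _ _ _ (P K)).
    by move=> x xK; apply/esym/ps; rewrite ?mem_head.
  by apply: continuous_subspaceT; apply: cs; rewrite mem_head.
- apply: IH => // L Ls; first by apply: cs; rewrite inE Ls orbT.
  by apply: ps; rewrite inE Ls orbT.
Qed.

Lemma poly_fun_continuous m (p : plane R -> R) : poly_fun m p -> continuous p.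
Proof.
move: m p; apply: (@poly_fun_rect R (fun p => continuous p)).
- by move=> f g /funext ->.
- by move=> c x; exact: cvg_cst.
- by move=> x; exact: cvg_fst.
- by move=> x; exact: cvg_snd.
- by move=> f g cf cg x; exact: cvgD (cf x) (cg x).
- by move=> f g cf cg x; exact: cvgM (cf x) (cg x).
Qed.

Lemma nodal_basis_exists T x : (0 < k)%N -> nondeg T -> conforming T ->
  vertices T x -> exists phi, nodal_basis k T x phi.
Proof.
move=> k0 nT cT xT; have [L [sL L0 L1]] := nodal_poly k0.
pose P K z := L.[hat x K z].
have pP K : poly_fun k (P K) by apply: poly_fun_horner => //; exact: affine_hat.
have phiE K z : K \in T -> tri K z -> glue T P z = P K z.
  move=> KT zK; apply: glue_in => // K' KT' zK'.
  by rewrite /P (hat_single x nT cT KT' KT zK' zK).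
exists (glue T P); split.
- apply: (@closed_pieces_continuous T P) => // K KT.
    exact: poly_fun_continuous (pP K).
  by move=> z /set_mem zK; exact: phiE.
- by move=> K KT; exists (P K) => // z /set_mem zK; exact: phiE.
- move=> K z KT hz; have nK := nT K KT.
  have zK := lagrange_tri k0 hz.
  rewrite (phiE K)// /P; case: hz => a sa zE.
  have w := lagrange_weight k0 nK sa zE.
  have [/in_triP[l xl]|xK] := boolP (x \in K).
    have -> : hat x K z = (a l)%:R / k%:R.
      rewrite /hat (bigD1 l)//= -xl eqxx mul1r w big1 ?addr0// => i il.
      by rewrite xl (inj_eq (vtx_inj nK)) (negbTE il) mul0r.
    have [al|al] := ltnP (a l) k.
      rewrite L0//; have [zx|//] := eqVneq z x.
      have : bary K l z = 1 by rewrite zx xl bary_vtx// eqxx.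
      rewrite w => /(canRL (divfK _)); rewrite mul1r pnatr_eq0 -lt0n k0 => /(_ isT)/eqP.
      by rewrite eqr_nat => /eqP e; rewrite e ltnn in al.
    have ak : a l = k.
      by apply/eqP; rewrite eqn_leq al andbT -sa (bigD1 l)//= leq_addr.
    rewrite ak divff ?pnatr_eq0 -?lt0n// L1.
    suff -> : z = x by rewrite eqxx.
    rewrite zE (bigD1 l)//= big1 ?addr0 => [|i il].
      by rewrite ak divff ?pnatr_eq0 -?lt0n// scale1r xl.
    have : (\sum_(i | i != l) a i)%N = 0%N.
      by move: sa; rewrite (bigD1 l)//= ak; lia.
    move=> /eqP; rewrite sum_nat_eq0 => /forallP/(_ i); rewrite il /= => /eqP ->.
    by rewrite mul0r scale0r.
  have -> : hat x K z = 0.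
    rewrite /hat big1// => i _; case: eqP => [e|]; last by rewrite mul0r.
    by move: xK; rewrite -e mem_vtx.
  have -> : L.[0] = 0 by have := L0 0%N k0; rewrite mul0r.
  have [zx|//] := eqVneq z x.
  by move: xK; rewrite (vertex_in_tri nT cT KT xT)// -zx.
Qed.

End NodalBasis.

(** * The extra fields as conforming families *)

Section PatchFamily.
Variables (R : realType) (k : nat) (Omega : set (plane R)) (T0 : mesh R).
Hypotheses (nT0 : nondeg T0) (dT0 : interior_disjoint T0) (k0 : (0 < k)%N).
Implicit Types (K L : triangle R) (T S : mesh R) (x y z u v w a b d t : plane R)
  (i j l : 'I_3) (p q : triangle R -> plane R -> R) (phi : plane R -> R).

(* The pieces of an extra field with direction [t], for the vertex [x]; [e]
   tells the side of the line through [x] along [t] that carries the field. *)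
Definition patch_pieces T t x (e : bool) q :=
  [/\ forall K, K \in T -> poly_fun k (q K),
      forall K K' u v, K \in T -> K' \in T -> u != v ->
        u \in K -> u \in K' -> v \in K -> v \in K' -> crs (v - u) t != 0 ->
        forall z, segment u v z -> q K z = q K' z,
      forall K v, K \in T -> v \in K -> v != x -> q K v = 0 &
      forall K, K \in T -> x \in K -> q K x = (side x t K == e)%:R].

Lemma side_signE K x d (s : bool) : nondegenerate_tri K -> d != 0 ->
  one_sided K x d -> (0 < (-1) ^+ s * crs (mid K - x) d) = (side x d K == ~~ s).
Proof.
move=> nK d0 os; case: s; rewrite ?expr1 ?expr0 ?mulN1r ?mul1r /=.
  have [[h _]|[h _]] := one_sided_side nK d0 os; rewrite /side oppr_gt0 in h *.
    by rewrite h ltNge ltW.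
  by rewrite h ltNge ltW.
by rewrite eqb_id.
Qed.

(** The pieces are those of [phi] on the triangles of the half patch and zero on all others, which
    gives the restricted function at generic points. *)
Lemma extra_field_patch T x a b phi (s : bool) t : nondeg T -> conforming T ->
  nvb_refine T0 T -> vertices T x -> created T0 T x a b -> nodal_basis k T x phi ->
  t != 0 -> crs (b - a) t = 0 -> exists q (e : bool), patch_pieces T t x e q /\
    forall y, generic T y -> (phi \_ (half_patch T x a b s)) y = glue T q y.
Proof.
move=> nT cT T0T xT cr [_ pp pn] t0 par; have dT := conforming_disjoint nT cT.
have /boolp.choice[P hP] : forall K, exists p : plane R -> R, K \in T ->
    poly_fun k p /\ {in tri K, phi =1 p}.
  move=> K; have [KT|] := boolP (K \in T); last by exists (fun=> 0).
  by have [p ? ?] := pp K KT; exists p.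
have PE K z : K \in T -> tri K z -> phi z = P K z.
  by move=> KT zK; apply: (hP K KT).2; rewrite mem_set.
have Pn K z : K \in T -> lagrange_node k K z -> P K z = (z == x)%:R.
  by move=> KT hz; rewrite -PE// ?(pn K)//; exact: lagrange_tri hz.
have ab := created_neq nT0 cr.
have d0 := tangent_neq0 ab.
set d := tangent a b in d0.
have tri_v K v : v \in K -> tri K v by move=> /in_triP[i ->]; exact: tri_vtx.
have osd K : K \in T -> x \in K -> one_sided K x d.
  move=> KT xK; apply: one_sidedZ; exact: created_one_sided cr KT xK.
have xin K : K \in T -> tri K x -> x \in K.
  by move=> KT xK; exact: vertex_in_tri nT cT KT xT xK.
pose c K := `[< tri K x >] && (0 < (-1) ^+ s * crs (mid K - x) d).
have cE K : K \in T -> x \in K -> c K = (side x d K == ~~ s).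
  move=> KT xK; rewrite /c asboolT /=; last exact: tri_v.
  by apply: side_signE => //; [exact: nT | exact: osd].
have dpar : crs d t = 0 by rewrite /d /tangent crsZl par mulr0.
have [r r0 tE] := parallel_scale_neq0 d0 t0 dpar.
pose q K z := if c K then P K z else 0.
(* [t] is [r] times the unit tangent: a negative [r] exchanges the names of the two sides. *)
exists q, ((0 < r) == ~~ s); split; last first.
  move=> y gy; have [[K KT yK]|ny] := pselect (mesh_union T y); last first.
    rewrite glue_out; last by move=> K KT yK; apply: ny; exists K.
    rewrite patchE; case: ifP => // /set_mem[K [KT _ _] yK].
    by case: ny; exists K.
  rewrite (glue_generic _ nT dT gy KT yK) patchE /q /c.
  case: ifP => [/set_mem[K' [K'T xK' sK'] yK']|h].
    have -> : K = K' by exact: (generic_unique nT dT gy).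
    by rewrite asboolT //= /crs sK' -PE.
  case: ifP => // /andP[/asboolP xK sK].
  by move/negP: h; case; rewrite mem_set//; exists K.
(* an edge that carries the jump of [q] runs along [t], or it misses [x] *)
have edge0 K K' u v z : K \in T -> K' \in T -> u != v -> u \in K -> u \in K' ->
    v \in K -> v \in K' -> crs (v - u) t != 0 -> segment u v z -> c K -> ~~ c K' ->
    P K z = 0.
  move=> KT KT' uv uK uK' vK vK' ntv sz cK ncK'.
  have nK := nT K KT; have nK' := nT K' KT'.
  have xK : x \in K by move: cK => /andP[/asboolP xK _]; exact: xin.
  have ends u' v' : u' \in K -> u' \in K' -> v' \in K -> v' \in K' ->
      crs (v' - u') t != 0 -> u' <> x.
    move=> uK1 uK1' vK1 vK1' nt ux.
    have xK' : x \in K' by rewrite -ux.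
    move: cK ncK'; rewrite !cE//.
    have nd : crs (v' - x) d != 0.
      by apply: contra_neq nt => h; rewrite ux tE crsZr h mulr0.
    move: vK1 vK1' => /in_triP[i vi] /in_triP[j vj].
    (* [v'] is off the line through [x] along [d] and belongs to both triangles, so these lie on the
       same side. *)
    have [[S H]|[S H]] := one_sided_side nK d0 (osd K KT xK);
    have [[S' H']|[S' H']] := one_sided_side nK' d0 (osd K' KT' xK').
    - by rewrite S S' => ->.
    - move: (H i) (H' j) nd; rewrite -vi -vj => ? ? /eqP; lra.
    - move: (H i) (H' j) nd; rewrite -vi -vj => ? ? /eqP; lra.
    - have -> : side x d K = false by apply/negbTE; rewrite -leNgt ltW.
      have -> : side x d K' = false by apply/negbTE; rewrite -leNgt ltW.
      by move=> ->.
  have ux : u <> x by exact: ends uK uK' vK vK' ntv.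
  have vx : v <> x.
    by apply: (ends v u) => //; rewrite -opprB /crs; move: ntv; rewrite /crs /dot /=; lra.
  (* The edge carries [k + 1] nodes, and [x] is not one of them, so [P K] vanishes at all of
     them. *)
  apply: (poly_fun_segment_eq0 (hP K KT).1 k0 _ sz) => m mk.
  rewrite Pn//; last exact: lagrange_segment.
  have [e|//] := eqVneq _ x.
  move: uK vK xK => /in_triP[i ui] /in_triP[j vj] /in_triP[l xl].
  have ij : i != j by apply: contra_neq uv => h; rewrite ui vj h.
  have : segment (vtx K i) (vtx K j) x.
    rewrite -e -ui -vj; exists (m%:R / k%:R).
      rewrite /= in_itv/= divr_ge0//= ler_pdivrMr ?ltr0n// mul1r ler_nat//.
    rewrite natrB// mulrBl divff// pnatr_eq0 -lt0n//.
  move=> /(segmentP _ nK ij)[_]; rewrite xl bary_vtx// => /eqP.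
  case: (I3_other l ij) => el; rewrite el ?eqxx ?oner_eq0// in xl *.
    by case: ux; rewrite ui.
  by case: vx; rewrite vj.
split.
- move=> K KT; rewrite /q; case: (c K); first exact: (hP K KT).1.
  exact: poly_fun0.
- move=> K K' u v KT KT' uv uK uK' vK vK' nt z sz; rewrite /q.
  have szc K1 : K1 \in T -> u \in K1 -> v \in K1 -> tri K1 z.
    move=> KT1 /in_triP[i ui] /in_triP[j vj].
    have ij : i != j by apply: contra_neq uv => h; rewrite ui vj h.
    by move: sz; rewrite ui vj => /(segmentP _ (nT _ KT1) ij)[].
  case: (boolP (c K)) => cK; case: (boolP (c K')) => cK' //.
  + by rewrite -!PE//; exact: szc.
  + exact: (edge0 K K' u v).
  + by apply/esym; exact: (edge0 K' K u v).
- move=> K v KT /in_triP[i vi] vx; rewrite /q; case: (c K) => //.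
  by rewrite Pn ?(negbTE vx)// vi; exact: lagrange_vtx.
- move=> K KT xK; rewrite /q cE// tE side_scale//; [|exact: nT|exact: osd].
  have -> : P K x = 1.
    by move: (xK) => /in_triP[i xi]; rewrite Pn ?eqxx//; rewrite xi; exact: lagrange_vtx.
  by case: (side x d K); case: (s); case: (0 < r).
Qed.

Lemma patch_conforming T t x e q a b : nondeg T -> conforming T ->
  patch_pieces T t x e q -> Omega x -> ~ vertices T0 x -> vertices T x ->
  created T0 T x a b -> crs (b - a) t = 0 ->
  conforming_family k Omega T0 T t q.
Proof.
move=> nT cT [qp qe qv qx] Ox nx xT cr par; split=> // z zT.
have [->|zx] := eqVneq z x; [right|left].
  split => //; first by exists a, b.
  exists (fun c => (c == e)%:R) => K KT xK; apply: qx => //.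
  exact: vertex_in_tri nT cT KT xT xK.
move=> K K' KT KT' zK zK'; rewrite !qv//.
  exact: vertex_in_tri nT cT KT' zT zK'.
exact: vertex_in_tri nT cT KT zT zK.
Qed.

(** [q] vanishes at every vertex other than [x], so the correction at [x] disturbs no other
    vertex. *)
Lemma conforming_subZ T t (p q : triangle R -> plane R -> R) x e (r : R) :
  nondeg T -> conforming T -> vertices T x ->
  conforming_family k Omega T0 T t p -> patch_pieces T t x e q ->
  (forall K K', K \in T -> K' \in T -> tri K x -> tri K' x ->
    p K x - r * q K x = p K' x - r * q K' x) ->
  conforming_family k Omega T0 T t (fun K z => p K z - r * q K z) /\
  (forall z, vertices T z -> single_valued T p z \/ z = x ->
    single_valued T (fun K z => p K z - r * q K z) z).
Proof.
move=> nT cT xT [pp pe pv] [qp qe qv qx] hx.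
have q0 K z : K \in T -> vertices T z -> z != x -> tri K z -> q K z = 0.
  by move=> KT zT zx zK; apply: qv => //; exact: vertex_in_tri nT cT KT zT zK.
have sv z : vertices T z -> single_valued T p z \/ z = x ->
    single_valued T (fun K z => p K z - r * q K z) z.
  move=> zT h K K' KT KT' zK zK'; have [zx|zx] := eqVneq z x.
    by rewrite zx in zK zK' *; exact: hx.
  case: h => [h|/eqP]; last by rewrite (negbTE zx).
  by rewrite !(q0 _ z)// (h K K').
split=> //; split.
- by move=> K KT; apply: poly_funB; [exact: pp | apply: poly_funZ; exact: qp].
- move=> K K' u v KT KT' uv uK uK' vK vK' nt z sz.
  by rewrite (pe K K' u v)// (qe K K' u v).
- move=> z zT; have [zx|zx] := eqVneq z x; first by left; apply: sv => //; right.
  case: (pv z zT) => [h|[Oz nz cz [c hc]]]; [left|right]; first by apply: sv => //; left.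
  by split => //; exists c => K KT zK; rewrite (q0 K z)// mulr0 subr0; exact: hc.
Qed.

End PatchFamily.

(** * Conforming families in the extended space *)

Section ExtendedSpace.
Variables (R : realType) (k : nat) (Omega : set (plane R)) (T0 : mesh R).
Hypotheses (mO : measurable (Omega : set (measurableTypeR R * measurableTypeR R)))
  (nT0 : nondeg T0) (dT0 : interior_disjoint T0) (k2 : (2 <= k)%N).
Local Notation mu := (lebesgue2 R).
Local Notation ext := (extended_stress_space k Omega T0).
Implicit Types (K L : triangle R) (T S : mesh R) (x y z u v w a b d t : plane R)
  (i j l : 'I_3) (p q : triangle R -> plane R -> R) (phi : plane R -> R).

Lemma dyad_parallel u v : u != 0 -> crs u v = 0 -> exists c : R, dyad v = c *: dyad u.
Proof.
by move=> u0 /(parallel_scale u0)[r ->]; exists (r ^+ 2); rewrite dyadZ.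
Qed.

Lemma I3_succ i : (i + 1 != i + 2) && (- ((i + 1) + (i + 2)) == i).
Proof. by elim/I3_ind: i. Qed.

Lemma I3_avoid i j : exists2 l, i != l & l != j.
Proof.
have [<-|ij] := eqVneq i j; first by exists (i + 1); elim/I3_ind: i.
by have /andP[h1 h2] := I3_third ij; exists (- (i + j)); first rewrite eq_sym.
Qed.

Lemma I3_edge i j l : i != j -> l = - (i + j) ->
  (i = l + 1 /\ j = l + 2) \/ (i = l + 2 /\ j = l + 1).
Proof.
move=> ij ->; move: ij; elim/I3_ind: i; elim/I3_ind: j => // _;
  [left|right|right|left|left|right]; split; exact/val_inj.
Qed.

Lemma shared_edge_single T p : nondeg T -> conforming T ->
  (forall K K' z, K \in T -> K' \in T -> z \in K -> z \in K' -> p K z = p K' z) ->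
  (forall K K' x y z, K \in T -> K' \in T -> x != y -> x \in K -> y \in K ->
    x \in K' -> y \in K' -> segment x y z -> p K z = p K' z) ->
  forall K K' z, K \in T -> K' \in T -> tri K z -> tri K' z -> p K z = p K' z.
Proof.
move=> nT cT hv he K K' z KT KT' zK zK'; have [<-//|KK'] := eqVneq K K'.
have [[? ?]|[x [y [xy [? ?] [? ?] _ sz]]]] := conforming_cap nT cT KT KT' KK' zK zK'.
  exact: hv.
exact: (he K K' x y).
Qed.

Lemma edge_bubble K l (f : plane R -> R) : nondegenerate_tri K -> poly_fun k f ->
  exists2 g, poly_fun (k - 2) g &
    forall z, bary K l z = 0 -> tri K z ->
      f z = bary K (l + 1) z * f (vtx K (l + 1)) + bary K (l + 2) z * f (vtx K (l + 2)) +
            bary K (l + 1) z * bary K (l + 2) z * g z.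
Proof.
move=> nK pf; have /andP[l12 /eqP l3] := I3_succ l.
pose h z := f z - (bary K (l + 1) z * f (vtx K (l + 1)) +
                   bary K (l + 2) z * f (vtx K (l + 2))).
have ph : poly_fun k h.
  apply: poly_funB => //; apply: (@poly_fun_leq R 1); first by lia.
  by apply: poly_fun_affine; have [a [b [c e]]] := affine_bary K (l + 1);
    have [a' [b' [c' e']]] := affine_bary K (l + 2);
    exists (a * f (vtx K (l + 1)) + a' * f (vtx K (l + 2))),
      (b * f (vtx K (l + 1)) + b' * f (vtx K (l + 2))),
      (c * f (vtx K (l + 1)) + c' * f (vtx K (l + 2))) => z; rewrite e e'; ring.
have h1 : h (vtx K (l + 1)) = 0.
  by rewrite /h !bary_vtx// eqxx eq_sym (negbTE l12) mul1r mul0r addr0 subrr.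
have h2 : h (vtx K (l + 2)) = 0.
  by rewrite /h !bary_vtx// eqxx (negbTE l12) mul1r mul0r add0r subrr.
have b1 : bary K (l + 2) (vtx K (l + 1)) = 0 by rewrite bary_vtx// eq_sym (negbTE l12).
have b2 : bary K (l + 2) (vtx K (l + 2)) = 1 by rewrite bary_vtx// eqxx.
have [g pg hg] := poly_fun_edge_factor k2 ph (affine_bary K (l + 2)) b1 b2 h1 h2.
exists g => // z lz zK.
have sz : segment (vtx K (l + 1)) (vtx K (l + 2)) z by apply/segmentP; rewrite ?l3.
have := hg z sz; rewrite /h.
have -> : 1 - bary K (l + 2) z = bary K (l + 1) z.
  by have := sum_bary z nK; rewrite (sum_I3_third _ l12) l3 lz; lra.
lra.
Qed.

Lemma conforming_single_ext T p t : triangulation Omega T -> t != 0 ->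
  conforming_family k Omega T0 T t p ->
  (forall z, vertices T z -> single_valued T p z) ->
  ext T (fun x => glue T p x *: dyad t).
Proof.
move=> [nT cT uT] t0 [pp pe _] sv; have dT := conforming_disjoint nT cT.
pose par K l := crs (vtx K (l + 2) - vtx K (l + 1)) t == 0.
have ll i : i + 1 != i + 2 by have /andP[] := I3_succ i.
have l3 i : - ((i + 1) + (i + 2)) = i by have /andP[_ /eqP] := I3_succ i.
have /boolp.choice[q hq] : forall Kl : triangle R * 'I_3, exists g : plane R -> R,
    Kl.1 \in T -> [/\ poly_fun (k - 2) g, ~~ par Kl.1 Kl.2 -> g = fun=> 0 &
    par Kl.1 Kl.2 -> forall z, bary Kl.1 Kl.2 z = 0 -> tri Kl.1 z -> p Kl.1 z =
      bary Kl.1 (Kl.2 + 1) z * p Kl.1 (vtx Kl.1 (Kl.2 + 1)) +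
      bary Kl.1 (Kl.2 + 2) z * p Kl.1 (vtx Kl.1 (Kl.2 + 2)) +
      bary Kl.1 (Kl.2 + 1) z * bary Kl.1 (Kl.2 + 2) z * g z].
  move=> [K l] /=; case: (boolP (K \in T)) => [KT|]; last by exists (fun=> 0).
  case: (boolP (par K l)) => pl; last by exists (fun=> 0) => _; split => //; exact: poly_fun0.
  by have [g pg hg] := edge_bubble l (nT K KT) (pp K KT); exists g.
(* The bubble of the edge opposite [l]. It vanishes on the other two edges, and identically unless
   its edge is parallel to [t], as required for the direction of a bubble. *)
pose beta K l z := bary K (l + 1) z * bary K (l + 2) z * q (K, l) z.
pose p' K z := p K z - \sum_l beta K l z.
have beta0 K l l' z : l != l' -> bary K l' z = 0 -> beta K l z = 0.
  move=> lN bz; have [l'E|l'E] : l' = l + 1 \/ l' = l + 2.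
    case: (I3_other l' (ll l)); [by left | by right | rewrite l3 => e].
    by rewrite e eqxx in lN.
  - by rewrite /beta -l'E bz !mul0r.
  - by rewrite /beta -l'E bz mulr0 mul0r.
have betaE K l z : bary K l z = 0 -> \sum_i beta K i z = beta K l z.
  by move=> bz; rewrite (bigD1 l)//= big1 ?addr0// => i il; exact: beta0 il bz.
have p'v K z : K \in T -> z \in K -> p' K z = p K z.
  move=> KT /in_triP[i zi]; rewrite /p' big1 ?subr0// => l _.
  have [m lm mi] := I3_avoid l i.
  by apply: (@beta0 K l m _ lm); rewrite zi bary_vtx ?(negbTE mi)//; exact: nT.
have crsN u : crs (- u) t = - crs u t by rewrite /crs /dot /=; ring.
(* Edges not parallel to [t] keep their trace; on the others only the interpolant of the vertex
   values is left. *)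
have p'e K x y z : K \in T -> x != y -> x \in K -> y \in K -> segment x y z ->
    (crs (y - x) t != 0 -> p' K z = p K z) /\
    (crs (y - x) t = 0 -> forall s : R, z = (1 - s) *: x + s *: y ->
      p' K z = (1 - s) * p K x + s * p K y).
  move=> KT xy /in_triP[i xi] /in_triP[j yj] sz; have nK := nT K KT.
  have ij : i != j by apply: contra_neq xy => e; rewrite xi yj e.
  move: (sz); rewrite {1}xi {1}yj => /(segmentP _ nK ij)[zK].
  set l := - (i + j) => bz.
  have [_ q0 q1] := hq (K, l) KT.
  have parE : par K l = (crs (y - x) t == 0).
    rewrite /par xi yj; have [h1 h2] := andP (I3_third ij).
    case: (I3_edge ij (erefl l)) => -[-> ->] //; by rewrite -[in RHS]opprB crsN oppr_eq0.
  rewrite /p' (betaE K l)//; split => h.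
    by rewrite /beta q0 ?mulr0 ?subr0// parE.
  move=> s zE; have {}q1 := q1 _ z bz zK.
  rewrite q1 ?parE ?h ?eqxx// /beta /= addrK.
  have bs m : bary K m z = (1 - s) * (i == m)%:R + s * (j == m)%:R.
    rewrite zE affine_segment; last exact: affine_bary.
    by rewrite xi yj !bary_vtx// ![m == _]eq_sym.
  have ji : (j == i) = false by rewrite eq_sym (negbTE ij).
  case: (I3_edge ij (erefl l)) => -[iE jE]; rewrite xi yj -iE -jE !bs !eqxx (negbTE ij) ji /=; ring.
have sv' : forall K K' z, K \in T -> K' \in T -> tri K z -> tri K' z -> p' K z = p' K' z.
  have tri_v K v : v \in K -> tri K v by move=> /in_triP[i ->]; exact: tri_vtx.
  have svv K K' z : K \in T -> K' \in T -> z \in K -> z \in K' -> p K z = p K' z.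
    by move=> KT KT' zK zK'; apply: sv => //; [exists K | exact: tri_v..].
  apply: shared_edge_single => // [K K' z KT KT' zK zK'|K K' x y z KT KT' xy xK yK xK' yK' sz].
    by rewrite !p'v//; exact: svv.
  have [e1 e2] := p'e K x y z KT xy xK yK sz.
  have [e1' e2'] := p'e K' x y z KT' xy xK' yK' sz.
  have [h|h] := eqVneq (crs (y - x) t) 0; last by rewrite e1// e1'//; exact: (pe K K' x y).
  case: (sz) => s _ /esym zE; rewrite (e2 h s zE) (e2' h s zE).
  by rewrite (svv K K' x)// (svv K K' y).
have subO : Omega `<=` mesh_union T by rewrite uT; exact: subset_closure.
have pp' K : K \in T -> poly_fun k (p' K).
  move=> KT; apply: poly_funB; first exact: pp.
  apply: poly_fun_sum => l _; have -> : k = (1 + 1 + (k - 2))%N by lia.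
  by apply: poly_funM; [apply: poly_funM; exact/poly_fun_affine/affine_bary |
    have [] := hq (K, l) KT].
have e1 : ext T (fun x => glue T p' x *: dyad t).
  apply: stress_ext => //; apply: H1_stress_space => //.
    by apply: H1_sym_dyad => //; exact: glue_H1 mO nT dT subO pp' sv'.
  move=> K KT; exists (fun x => p' K x *: dyad t).
    split; first by move=> x; rewrite linearZ /= dyad_sym.
    move=> i j; apply: poly_fun_ext (poly_funZ (dyad t i j) (pp' K KT)) => x.
    by rewrite [RHS]mxE mulrC.
  apply: aeW => x xK; congr (_ *: _); apply: glue_in => // K' KT' xK'; exact: sv'.
pose F K x := if K \in T then \sum_l (\1_(tri K) x * beta K l x) *: dyad t else 0.
have e2 : ext T (fun x => \sum_(K <- T) F K x).
  apply: ext_sum => // K; rewrite /F.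
  case: (boolP (K \in T)) => KT; last exact/stress_ext/stress_space0.
  apply: ext_sum => // l; have [pq q0 _] := hq (K, l) KT.
  have [h|h] := boolP (par K l); last first.
    have -> : (fun x => (\1_(tri K) x * beta K l x) *: dyad t) = (fun=> 0).
      by apply/funext => x; rewrite /beta q0// !mulr0 scale0r.
    exact/stress_ext/stress_space0.
  have nz : vtx K (l + 2) - vtx K (l + 1) != 0.
    by rewrite subr_eq0 (inj_eq (vtx_inj (nT K KT))) eq_sym ll.
  have [c ->] := dyad_parallel nz (eqP h).
  by apply: stress_ext => //; exact: bubble_stress_space.
apply: ext_ae (extD e1 e2) _.
have := ae_generic nT; apply: ae_imp => x gx Ox /=.
have [K KT xK] := subO x Ox.
rewrite !(glue_generic _ nT dT gx KT xK) (bigD1_seq K)//= big1_seq ?addr0.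
  rewrite /F KT -scaler_suml -scalerDl; congr (_ *: _).
  by rewrite -mulr_sumr indicE mem_set// mul1r /p' subrK.
move=> K' /andP[KK' KT']; rewrite /F KT' big1// => l _.
rewrite indicE memNset ?mul0r ?scale0r// => xK'.
by case/eqP: KK'; apply/esym; exact: (generic_unique nT dT gx).
Qed.

Lemma conforming_ext T p t : nvb_refine T0 T -> triangulation Omega T -> t != 0 ->
  conforming_family k Omega T0 T t p -> ext T (fun x => glue T p x *: dyad t).
Proof.
move=> T0T tT t0 cp; have [nT cT uT] := tT; have dT := conforming_disjoint nT cT.
have k0 : (0 < k)%N by lia.
(* Induction on a list [s] of points outside which the family is single valued; all vertices of the
   mesh serve as the initial list. *)
suff h (s : seq (plane R)) f : conforming_family k Omega T0 T t f ->
    (forall z, vertices T z -> z \notin s -> single_valued T f z) ->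
    ext T (fun x => glue T f x *: dyad t).
  apply: (h (flatten [seq tval K | K <- T]) p cp) => z [K KT zK] /negP[].
  by apply/flattenP; exists (tval K) => //; exact: map_f.
elim: s f => [|x s IH] f cf hf.
  by apply: conforming_single_ext => // z zT; exact: hf.
have [[xT nsv]|hx] := pselect (vertices T x /\ ~ single_valued T f x); last first.
  apply: IH => // z zT zs; have [zx|zx] := eqVneq z x.
    by rewrite zx in zT *; apply: contrapT => nsv; apply: hx.
  by apply: hf => //; rewrite inE negb_or zx.
have [_ _ /(_ x xT)[//|[Ox nx [a [b [cr par]]] [c hc]]]] := cf.
have [phi nphi] := nodal_basis_exists k0 nT cT xT.
(* One half patch is enough to remove the jump; [false] selects the positive one. *)
have [q [e [pq qE]]] := extra_field_patch nT0 dT0 k0 false nT cT T0T xT cr nphi t0 par.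
have xin K : K \in T -> tri K x -> x \in K.
  by move=> KT xK; exact: vertex_in_tri nT cT KT xT xK.
(* The jump at [x], counted from the side without the patch, whose value remains on both sides. *)
pose r := c e - c (~~ e).
have fq K : K \in T -> tri K x -> f K x - r * q K x = c (~~ e).
  move=> KT xK; have [_ _ _ qx] := pq; rewrite hc// qx//; last exact: xin.
  by rewrite /r; case: eqP => [->|]; [|case: (side x t K); case: (e) => // _] => /=; ring.
have hx K K' : K \in T -> K' \in T -> tri K x -> tri K' x ->
    f K x - r * q K x = f K' x - r * q K' x.
  by move=> KT KT' xK xK'; rewrite !fq.
have [cf' sv'] := conforming_subZ nT cT xT cf pq hx.
have e1 : ext T (fun y => glue T (fun K z => f K z - r * q K z) y *: dyad t).
  apply: IH => // z zT zs; apply: sv' => //.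
  have [->|zx] := eqVneq z x; [by right | left].
  by apply: hf => //; rewrite inE negb_or zx.
have d0 := tangent_neq0 (created_neq nT0 cr).
have [kap dE] : exists kap : R, dyad t = kap *: dyad (tangent a b).
  by apply: dyad_parallel => //; rewrite /tangent crsZl par mulr0.
have e2 := extra_ext (r * kap) (ex_intro _ x (ex_intro _ a (ex_intro _ b
  (ex_intro _ phi (ex_intro _ false (And4 (conj (conj xT Ox) nx) cr nphi erefl))))))
  : ext T _.
apply: ext_ae (extD e1 e2) _.
have := ae_generic nT; apply: ae_imp => y gy Oy /=.
have subO : Omega `<=` mesh_union T by rewrite uT; exact: subset_closure.
have [K KT yK] := subO y Oy.
rewrite qE// !(glue_generic _ nT dT gy KT yK) dE !scalerA -scalerDl.
by congr (_ *: _); ring.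
Qed.

Lemma conforming_familyZ T t p (c : R) : conforming_family k Omega T0 T t p ->
  conforming_family k Omega T0 T t (fun K z => c * p K z).
Proof.
move=> [pp pe pv]; split=> [K KT|K K' x y KT KT' xy xK xK' yK yK' nt z sz|z zT].
- by apply: poly_funZ; exact: pp.
- by rewrite (pe K K' x y).
- case: (pv z zT) => [sv|[? ? ? [c' hc]]]; [left|right].
    by move=> K K' KT KT' zK zK'; rewrite (sv K K').
  by split => //; exists (fun e => c * c' e) => K KT zK; rewrite hc.
Qed.

Lemma refine_ext T That p t : nvb_refine T0 T -> triangulation Omega T ->
  triangulation Omega That -> nvb_refine T That ->
  (forall z, nbhs z (closure Omega) -> Omega z) -> t != 0 ->
  conforming_family k Omega T0 T t p -> ext That (fun x => glue T p x *: dyad t).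
Proof.
move=> T0T tT tT' TT' intO t0 cp.
have [nT cT uT] := tT; have [nT' cT' uT'] := tT'.
have dT := conforming_disjoint nT cT; have dT' := conforming_disjoint nT' cT'.
have /boolp.choice[par hpar] : forall L, exists K, L \in That ->
    K \in T /\ tri L `<=` tri K.
  move=> L; case: (boolP (L \in That)) => [LT|]; last by exists L.
  by have [K KT LK] := refine_parent TT' nT LT; exists K.
have cp' := conforming_refine nT0 dT0 T0T tT tT' TT' intO hpar t0 cp.
apply: ext_ae (conforming_ext (refine_trans T0T TT') tT' t0 cp') _.
apply: ae_imp2 (ae_generic nT) (ae_generic nT') => x gx gx' Ox; congr (_ *: _).
have : closure Omega x by exact: subset_closure.
rewrite -uT' => -[L LT xL]; have [KT LK] := hpar L LT.
by rewrite (glue_generic _ nT' dT' gx' LT xL) (glue_generic _ nT dT gx KT (LK _ xL)).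
Qed.

(* A bubble vanishes on every edge that is not parallel to its direction. *)
Lemma bubble_conforming T K i j g : nondeg T -> conforming T -> K \in T -> i != j ->
  poly_fun (k - 2) g ->
  conforming_family k Omega T0 T (vtx K j - vtx K i)
    (fun L z => if L == K then bary K i z * bary K j z * g z else 0).
Proof.
move=> nT cT KT ij pg; have nK := nT K KT.
pose f L z := if L == K then bary K i z * bary K j z * g z else 0.
have f0 L z : L \in T -> z \in L -> f L z = 0.
  rewrite /f; case: eqP => // -> _ /in_triP[l ->]; rewrite !bary_vtx//.
  case: eqP => [<-|]; last by rewrite !mul0r.
  by rewrite [j == i]eq_sym (negbTE ij) mulr0 mul0r.
split.
- move=> L LT; case: (L == K); last exact: poly_fun0.
  have -> : k = (1 + 1 + (k - 2))%N by lia.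
  by apply: poly_funM => //; apply: poly_funM; exact/poly_fun_affine/affine_bary.
- move=> L L' x y LT LT' xy xL xL' yL yL' nt z sz.
  suff e M : M \in T -> x \in M -> y \in M -> f M z = 0 by rewrite -!/(f _ _) !e.
  move=> MT xM yM; rewrite /f; case: eqP => // MK; rewrite MK in xM yM.
  move: xM yM => /in_triP[u xu] /in_triP[v yv].
  have uv : u != v by apply: contra_neq xy => e; rewrite xu yv e.
  move: sz; rewrite {1}xu {1}yv => /(segmentP _ nK uv)[_ z0].
  (* An edge of [K] is opposite [i] or [j], where a factor vanishes, or it joins them and is
     parallel to the direction. *)
  case: (I3_other (- (u + v)) ij) => lE; rewrite lE in z0; rewrite ?z0 ?mul0r ?mulr0 ?mul0r//.
  case/eqP: nt; rewrite xu yv; have [h1 h2] := andP (I3_third uv).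
  rewrite lE in h1 h2.
  have ends m : - (i + j) != m -> m = i \/ m = j.
    by move=> h; case: (I3_other m ij) => mE; [left|right|rewrite mE eqxx in h].
  have crsN u1 w1 : crs (- u1) w1 = - crs u1 w1 by rewrite /crs /dot /=; ring.
  case: (ends u h1) uv => -> ; case: (ends v h2) => ->; rewrite ?eqxx// => _.
    by rewrite crsxx.
  by rewrite -opprB crsN crsxx oppr0.
- move=> z zT; left => L L' LT LT' zL zL'.
  by rewrite -!/(f _ _) !f0//; [exact: vertex_in_tri nT cT LT' zT zL' |
    exact: vertex_in_tri nT cT LT zT zL].
Qed.

End ExtendedSpace.

(** * Inclusion of the extended stress spaces *)

Theorem theorem3p2 (R : realType) (Omega : set (plane R)) (T0 : mesh R)
  (k : nat) (T That : mesh R)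
  (hOmega : bounded_polygonal_domain Omega)
  (hsc : simply_connected Omega)
  (hT0 : triangulation Omega T0)
  (hk : (3 <= k)%N)
  (hT : admissible Omega T0 T)
  (hThat : admissible Omega T0 That)
  (href : nvb_refine T That) :
  extended_stress_space k Omega T0 T `<=` extended_stress_space k Omega T0 That.
Proof.
have [_ oO _ _ _] := hOmega.
have mO := open_plane_measurable oO.
have intO z : nbhs z (closure Omega) -> Omega z by exact: polygonal_interior.
have [nT0 cT0 uT0] := hT0; have dT0 := conforming_disjoint nT0 cT0.
have [T0T tT] := hT; have [_ tT'] := hThat.
have [nT cT uT] := tT; have dT := conforming_disjoint nT cT.
have k2 : (2 <= k)%N by lia.
have k0 : (0 < k)%N by lia.
have subO : Omega `<=` mesh_union T by rewrite uT; exact: subset_closure.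
move=> sigma [s1 [_ [sc [sb [s1E Hc pc pb]]]] [s2 [n [c [f [hf s2E]]]] sE]].
have ec : extended_stress_space k Omega T0 That sc.
  apply: stress_ext => //; apply: H1_stress_space => // L LT.
  have [K KT LK] := refine_parent href nT LT.
  have [p pp e] := pc K KT; exists p => //.
  by apply: ae_imp e => x e xL; apply: e; exact: LK.
have /boolp.choice[p hp] : forall K, exists p : 'I_3 -> 'I_3 -> plane R -> R,
    K \in T -> (forall i j, poly_fun (k - 2) (p i j)) /\
    \forall x \ae lebesgue2 R, tri K x -> sb x = \sum_(i < 3) \sum_(j < 3 | (i < j)%N)
      (bary K i x * bary K j x * p i j x) *: dyad (vtx K j - vtx K i).
  move=> K; case: (boolP (K \in T)) => [KT|]; last by exists (fun _ _ _ => 0).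
  have [q [p pp qE] e] := pb K KT; exists p => _; split => //.
  by apply: ae_imp e => x e xK; rewrite e.
(* A conforming family has one direction, so the bubble part is split into one family, extended by
   zero, for each triangle and edge. *)
pose F (K : triangle R) (i j : 'I_3) (L : triangle R) z :=
  if L == K then bary K i z * bary K j z * p K i j z else 0.
pose G (K : triangle R) x := if K \in T then \sum_(i < 3) \sum_(j < 3)
  (if (i < j)%N then glue T (F K i j) x *: dyad (vtx K j - vtx K i) else 0) else 0.
have eb : extended_stress_space k Omega T0 That (fun x => \sum_(K <- T) G K x).
  apply: ext_sum => // K; rewrite /G.
  case: (boolP (K \in T)) => KT; last exact/stress_ext/stress_space0.
  apply: ext_sum => // i; apply: ext_sum => // j.
  have [ij|_] := ltnP i j; last exact/stress_ext/stress_space0.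
  have {}ij : i != j by apply: contraTneq ij => ->; rewrite ltnn.
  apply: (refine_ext mO nT0 dT0 k2 T0T tT tT' href intO).
    by rewrite subr_eq0 (inj_eq (vtx_inj (nT K KT))) eq_sym.
  by apply: bubble_conforming => //; apply: (hp K KT).1.
have es : extended_stress_space k Omega T0 That (fun x => \sum_(i < n) c i *: f i x).
  apply: ext_sum => // i.
  have [x [a [b [phi [s [[[xT Ox] nx] cr nphi ->]]]]]] := hf i.
  have ab := created_neq nT0 cr.
  have par : crs (b - a) (tangent a b) = 0.
    by rewrite crs_tangent crsxx mulr0.
  have [q [e [pq qE]]] :=
    extra_field_patch nT0 dT0 k0 s nT cT T0T xT cr nphi (tangent_neq0 ab) par.
  have cq := conforming_familyZ (c i) (patch_conforming nT cT pq Ox nx xT cr par).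
  apply: ext_ae (refine_ext mO nT0 dT0 k2 T0T tT tT' href intO (tangent_neq0 ab) cq) _.
  apply: ae_imp (ae_generic nT) => y gy Oy; rewrite qE// scalerA.
  have [K KT yK] := subO y Oy.
  by rewrite !(glue_generic _ nT dT gy KT yK).
apply: ext_ae (extD (extD ec eb) es) _.
have sbE : \forall x \ae lebesgue2 R, forall K, K \in T -> tri K x -> sb x = G K x.
  apply: ae_seq => K KT; apply: ae_imp2 (ae_generic nT) (hp K KT).2 => x gx e xK.
  rewrite e// /G KT; apply: eq_bigr => i _; rewrite big_mkcond; apply: eq_bigr => j _.
  by case: ifP => // _; rewrite (glue_generic _ nT dT gx KT xK) /F eqxx.
have {}sbE : sb = (fun x => \sum_(K <- T) G K x) %[ae lebesgue2 R in Omega].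
  apply: ae_imp2 (ae_generic nT) sbE => x gx e Ox; have [K KT xK] := subO x Ox.
  rewrite (e K)// (bigD1_seq K)//= big1_seq ?addr0// => L /andP[LK LT].
  rewrite /G LT big1// => i _; rewrite big1// => j _; case: ifP => // _.
  rewrite (glue_generic _ nT dT gx KT xK) /F eq_sym (negbTE LK) scale0r//.
apply: ae_imp2 sE (ae_imp2 _ s1E sbE) => x; last by move=> e1 e2; exact: (conj e1 e2).
by move=> e [e1 e2] Ox; rewrite e//= e1//= e2// s2E.
Qed.
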